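(* Let $W$ be an irreducible Weyl group with complex reflection representation $\mathfrak h$, $L\subset\mathfrak h$ a $W$-invariant $\mathbb Z$-lattice, and $H=\mathfrak h/2\pi iL$. Let $c$ be a conjugation-invariant function on the set of reflection hypertori in $H$, and let $H_c(W,H)$ be the degenerate double affine Hecke algebra (trigonometric Cherednik algebra). Then the polynomial representation $M=\mathbb C[H]$ of $H_c(W,H)$ is reducible if and only if $$c\in\bigcup_{g\in\Sigma}\mathrm{Red}_g(W,L).$$
   Context: Root data. For each reflection $s\in W$, $\alpha_s^\vee$ is a generator of the intersection of $L$ with the $(-1)$-eigenspace of $s$ in $\mathfrak h$, and $\alpha_s\in\mathfrak h^*$ satisfies $s\alpha_s=-\alpha_s$, $(\alpha_s,\alpha_s^\vee)=2$. Then $R=\{\pm\alpha_s\}$ and $R^\vee=\{\pm\alpha_s^\vee\}$ are mutually dual reduced root systems, and $L$ lies between the coroot lattice $Q^\vee$ and the coweight lattice $P^\vee$. $H$ is identified with the maximal torus of the simple complex Lie group $G$ with root system $R$ and center $P^\vee/L$; $\mathfrak g=\mathrm{Lie}(G)$. For $g\in H$, $C_{\mathfrak g}(g)$ is the centralizer of $g$ in $\mathfrak g$ and $W_g$ is the stabilizer of $g$ in $W$. $\Sigma\subset H$ is the (finite) set of elements $g$ for which $C_{\mathfrak g}(g)$ is semisimple. Degenerate DAHA. A reflection hypertorus is a connected component $T$ of the fixed set $H^s$ of a reflection $s\in W$; $s_T=s$ is the corresponding reflection, and $\chi_T:H\to\mathbb C^*$ is the affine linear map (a constant times a character) with $\chi_T^{-1}(1)=T$.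 $H_{\rm reg}$ is the complement of all reflection hypertori. $H_c(W,H)$ is the subalgebra of $\mathbb C[W]\ltimes D(H_{\rm reg})$ generated by regular functions on $H$, the group $W$, and the trigonometric Dunkl operators $$\partial_a+\sum_Tc(T)\frac{d\chi_T(a)}{\chi_T-1}(s_T-1),\qquad a\in\mathfrak h,$$ where $d\chi_T(a)$ is the derivative of $\chi_T$ along the invariant vector field $a$. It preserves $M=\mathbb C[H]$, the space of regular functions on $H$ (the polynomial representation). Rational Cherednik algebra. For a finite group $\Gamma\subset GL(\mathfrak h)$ generated by or containing reflections (elements $s\ne1$ with $\mathrm{rk}(s-1)=1$) and a conjugation-invariant function $k$ on its reflections (all of order 2 here), $H_k(\Gamma,\mathfrak h)$ is the quotient of $\mathbb C[\Gamma]\ltimes T(\mathfrak h\oplus\mathfrak h^* )$ by $[x,x']=0$, $[y,y']=0$, $[y,x]=(y,x)-\sum_sk_s(y,\alpha_s)(x,\alpha_s^\vee)s$ ($x,x'\in\mathfrak h^*$, $y,y'\in\mathfrak h$). Its polynomial representation is $M_k(\Gamma,\mathfrak h,\mathbb C)=H_k(\Gamma,\mathfrak h)\otimes_{\mathbb C[\Gamma]\ltimes\mathbb C[\mathfrak h^*]}\mathbb C$ ($\Gamma$ acting trivially and $\mathfrak h$ by $0$ on $\mathbb C$), equivalently $\mathbb C[\mathfrak h]$ with $y$ acting by $\partial_y+\sum_sk_s\frac{\alpha_s(y)}{\alpha_s}(s-1)$. $\mathrm{Red}(\Gamma,\mathfrak h)$ is the set of $k$ for which it is reducible. For $g\in\Sigma$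 and a reflection $s\in W_g$, $c_g(s)$ is the value of $c$ on the unique reflection hypertorus passing through $g$ and fixed by $s$. $\mathrm{Red}_g(W,L)$ is the set of $c$ such that $c_g\in\mathrm{Red}(W_g,\mathfrak h)$. *)

(* Defs.v *)
From HB Require Import structures.
From mathcomp Require Import all_boot all_order all_fingroup all_algebra.
From mathcomp Require Import generic_quotient ring_quotient mxrepresentation.
From mathcomp Require Import all_classical all_reals all_analysis.
From mathcomp Require Import complex.
From mathcomp Require mpoly.

Set Implicit Arguments.
Unset Strict Implicit.
Unset Printing Implicit Defensive.

Import Order.TTheory GRing.Theory Num.Theory.
Import numFieldNormedType.Exports.
Import complex.

Local Open Scope classical_set_scope.
Local Open Scope quotient_scope.
Local Open Scope ring_scope.

(* The complex numbers.  The named structure (rather than its carrier R[i]) is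
   what gives them and their matrices the topology of [numFieldNormedType]. *)
Definition Cplx (R : realType) : numClosedFieldType := complex R.

Section OperatorAlgebras.
Context {K : pzRingType} {V : lmodType K}.

Inductive generated_algebra (S : set (V -> V)) : (V -> V) -> Prop :=
| gen_algebra_one : generated_algebra S idfun
| gen_algebra_gen X : S X -> generated_algebra S X
| gen_algebra_lin a X Y : generated_algebra S X -> generated_algebra S Y ->
    generated_algebra S (fun v => a *: X v + Y v)
| gen_algebra_comp X Y : generated_algebra S X -> generated_algebra S Y ->
    generated_algebra S (X \o Y).

Definition submodule (A : set (V -> V)) (N : set V) :=
  [/\ N 0,
      forall a u v, N u -> N v -> N (a *: u + v)
    & forall X v, A X -> N v -> N (X v)].

Definition reducible_module (A : set (V -> V)) (M : set V) :=
  exists N : set V, [/\ submodule A N, N `<=` M, N <> [set 0] & N <> M].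

End OperatorAlgebras.

Section LieAlgebras.
Context {K : fieldType} {gg : vectType K}.

Record lie_bracket (br : gg -> gg -> gg) : Prop := LieBracket {
  lie_linear_l : forall z, linear (br^~ z);
  lie_linear_r : forall x, linear (br x);
  lie_alternating : forall x, br x x = 0;
  lie_jacobi : forall x y z,
    br x (br y z) + br y (br z x) + br z (br x y) = 0 }.

Variable br : gg -> gg -> gg.

Definition lie_prod (U V : {vspace gg}) : {vspace gg} :=
  <<[seq br x y | x <- vbasis U, y <- vbasis V]>>%VS.

Definition lie_ideal (k I : {vspace gg}) : Prop :=
  (I <= k)%VS /\ (lie_prod k I <= I)%VS.

Definition lie_solvable (I : {vspace gg}) : Prop :=
  exists m, iter m (fun U => lie_prod U U) I = 0%VS.

Definition lie_semisimple (k : {vspace gg}) : Prop :=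
  forall I, lie_ideal k I -> lie_solvable I -> I = 0%VS.

Definition lie_simple (k : {vspace gg}) : Prop :=
  lie_prod k k <> 0%VS /\ forall I, lie_ideal k I -> I = 0%VS \/ I = k.

End LieAlgebras.

(* The reflection representation is the space of row vectors ['rV[C]_n], on
   which a group element [w] acts by [v |-> v *m rW w]; its dual is the space of
   column vectors.  For the corresponding left action [w v = v *m rW w^-1], the
   action of [w] on functions is [(w f) v = f (w^-1 v) = f (v *m rW w)]. *)

Definition pairing {K : pzRingType} {n} (v : 'rV[K]_n) (l : 'cV[K]_n) : K :=
  (v *m l) 0 0.

Section Weyl.
Context {K : fieldType} {gT : finGroupType} {W : {group gT}} {n : nat}.
Variable rW : mx_representation K W n.

Definition reflection (s : gT) : bool :=
  (s \in W) && (\rank (rW s - 1%:M) == 1%N).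

Definition reflection_mx (al : 'cV[K]_n) (av : 'rV[K]_n) : 'M[K]_n :=
  1%:M - al *m av.

(* Root systems in the sense of Bourbaki, Lie VI.1.1, over any field of
   characteristic 0. *)
Record root_system (Phi : seq 'cV[K]_n) (coroot : 'cV[K]_n -> 'rV[K]_n) :
    Prop := RootSystem {
  root_neq0 : 0 \notin Phi;
  root_span : <<Phi>>%VS = fullv;
  root_coroot : {in Phi, forall al, pairing (coroot al) al = 2};
  root_stable : {in Phi &, forall al be,
    reflection_mx al (coroot al) *m be \in Phi};
  root_integral : {in Phi &, forall al be,
    exists m : int, pairing (coroot al) be = m%:~R} }.

Definition weyl_group_repr : Prop :=
  mx_faithful rW /\
  exists Phi coroot, let refl al := reflection_mx al (coroot al) in
  [/\ root_system Phi coroot,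
      {in Phi, forall al, exists2 s, s \in W & rW s = refl al}
    & W :=: <<[set s in W | has (fun al => rW s == refl al) Phi]>>%g].

End Weyl.

Section Torus.
Context {R : realType} {n : nat}.
Local Notation C := (Cplx R).

Definition cexp (z : C) : C :=
  (expR (Re z) * cos (Im z) +i* (expR (Re z) * sin (Im z)))%C.

(* 2 pi i *)
Definition twopii : C := (0 +i* (pi *+ 2))%C.

Definition is_lattice (L : {pred 'rV[C]_n}) : Prop :=
  exists2 B : 'M[C]_n, B \in unitmx &
    forall v, v \in L <-> exists m : 'rV[int]_n, v = map_mx intr m *m B.

Definition dual_lattice (L : {pred 'rV[C]_n}) : set 'cV[C]_n :=
  [set l | forall v, v \in L -> exists m : int, pairing v l = m%:~R].

Definition periods (L : {pred 'rV[C]_n}) : {pred 'rV[C]_n} :=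
  [pred v | twopii^-1 *: v \in L].

Lemma periods_zmod_closed (L : zmodClosed 'rV[C]_n) : zmod_closed (periods L).
Proof.
split=> [|u v]; rewrite !inE ?scaler0 ?rpred0 //.
by move=> Lu Lv; rewrite scalerBr rpredB.
Qed.

HB.instance Definition _ (L : zmodClosed 'rV[C]_n) :=
  GRing.isZmodClosed.Build 'rV[C]_n (periods L) (periods_zmod_closed L).

(* h / 2 pi i L, with [topi L] the projection from h. *)
Definition torus (L : zmodClosed 'rV[C]_n) : zmodType :=
  Quotient.quot (periods L).

Definition topi (L : zmodClosed 'rV[C]_n) (v : 'rV[C]_n) : torus L :=
  \pi_(Quotient.quot (periods L)) v.

(* The regular functions on [torus L] are the linear combinations of the
   characters [exp l], for [l] in the dual lattice. *)
Definition regular_function (L : zmodClosed 'rV[C]_n) : set (torus L -> C^o) :=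
  [set f | exists m (a : 'I_m -> C) (l : 'I_m -> 'cV[C]_n),
     (forall i, dual_lattice L (l i)) /\
     forall v, f (topi L v) = \sum_i a i * cexp (pairing v (l i))].

Definition invariant_derivative (L : zmodClosed 'rV[C]_n) (a : 'rV[C]_n)
    (f : torus L -> C^o) (x : torus L) : C :=
  derive1 (fun t : C => f (x + topi L (t *: a))) 0.

(* A nonzero constant times a character. *)
Definition affine_linear (L : zmodClosed 'rV[C]_n) (f : torus L -> C) : Prop :=
  exists2 z : C, z != 0 & exists2 l, dual_lattice L l &
    forall v, f (topi L v) = z * cexp (pairing v l).

Definition torus_component (L : zmodClosed 'rV[C]_n) (A : set (torus L))
    (x : torus L) : set (torus L) :=
  @connected_component (quotient_topology (Quotient.quot (periods L))) A x.

Definition polynomial_function : set ('rV[C]_n -> C^o) :=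
  [set f : 'rV[C]_n -> C^o | exists p : mpoly.mpoly n C,
     forall v : 'rV[C]_n, f v = mpoly.meval (fun i => v 0 i) p].

Definition directional_derivative (a : 'rV[C]_n) (f : 'rV[C]_n -> C^o)
    (v : 'rV[C]_n) : C :=
  derive1 (fun t : C => f (v + t *: a)) 0.

End Torus.

Section Cherednik.
Context {R : realType} {gT : finGroupType} {W : {group gT}} {n : nat}.
Local Notation C := (Cplx R).
Variable rW : mx_representation C W n.

Section Rational.
Variables (Gamma : {set gT}) (alpha : gT -> 'cV[C]_n) (k : gT -> C).

Definition hreg : set 'rV[C]_n :=
  [set v | forall s, reflection rW s -> s \in Gamma ->
     pairing v (alpha s) != 0].

(* Functions on [hreg] are represented by their extension by 0. *)
Definition dunkl_operator (y : 'rV[C]_n) (f : 'rV[C]_n -> C^o) :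
    'rV[C]_n -> C^o :=
  (fun v => directional_derivative y f v +
     \sum_(s in Gamma | reflection rW s)
        k s * (pairing y (alpha s) / pairing v (alpha s)) *
        (f (v *m rW s) - f v)) \_ hreg.

Inductive cherednik_generator :
    (('rV[C]_n -> C^o) -> ('rV[C]_n -> C^o)) -> Prop :=
| cherednik_linear_form (x : 'cV[C]_n) :
    cherednik_generator (fun f v => pairing v x * f v)
| cherednik_group w of w \in Gamma :
    cherednik_generator (fun f v => f (v *m rW w))
| cherednik_dunkl y : cherednik_generator (dunkl_operator y).

(* The polynomial representation C[h] of the rational Cherednik algebra, whose
   vectors [y] act by Dunkl operators.  Its invariant subspaces only depend on
   the image of the algebra in the operators, which is the algebra generated
   by linear forms, group elements and Dunkl operators.  A polynomial is
   determined by its restriction to [hreg]. *)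
Definition Red : Prop :=
  reducible_module (generated_algebra cherednik_generator)
    [set f \_ hreg | f in polynomial_function].

End Rational.

Section Trigonometric.
Variable L : zmodClosed 'rV[C]_n.

Definition invariant_lattice : Prop :=
  forall w v, w \in W -> v \in L -> v *m rW w \in L.

Record root_data (alpha : gT -> 'cV[C]_n) (alphav : gT -> 'rV[C]_n) : Prop :=
    RootData {
  coroot_lattice : forall s, reflection rW s -> alphav s \in L;
  coroot_anti : forall s, reflection rW s ->
    alphav s *m rW s = - alphav s;
  coroot_generator : forall s, reflection rW s -> forall v, v \in L ->
    v *m rW s = - v -> exists m : int, v = alphav s *~ m;
  root_anti : forall s, reflection rW s -> rW s *m alpha s = - alpha s;
  root_pairing : forall s, reflection rW s ->
    pairing (alphav s) (alpha s) = 2 }.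

Definition root_set (alpha : gT -> 'cV[C]_n) : set 'cV[C]_n :=
  [set l | exists2 s, reflection rW s & l = alpha s \/ l = - alpha s].

Definition torus_act (w : gT) (x : torus L) : torus L :=
  topi L (repr x *m rW w).

Definition fixed_points (w : gT) : set (torus L) :=
  [set x | torus_act w x = x].

Definition hypertori (s : gT) : set (set (torus L)) :=
  [set torus_component (fixed_points s) x | x in fixed_points s].

Definition reflection_hypertorus (T : set (torus L)) : Prop :=
  exists2 s, reflection rW s & hypertori s T.

Definition conjugation_invariant (c : set (torus L) -> C) : Prop :=
  forall w T, w \in W -> reflection_hypertorus T ->
    c (torus_act w @` T) = c T.

Definition hypertorus_equations (chi : set (torus L) -> torus L -> C) : Prop :=
  forall T, reflection_hypertorus T ->
    affine_linear (chi T) /\ [set x | chi T x = 1] = T.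

Definition Hreg : set (torus L) :=
  [set x | forall T, reflection_hypertorus T -> ~ T x].

Section DAHA.
Variables (chi : set (torus L) -> torus L -> C) (c : set (torus L) -> C).

(* The reflection hypertori [T] with [s_T = s] are the elements of
   [hypertori s].  Functions on [Hreg] are represented by their extension
   by 0. *)
Definition trig_dunkl_operator (a : 'rV[C]_n) (f : torus L -> C^o) :
    torus L -> C^o :=
  (fun x => invariant_derivative a f x +
     \sum_(s in W | reflection rW s) \sum_(T \in hypertori s)
        c T * (invariant_derivative a (chi T) x / (chi T x - 1)) *
        (f (torus_act s x) - f x)) \_ Hreg.

Inductive daha_generator :
    ((torus L -> C^o) -> (torus L -> C^o)) -> Prop :=
| daha_regular g of regular_function g :
    daha_generator (fun f x => g x * f x)
| daha_group w of w \in W : daha_generator (fun f x => f (torus_act w x))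
| daha_dunkl a : daha_generator (trig_dunkl_operator a).

(* C[W] |x D(Hreg) acts faithfully on C[Hreg], so its subalgebras are given as
   algebras of operators on functions on [Hreg]. *)
Definition daha : set ((torus L -> C^o) -> (torus L -> C^o)) :=
  generated_algebra daha_generator.

Definition polynomial_representation : set (torus L -> C^o) :=
  [set f \_ Hreg | f in regular_function (L := L)].

End DAHA.

Definition stabilizer (g : torus L) : {set gT} :=
  [set w in W | torus_act w g == g].

(* The component of [fixed_points s] through [g] is the unique reflection
   hypertorus through [g] with reflection [s], for [s] in the stabilizer. *)
Definition local_parameter (c : set (torus L) -> C) (g : torus L) (s : gT) : C :=
  c (torus_component (fixed_points s) g).

Definition Red_at (alpha : gT -> 'cV[C]_n) (g : torus L)
    (c : set (torus L) -> C) : Prop :=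
  Red (stabilizer g) alpha (local_parameter c g).

Section Centralizers.
Variables (gg : vectType C) (br : gg -> gg -> gg) (iota : 'Hom('rV[C]_n, gg)).

Definition weight_vector (l : 'cV[C]_n) (x : gg) : Prop :=
  forall a, br (iota a) x = pairing a l *: x.

(* [gg] is a simple Lie algebra in which [iota] embeds 'rV[C]_n as a Cartan
   subalgebra, with root system [Phi]. *)
Record simple_lie_algebra_of (Phi : set 'cV[C]_n) : Prop :=
    SimpleLieAlgebraOf {
  slie_bracket : lie_bracket br;
  slie_simple : lie_simple br fullv;
  slie_inj : lker iota = 0%VS;
  slie_cartan : forall x, weight_vector 0 x <-> x \in limg iota;
  slie_roots : forall l, l != 0 ->
    ((exists2 x, x != 0 & weight_vector l x) <-> Phi l);
  slie_decomposition : forall x, exists m (l : 'I_m -> 'cV[C]_n)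
    (y : 'I_m -> gg), (forall i, weight_vector (l i) (y i)) /\
                      x = \sum_i y i }.

(* The adjoint action of the maximal torus: Ad (exp v) = exp (ad v). *)
Definition adjoint_action (Ad : torus L -> 'End(gg)) : Prop :=
  forall v l x, weight_vector l x ->
    Ad (topi L v) x = cexp (pairing v l) *: x.

Definition centralizer (Ad : torus L -> 'End(gg)) (g : torus L) :
    {vspace gg} :=
  fixedSpace (Ad g).

Definition Sigma (Ad : torus L -> 'End(gg)) : set (torus L) :=
  [set g | lie_semisimple br (centralizer Ad g)].

End Centralizers.
End Trigonometric.
End Cherednik.

Arguments polynomial_representation {R gT W n} rW L _.

(* Main.v *)
(** Near [g = topi u] the trigonometric Dunkl operator along [a] is the rational Dunkl operator of the
    stabilizer of [g], acting on Taylor coefficients at [u], up to terms that do not lower the degree and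
    only involve multiplications, reflections and the Taylor coefficients at the points of the orbit of [g].

    If the rational polynomial representation at [g] has a proper submodule [J], then [J] contains a power of
    the discriminant, and the functions all of whose Taylor coefficients along the orbit of [g] lie in [J]
    form a proper submodule, which contains a power of the discriminant of the torus.

    Conversely, a proper nonzero submodule is an ideal of regular functions, so it has a zero [g].  If some
    [b <> 0] is annihilated by the roots of the stabilizer of [g], the Dunkl operator along [b] shows that the
    ideal vanishes on the whole line [g exp(t b)], which meets a further reflection hypertorus; so one may assume
    that the roots of the stabilizer of [g] span, which makes the centralizer of [g] semisimple.  The leading
    Taylor forms at [g] of the functions of the ideal then span a proper submodule of the rational
    polynomial representation. *)
Require Import Defs.
From HB Require Import structures.
From mathcomp Require Import all_boot all_order all_fingroup all_algebra.
From mathcomp Require Import mxrepresentation.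
From mathcomp Require Import all_classical all_reals all_analysis.
From mathcomp Require Import generic_quotient ring_quotient complex ring zify.
From mathcomp Require mpoly.
Import (canonicals) mpoly.

Set Implicit Arguments.
Unset Strict Implicit.
Unset Printing Implicit Defensive.

Import Order.TTheory GRing.Theory Num.Theory.
Import numFieldNormedType.Exports.
Import complex.

Local Open Scope classical_set_scope.
Local Open Scope quotient_scope.
Local Open Scope ring_scope.

(** The obstacle is that a Dunkl operator involves all reflections, so it mixes the Taylor
    coefficients at $g$ with those at the other points of its orbit. In one direction the condition
    is therefore imposed along the whole orbit, each coefficient being carried back to $g$ by the
    group element. In the other, a function of the ideal is multiplied by a regular function that is
    1 at $g$ and vanishes to high order at the other orbit points; only then does its leading form
    see the rational Dunkl operator alone. Taylor coefficients need no convergence argument here. A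
    regular function is a finite exponential sum, its coefficients along a line are power sums in
    the exponents, and polynomial interpolation shows that they determine it. The poles of the
    trigonometric operator cancel globally, inside regular functions; the pole $1/\alpha_s$ of the
    rational operator arises only when the series of $\chi_T - 1$, which has no constant term at a
    point of $T$, is inverted formally. The zero of the ideal comes from a Nullstellensatz for the
    torus that rests on the uncountability of the field. *)

Lemma derive_first_order (R : realType) (f : R -> R) (x df e : R) :
  is_derive x 1 f df -> 0 < e ->
  \forall h \near 0, `|f (h + x) - f x - df * h| <= e * `|h|.
Proof.
move=> [dfx <-] e0; move: dfx => /cvgP; rewrite /derivable.
move=> cv.
have /cvgrPdist_le/(_ _ e0) := cv.
rewrite near_withinE => H; near=> h.
have [->|h0] := eqVneq h 0; first by rewrite add0r subrr mulr0 subr0 !normr0 mulr0.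
have /(_ h0) /= : h != 0 -> `|'D_1 f x - h^-1 *: (f (h *: 1 + x) - f x)| <= e.
  by near: h.
rewrite /GRing.scale /= mulr1 => Hh.
have -> : f (h + x) - f x - 'D_1 f x * h =
   - (h * ('D_1 f x - h^-1 * (f (h + x) - f x))).
  by rewrite mulrBr mulrA divff // mul1r; ring.
by rewrite normrN normrM mulrC ler_wpM2r.
Unshelve. all: by end_near. Qed.

(** * The complex exponential: first-order estimate, kernel, surjectivity *)

Section ComplexExponential.
Context {R : realType}.
Local Notation C := (Cplx R).
Implicit Types z w : C.

Lemma cexpD z w : cexp (z + w) = cexp z * cexp w.
Proof.
case: z w => [a b] [c d]; rewrite /cexp /= expRD cosD sinD.
by congr (_ +i* _)%C; ring.
Qed.

Lemma cexp0 : cexp (0 : C) = 1.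
Proof. by rewrite /cexp /= expR0 cos0 sin0 mulr1 mulr0. Qed.

Lemma cexp_neq0 z : cexp z != 0.
Proof.
apply/negP => /eqP ez0; have /eqP := cexpD z (- z).
by rewrite subrr cexp0 ez0 mul0r oner_eq0.
Qed.

Lemma cexpN z : cexp (- z) = (cexp z)^-1.
Proof.
apply: (mulfI (cexp_neq0 z)); rewrite divff ?cexp_neq0 //.
by rewrite -cexpD subrr cexp0.
Qed.

Lemma cexpMz z (m : int) : cexp (m%:~R * z) = cexp z ^ m.
Proof.
have H k : cexp (k%:R * z) = cexp z ^+ k.
  elim: k => [|k IH]; first by rewrite mul0r cexp0 expr0.
  by rewrite -natr1 mulrDl mul1r cexpD IH exprSr.
case: m => k; first by rewrite -exprnP -H.
by rewrite NegzE -exprnN -H mulrNz mulNr cexpN.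
Qed.

Lemma sqrt_sqr_leD (a b : R) : Num.sqrt (a ^+ 2 + b ^+ 2) <= `|a| + `|b|.
Proof.
rewrite -[leRHS]ger0_norm ?addr_ge0 // -sqrtr_sqr.
by rewrite ler_wsqrtr // sqrrD !real_normK ?num_real // lerD2r lerDl mulrn_wge0 // mulr_ge0.
Qed.

Lemma norm_le_sqrt_sqr (a b : R) :
  `|a| <= Num.sqrt (a ^+ 2 + b ^+ 2) /\ `|b| <= Num.sqrt (a ^+ 2 + b ^+ 2).
Proof.
split; rewrite -sqrtr_sqr ler_wsqrtr //.
  by rewrite lerDl sqr_ge0.
by rewrite lerDr sqr_ge0.
Qed.

Lemma cexp_first_order (e : R) : 0 < e -> exists2 d : R, 0 < d &
  forall h : C, `|h| < d%:C%C -> `|cexp h - 1 - h| <= e%:C%C * `|h|.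
Proof.
move=> e0.
(* The real and imaginary parts will cost $3kN$ and $5kN$, and $8 \cdot e/16$ is below [e]. The
   bound by 1 gives $|x| \le 1$ and absorbs $kN$ into $N$. *)
pose k := Num.min 1 (e / 16).
have k0 : 0 < k by rewrite lt_min ltr01 divr_gt0.
have k1 : k <= 1 by rewrite ge_min lexx.
have ke : k <= e / 16 by rewrite ge_min lexx orbT.
have H1 := derive_first_order (is_derive_expR (0 : R)) k0.
have H2 := derive_first_order (is_derive_cos (0 : R)) k0.
have H3 := derive_first_order (is_derive_sin (0 : R)) k0.
have /nbhs_ballP[d /= d0 Hd] : \forall h \near (0 : R),
   [/\ `|expR h - 1 - h| <= k * `|h|, `|cos h - 1| <= k * `|h|
     & `|sin h - h| <= k * `|h|].
  near=> h; split.
  - suff: `|expR (h + 0) - expR 0 - expR 0 * h| <= k * `|h|.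
      by rewrite addr0 expR0 mul1r.
    by near: h.
  - suff: `|cos (h + 0) - cos 0 - - sin 0 * h| <= k * `|h|.
      by rewrite addr0 cos0 sin0 oppr0 mul0r subr0.
    by near: h.
  - suff: `|sin (h + 0) - sin 0 - cos 0 * h| <= k * `|h|.
      by rewrite addr0 cos0 sin0 subr0 mul1r.
    by near: h.
exists (Num.min d k); first by rewrite lt_min d0 k0.
move=> [x y]; rewrite !normc_def /= ltcR => hd.
set N := Num.sqrt (x ^+ 2 + y ^+ 2) in hd *.
have [xN yN] : `|x| <= N /\ `|y| <= N by exact: norm_le_sqrt_sqr.
have [Nd Nk] : N < d /\ N < k by apply/andP; rewrite -lt_min.
have Bx : ball 0 d x by rewrite /ball /= sub0r normrN (le_lt_trans xN).
have By : ball 0 d y by rewrite /ball /= sub0r normrN (le_lt_trans yN).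
have [Ex _ _] := Hd x Bx; have [_ Cy Sy] := Hd y By.
rewrite -rmorphM /= lecR.
apply: (le_trans (sqrt_sqr_leD _ _)).
have N0 : 0 <= N by rewrite sqrtr_ge0.
have c1 : `|cos y| <= 1 by rewrite ler_norml cos_geN1 cos_le1.
have x1 : `|x| <= 1 by rewrite (le_trans xN) // (le_trans (ltW Nk)).
have kN : forall u, u <= N -> k * u <= k * N by move=> u; rewrite ler_pM2l.
have B1 : `|expR x * cos y - 1 - x| <= 3 * (k * N).
  have -> : expR x * cos y - 1 - x = (expR x - 1 - x) * cos y + (1 + x) * (cos y - 1) by ring.
  apply: (le_trans (ler_normD _ _)); rewrite !normrM.
  have -> : 3 * (k * N) = k * N * 1 + 2 * (k * N) by ring.
  apply: lerD; first by apply: ler_pM => //; apply: (le_trans Ex); exact: kN.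
  apply: ler_pM => //; last by apply: (le_trans Cy); exact: kN.
  by apply: (le_trans (ler_normD _ _)); rewrite normr1 -[2]/(1 + 1) lerD2l.
have B2 : `|expR x * sin y - 0 - y| <= 5 * (k * N).
  have -> : expR x * sin y - 0 - y = (expR x - 1) * sin y + (sin y - y) by ring.
  apply: (le_trans (ler_normD _ _)); rewrite !normrM.
  have -> : 5 * (k * N) = (2 * k) * (2 * N) + (k * N) by ring.
  apply: lerD; last by apply: (le_trans Sy); exact: kN.
  apply: ler_pM => //.
    have -> : expR x - 1 = (expR x - 1 - x) + x by ring.
    apply: (le_trans (ler_normD _ _)).
    have -> : 2 * k = k + k by ring.
    apply: lerD; last by rewrite (le_trans xN) // ltW.
    by apply: (le_trans Ex); rewrite -[leRHS]mulr1 ler_pM2l.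
  have -> : sin y = (sin y - y) + y by ring.
  apply: (le_trans (ler_normD _ _)).
  have -> : 2 * N = N + N by ring.
  apply: lerD => //; apply: (le_trans Sy).
  by apply: (le_trans (kN _ yN)); rewrite -[leRHS]mul1r ler_wpM2r.
apply: (le_trans (lerD B1 B2)).
have -> : 3 * (k * N) + 5 * (k * N) = (8 * k) * N by ring.
rewrite ler_wpM2r //; apply: (le_trans (y := 8 * (e / 16))); first by rewrite ler_pM2l.
by have -> : 8 * (e / 16) = e / 2; [field | rewrite ler_pdivrMr // ler_peMr // ?ltW // ltr1n].
Unshelve. all: by end_near. Qed.

Lemma cexp_quotient_cvg (c : C) :
  (h^-1 * (cexp (h * c) - 1) : C^o) @[h --> (0 : C)^'] --> (c : C^o).
Proof.
have [->|c0] := eqVneq c 0.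
  under eq_fun do rewrite mulr0 cexp0 subrr mulr0.
  exact: cvg_cst.
apply/cvgrPdist_le => e e0.
have : 0 < e / `|c| by rewrite divr_gt0 // normr_gt0.
(* A positive element of the ordered field of complex numbers is real, so the tolerance is a real
   number [k1]. *)
set k := (e / `|c|); case E : k => [k1 k2] kp.
move: kp; rewrite ltcE /= => /andP[/eqP k20 k10]; rewrite k20 in E.
have [d d0 Hd] := cexp_first_order k10.
have dc0 : 0 < (d%:C%C : C) / `|c| by rewrite divr_gt0 ?normr_gt0 // ltcR.
have hnear : \forall h \near (0 : C), `|h| < (d%:C%C : C) / `|c|.
  exact: (@nbhs0_lt _ C^o).
rewrite near_withinE; near=> h => h0.
have hd : `|h| < (d%:C%C : C) / `|c| by near: h.
rewrite ltr_pdivlMr ?normr_gt0 // -normrM in hd.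
have := Hd _ hd.
have -> : c - h^-1 * (cexp (h * c) - 1) = - (h^-1 * (cexp (h * c) - 1 - h * c)).
  by rewrite [in RHS]mulrBr mulKf //; ring.
move=> H; rewrite normrN normrM normfV.
rewrite mulrC ler_pdivrMr ?normr_gt0 //; apply: (le_trans H).
rewrite -[(k1%:C)%C]E /k normrM mulrA [_ * `|h|]mulrC mulrA divfK ?normr_eq0 //.
by rewrite mulrC.
Unshelve. all: by end_near. Qed.

Lemma cexp_affine_cvg (b c t : C) :
  (h^-1 *: ((cexp (b + (h + t) * c) : C^o) - cexp (b + t * c)))
    @[h --> (0 : C)^'] --> (c * cexp (b + t * c) : C^o).
Proof.
have -> : (fun h : C => h^-1 *: ((cexp (b + (h + t) * c) : C^o) - cexp (b + t * c)))
  = (fun h : C => (h^-1 * (cexp (h * c) - 1) : C^o) * cexp (b + t * c)).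
  apply/funext => h; rewrite /GRing.scale /= -mulrA; congr (_ * _).
  by rewrite mulrBl mul1r -cexpD; congr (cexp _ - _); ring.
apply: cvgM; [exact: cexp_quotient_cvg | exact: cvg_cst].
Qed.

Lemma derivable_cexp_affine (b c t : C) :
  is_derive t 1 (fun s : C => (cexp (b + s * c) : C^o)) (c * cexp (b + t * c)).
Proof.
have H := @cexp_affine_cvg b c t.
have E : (h^-1 *: (((fun s : C => (cexp (b + s * c) : C^o)) \o shift t) (h *: 1) - cexp (b + t * c))) @[h --> (0 : C)^'] --> (c * cexp (b + t * c) : C^o).
  by under eq_fun do rewrite /= /GRing.scale /= mulr1.
split; first by apply/cvg_ex; exists (c * cexp (b + t * c)).
by apply: cvg_lim E; exact: norm_hausdorff.
Qed.

(** Cosine is injective on $[0, \pi]$, and $y \mapsto 2\pi - y$ maps the other half of the period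
    there. *)
Lemma cos_eq1 (y : R) : 0 <= y < trigo.pi *+ 2 -> cos y = 1 -> y = 0.
Proof.
move=> /andP[y0 y2] cy; have p0 := pi_gt0 R.
have [yp|yp] := leP y trigo.pi.
  by apply: cos_inj; rewrite ?in_itv /= ?lexx ?y0 ?yp ?ltW // cy cos0.
have : trigo.pi *+ 2 - y = 0.
  apply: cos_inj; rewrite ?in_itv /= ?lexx ?(ltW p0) // ?cos0.
    by rewrite subr_ge0 ltW //= lerBlDr mulr2n lerD2l ltW.
  by rewrite -cosN opprB cosB cy cos2pi sin2pi; ring.
by move/eqP; rewrite subr_eq0 => /eqP yE; rewrite yE ltxx in y2.
Qed.

Lemma twopii_neq0 : twopii != 0 :> C.
Proof.
rewrite /twopii eq_complex /= negb_and; apply/orP; right.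
by rewrite mulrn_eq0 negb_or /= gt_eqF ?pi_gt0.
Qed.

Lemma cexp_twopii : cexp (twopii : C) = 1.
Proof. by rewrite /cexp /twopii /= expR0 cos2pi sin2pi mul1r mulr0. Qed.

Lemma twopiiMz (m : int) : twopii * m%:~R = (0 +i* ((trigo.pi *+ 2) * m%:~R))%C :> C.
Proof.
have -> : (m%:~R : C) = (m%:~R : R)%:C%C by rewrite rmorph_int.
by rewrite /twopii; apply/eqP; rewrite eq_complex /=; apply/andP; split; apply/eqP; ring.
Qed.

Lemma cexp_eq1P z : reflect (exists m : int, z = twopii * m%:~R) (cexp z == 1).
Proof.
apply: (iffP eqP) => [|[m ->]]; last by rewrite mulrC cexpMz cexp_twopii exp1rz.
case: z => x y /eqP; rewrite /cexp eq_complex /= => /andP[/eqP ec /eqP es].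
have e0 : expR x != 0 by rewrite gt_eqF // expR_gt0.
have s0 : sin y = 0 by apply/eqP; move/eqP: es; rewrite mulf_eq0 (negbTE e0).
have c0 : 0 < cos y by rewrite -(pmulr_rgt0 _ (expR_gt0 x)) ec.
have c1 : cos y = 1 by rewrite -(sin0cos1 s0) gtr0_norm.
have x0 : x = 0 by apply: expR_inj; rewrite expR0 -[LHS]mulr1 -[in LHS]c1.
have p0 : 0 < trigo.pi *+ 2 :> R by rewrite mulrn_wgt0 ?pi_gt0.
(* Subtracting this multiple of $2\pi$ brings [y] into $[0, 2\pi)$, where [cos_eq1] applies. *)
pose m := Num.floor (y / (trigo.pi *+ 2)).
exists m; rewrite twopiiMz x0; congr (_ +i* _)%C.
have /andP[m1 m2] := floor_itv (y / (trigo.pi *+ 2)); rewrite -/m in m1 m2.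
have cm : cexp (twopii * m%:~R : C) = 1 by rewrite mulrC cexpMz cexp_twopii exp1rz.
have cy : cexp (0 +i* y : C)%C = 1 by rewrite /cexp /= expR0 c1 s0 mulr0 mulr1.
have := cexpD (0 +i* y)%C (- (twopii * m%:~R)).
rewrite cexpN cm cy invr1 mulr1 twopiiMz /cexp => /eqP; rewrite eq_complex /= => /andP[+ _].
rewrite add0r oppr0 expR0 mul1r => /eqP /cos_eq1 H.
apply/subr0_eq; apply: H.
rewrite subr_ge0 mulrC -ler_pdivlMr // m1 /= ltrBlDr mulrC.
have -> : trigo.pi *+ 2 + trigo.pi *+ 2 * m%:~R = (m + 1)%:~R * (trigo.pi *+ 2) :> R.
  by rewrite intrD; ring.
by rewrite -ltr_pdivrMr.
Qed.

(** Polar coordinates: [acos] yields an argument in $[0, \pi]$, whose sign is reversed when the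
    imaginary part is negative. *)
Lemma cexp_surj z : z != 0 -> exists w, cexp w = z.
Proof.
case: z => a b z0; pose r := Num.sqrt (a ^+ 2 + b ^+ 2).
have r2 : 0 < a ^+ 2 + b ^+ 2.
  rewrite lt_neqAle addr_ge0 ?sqr_ge0 // andbT eq_sym paddr_eq0 ?sqr_ge0 //.
  by rewrite !sqrf_eq0; rewrite eq_complex /= in z0.
have r0 : 0 < r by rewrite sqrtr_gt0.
have rE : r ^+ 2 = a ^+ 2 + b ^+ 2 by rewrite sqr_sqrtr // ltW.
have ar : -1 <= a / r <= 1.
  rewrite -ler_norml normrM normfV (gtr0_norm r0) ler_pdivrMr // mul1r.
  exact: (norm_le_sqrt_sqr a b).1.
have [_ ca] := acos_def ar; have sa := sin_acos ar.
have sb : Num.sqrt (1 - (a / r) ^+ 2) = `|b| / r.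
  have -> : 1 - (a / r) ^+ 2 = (b / r) ^+ 2.
    rewrite !expr_div_n rE; field.
    by rewrite gt_eqF.
  by rewrite sqrtr_sqr normrM normfV (gtr0_norm r0).
rewrite sb in sa.
have rn : r != 0 by rewrite gt_eqF.
have [b0|b0] := leP 0 b.
  exists (ln r +i* acos (a / r))%C; rewrite /cexp /= lnK // ca sa ger0_norm //.
  by rewrite !(mulrC r) !divfK.
exists (ln r +i* (- acos (a / r)))%C; rewrite /cexp /= lnK // cosN sinN ca sa ltr0_norm //.
by rewrite mulNr opprK !(mulrC r) !divfK.
Qed.

End ComplexExponential.

(** * Complex derivatives of exponential sums and of powers of affine functions *)

Section Derivatives.
Context {R : realType}.
Local Notation C := (Cplx R).

Lemma is_derive_big (I : Type) (r : seq I) (F : I -> C -> C^o) (dF : I -> C) (t : C) :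
  (forall i, is_derive t 1 (F i) (dF i)) ->
  is_derive t 1 (fun x => \sum_(i <- r) F i x : C^o) (\sum_(i <- r) dF i).
Proof.
move=> H; elim: r => [|i r IH].
  rewrite big_nil; under eq_fun do rewrite big_nil.
  exact: is_derive_cst.
rewrite big_cons; under eq_fun do rewrite big_cons.
exact: (is_deriveD (H i) IH).
Qed.

Lemma derive1_affine_sum (I : Type) (r : seq I) (a b c : I -> C) (t : C) :
  derive1 (fun t : C => \sum_(i <- r) a i * cexp (b i + t * c i) : C^o) t =
  \sum_(i <- r) a i * c i * cexp (b i + t * c i).
Proof.
rewrite derive1E.
have H i : is_derive t 1 (fun t : C => a i * cexp (b i + t * c i) : C^o)
    (a i * c i * cexp (b i + t * c i)).
  rewrite -mulrA; exact: (is_deriveZ (a i) (derivable_cexp_affine (b i) (c i) t)).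
exact: (@derive_val _ _ _ _ _ _ _ (is_derive_big r H)).
Qed.

Lemma derive1n_exp_sum (I : Type) (r : seq I) (a c : I -> C) (d : nat) :
  derive1n d (fun t : C => \sum_(i <- r) a i * cexp (t * c i) : C^o) =
  (fun t : C => \sum_(i <- r) a i * c i ^+ d * cexp (t * c i)).
Proof.
elim: d => [|d IH].
  by apply/funext => t; apply: eq_bigr => i _; rewrite expr0 mulr1.
rewrite derive1nS IH; apply/funext => t.
transitivity (derive1 (fun t : C => \sum_(i <- r) (a i * c i ^+ d) * cexp (0 + t * c i) : C^o) t).
  by congr (derive1 _ t); apply/funext => x; apply: eq_bigr => i _; rewrite add0r.
rewrite derive1_affine_sum; apply: eq_bigr => i _; rewrite add0r exprSr; ring.
Qed.

Lemma is_derive_affine (b c t : C) :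
  is_derive t 1 (fun t : C => b + t * c : C^o) c.
Proof.
have -> : (fun t : C => b + t * c : C^o) = ((cst b : C -> C^o) + c \*: (id : C -> C^o))%R.
  by apply/funext => x; rewrite /= /GRing.scale /= mulrC.
rewrite -[X in is_derive _ _ _ X]add0r; apply: is_deriveD.
rewrite -[X in is_derive _ _ _ X](mulr1 c); exact: (@is_deriveZ C C^o C^o _ c).
Qed.

Lemma derive1_affine_pow_sum (I : Type) (r : seq I) (a b c : I -> C) (d : nat) (t : C) :
  derive1 (fun t : C => \sum_(i <- r) a i * (b i + t * c i) ^+ d : C^o) t =
  \sum_(i <- r) a i * (d%:R * c i * (b i + t * c i) ^+ d.-1).
Proof.
rewrite derive1E.
have H i : is_derive t 1 (fun t : C => a i * (b i + t * c i) ^+ d : C^o)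
    (a i * (d%:R * c i * (b i + t * c i) ^+ d.-1)).
  apply: (@is_deriveZ C C^o C^o _ (a i)).
  have -> : d%:R * c i * (b i + t * c i) ^+ d.-1 = (d%:R * (b i + t * c i) ^+ d.-1) * c i by ring.
  have -> : (fun x : C^o => (b i + x * c i) ^+ d : C^o) = ((fun x : C^o => b i + x * c i : C) ^+ d).
    by apply/funext => x; elim: (d) => [|k IH]; rewrite ?expr0 // !exprS IH.
  have := @is_deriveX C C^o _ d t 1 _ (is_derive_affine (b i) (c i) t).
  by rewrite /GRing.scale.
exact: (@derive_val _ _ _ _ _ _ _ (is_derive_big r H)).
Qed.

End Derivatives.

(** * Interpolation and the pairing with the dual space *)

Section Interpolation.
Context {K : fieldType}.

(* Lagrange interpolation. *)
Lemma moments_eq0 (I : eqType) (r : seq I) (a x : I -> K) :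
  (forall d, \sum_(i <- r) a i * x i ^+ d = 0) ->
  forall h : K -> K, \sum_(i <- r) a i * h (x i) = 0.
Proof.
move=> H h.
have Hp (p : {poly K}) : \sum_(i <- r) a i * p.[x i] = 0.
  under eq_bigr do rewrite horner_coef mulr_sumr.
  rewrite exchange_big /= big1 // => j _.
  under eq_bigr do rewrite mulrCA.
  by rewrite -mulr_sumr H mulr0.
pose s := undup [seq x i | i <- r].
pose p : {poly K} := \sum_(y <- s) (h y / \prod_(z <- rem y s) (y - z)) *:
  \prod_(z <- rem y s) ('X - z%:P).
have us : uniq s by rewrite undup_uniq.
have ev y : y \in s -> p.[y] = h y.
  move=> ys; rewrite /p horner_sum (big_rem y) //= hornerZ horner_prod.
  rewrite [X in _ / _ * X + _](eq_bigr (fun z => y - z)) => [|z _]; last by rewrite hornerXsubC.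
  rewrite divfK; last first.
    rewrite prodf_seq_neq0; apply/allP => z; rewrite mem_rem_uniq // inE /= => /andP[zy _].
    by rewrite subr_eq0 eq_sym.
  rewrite big_seq big1 ?addr0 // => z; rewrite mem_rem_uniq // inE /= => /andP[zy zs].
  rewrite hornerZ horner_prod [X in _ * X](big_rem y) /=; last by rewrite mem_rem_uniq // inE eq_sym zy.
  by rewrite hornerXsubC subrr mul0r mulr0.
rewrite -[RHS](Hp p) !big_seq; apply: eq_bigr => i ir; rewrite ev //.
by rewrite mem_undup map_f.
Qed.

End Interpolation.

Section Pairing.
Context {K : comPzRingType} {n : nat}.
Implicit Types (u v : 'rV[K]_n) (l : 'cV[K]_n).

Lemma pairingDl u v l : pairing (u + v) l = pairing u l + pairing v l.
Proof. by rewrite /pairing mulmxDl mxE. Qed.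
Lemma pairingDr u l m : pairing u (l + m) = pairing u l + pairing u m.
Proof. by rewrite /pairing mulmxDr mxE. Qed.
Lemma pairingZl a u l : pairing (a *: u) l = a * pairing u l.
Proof. by rewrite /pairing -scalemxAl mxE. Qed.
Lemma pairingZr a u l : pairing u (a *: l) = a * pairing u l.
Proof. by rewrite /pairing -scalemxAr mxE. Qed.
Lemma pairingNl u l : pairing (- u) l = - pairing u l.
Proof. by rewrite /pairing mulNmx mxE. Qed.
Lemma pairingNr u l : pairing u (- l) = - pairing u l.
Proof. by rewrite /pairing mulmxN mxE. Qed.
Lemma pairingBl u v l : pairing (u - v) l = pairing u l - pairing v l.
Proof. by rewrite pairingDl pairingNl. Qed.
Lemma pairingBr u l m : pairing u (l - m) = pairing u l - pairing u m.
Proof. by rewrite pairingDr pairingNr. Qed.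
Lemma pairing0l l : pairing (0 : 'rV[K]_n) l = 0.
Proof. by rewrite /pairing mul0mx mxE. Qed.
Lemma pairing0r u : pairing u (0 : 'cV[K]_n) = 0.
Proof. by rewrite /pairing mulmx0 mxE. Qed.
Lemma pairing_mx u (A : 'M[K]_n) l : pairing (u *m A) l = pairing u (A *m l).
Proof. by rewrite /pairing mulmxA. Qed.
Lemma pairingE u l : pairing u l = \sum_j u 0 j * l j 0.
Proof. by rewrite /pairing mxE. Qed.

Lemma pairing_eq0 l : (forall u, pairing u l = 0) -> l = 0.
Proof.
move=> H; apply/matrixP => i j; rewrite ord1 mxE -(H (delta_mx 0 i)) pairingE.
rewrite (bigD1 i) //= big1 ?addr0 => [|k ki]; rewrite !mxE ?eqxx /= ?mul1r //.
by rewrite (negbTE ki) mul0r.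
Qed.
End Pairing.

(** * Regular functions on the torus and their Taylor coefficients *)

Section Torus.
Context {R : realType} {n : nat}.
Local Notation C := (Cplx R).
Variable L : zmodClosed 'rV[C]_n.
Implicit Types (f h : torus L -> C^o) (u v a : 'rV[C]_n).

Lemma topiD u v : topi L (u + v) = topi L u + topi L v.
Proof. by rewrite /topi raddfD. Qed.

Lemma topi_repr (x : torus L) : topi L (repr x) = x.
Proof. exact: reprK. Qed.

Lemma topi_eq u v : topi L u = topi L v <-> twopii^-1 *: (u - v) \in L.
Proof.
by split=> [/eqP|H]; last (apply/eqP); rewrite /topi -Quotient.idealrBE inE.
Qed.

Lemma topi_sub_period u v : twopii^-1 *: v \in L -> topi L (u + v) = topi L u.
Proof. by move=> Lv; apply/topi_eq; rewrite addrAC subrr add0r. Qed.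

Lemma topi_twopii u v : v \in L -> topi L (u + twopii *: v) = topi L u.
Proof. by move=> Lv; apply: topi_sub_period; rewrite scalerA mulVf ?twopii_neq0 // scale1r. Qed.

Lemma dual_latticeD l m : dual_lattice L l -> dual_lattice L m -> dual_lattice L (l + m).
Proof.
move=> Ll Lm v Lv; have [[i Ei] [j Ej]] := (Ll v Lv, Lm v Lv).
by exists (i + j); rewrite pairingDr Ei Ej intrD.
Qed.

Lemma dual_latticeMz l (k : int) : dual_lattice L l -> dual_lattice L (k%:~R *: l).
Proof.
move=> Ll v Lv; have [i Ei] := Ll v Lv; exists (k * i).
by rewrite pairingZr Ei intrM.
Qed.

Lemma dual_latticeN l : dual_lattice L l -> dual_lattice L (- l).
Proof. by rewrite -scaleN1r; apply: (@dual_latticeMz _ (-1)). Qed.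

Lemma dual_lattice0 : dual_lattice L (0 : 'cV_n).
Proof. by move=> v _; exists 0; rewrite pairing0r. Qed.

Lemma cexp_dual_period l v : dual_lattice L l -> twopii^-1 *: v \in L ->
  cexp (pairing v l) = 1.
Proof.
move=> Ll /Ll[m Em]; apply/eqP/cexp_eq1P; exists m.
by rewrite -Em pairingZl mulrA divff ?twopii_neq0 // mul1r.
Qed.

(** Evaluation at a representative makes this a function on the torus for every [l]; it is the
    character $e^l$ only for [l] in the dual lattice, see [chr_topi]. *)
Definition chr (l : 'cV[C]_n) : torus L -> C^o := fun x => cexp (pairing (repr x) l).

Lemma chr_topi l v : dual_lattice L l -> chr l (topi L v) = cexp (pairing v l).
Proof.
move=> Ll; rewrite /chr.
have /topi_eq/(cexp_dual_period Ll) : topi L (repr (topi L v)) = topi L v by rewrite topi_repr.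
rewrite pairingBl cexpD cexpN => H; exact: divr1_eq.
Qed.

(** A list in which exponents may repeat, so that sums and products of regular functions need no
    collection of terms. *)
Definition expsum (s : seq (C * 'cV[C]_n)) v : C := \sum_(p <- s) p.1 * cexp (pairing v p.2).

Lemma regular_functionP f : regular_function f <->
  exists2 s : seq (C * 'cV[C]_n), {in s, forall p, dual_lattice L p.2} &
    forall v, f (topi L v) = expsum s v.
Proof.
split=> [[m [a [l [Ll fE]]]]|[s Ls fE]].
  exists [seq (a i, l i) | i <- enum 'I_m]; first by move=> p /mapP[i _ ->] /=.
  by move=> v; rewrite fE /expsum big_map big_enum.
exists (size s), (fun i => (tnth (in_tuple s) i).1), (fun i => (tnth (in_tuple s) i).2).
split=> [i|v]; first by apply: Ls; exact: (mem_tnth i (in_tuple s)).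
by rewrite fE /expsum big_tnth.
Qed.

Lemma eq_regular f h : regular_function f -> f =1 h -> regular_function h.
Proof. by move=> rf /funext <-. Qed.

Lemma regular_chr l : dual_lattice L l -> regular_function (chr l).
Proof.
move=> Ll; apply/regular_functionP; exists [:: (1, l)].
  by move=> p; rewrite inE => /eqP ->.
by move=> v; rewrite /expsum big_seq1 mul1r chr_topi.
Qed.

Lemma regular_lin (a : C) f h : regular_function f -> regular_function h ->
  regular_function (fun x => a * f x + h x : C^o).
Proof.
move=> /regular_functionP[s Ls fE] /regular_functionP[s' Ls' hE].
apply/regular_functionP; exists ([seq (a * p.1, p.2) | p <- s] ++ s').
  by move=> p; rewrite mem_cat => /orP[/mapP[q /Ls Lq ->] //|/Ls'].
move=> v; rewrite fE hE /expsum big_cat big_map mulr_sumr; congr (_ + _).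
by apply: eq_bigr => p _; rewrite mulrA.
Qed.

Lemma regular_cst (a : C) : regular_function (fun _ : torus L => a : C^o).
Proof.
apply/regular_functionP; exists [:: (a, 0)].
  by move=> p; rewrite inE => /eqP ->; exact: dual_lattice0.
by move=> v; rewrite /expsum big_seq1 /= pairing0r cexp0 mulr1.
Qed.

Lemma regularD f h : regular_function f -> regular_function h ->
  regular_function (fun x => f x + h x : C^o).
Proof.
move=> rf rh; apply: eq_regular (regular_lin 1 rf rh) _ => x.
by rewrite mul1r.
Qed.

Lemma regularZ (a : C) f : regular_function f -> regular_function (fun x => a * f x : C^o).
Proof.
move=> rf; apply: eq_regular (regular_lin a rf (regular_cst 0)) _ => x.
by rewrite addr0.
Qed.

Lemma regularB f h : regular_function f -> regular_function h ->
  regular_function (fun x => f x - h x : C^o).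
Proof.
move=> rf rh; apply: eq_regular (regular_lin (-1) rh rf) _ => x.
by rewrite mulN1r addrC.
Qed.

Lemma expsumM (s s' : seq (C * 'cV[C]_n)) v : expsum s v * expsum s' v =
  expsum [seq (p.1 * q.1, p.2 + q.2) | p <- s, q <- s'] v.
Proof.
rewrite /expsum big_allpairs_dep mulr_suml; apply: eq_bigr => p _.
rewrite mulr_sumr; apply: eq_bigr => q _ /=.
by rewrite pairingDr cexpD; ring.
Qed.

Lemma regularM f h : regular_function f -> regular_function h ->
  regular_function (fun x => f x * h x : C^o).
Proof.
move=> /regular_functionP[s Ls fE] /regular_functionP[s' Ls' hE].
apply/regular_functionP; exists [seq (p.1 * q.1, p.2 + q.2) | p <- s, q <- s'].
  by move=> _ /allpairsP[[p q] [/= /Ls Lp /Ls' Lq ->]]; exact: dual_latticeD.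
by move=> v; rewrite fE hE expsumM.
Qed.

Lemma regular_sum (I : Type) (r : seq I) (P : pred I) (F : I -> torus L -> C^o) :
  (forall i, P i -> regular_function (F i)) ->
  regular_function (fun x => \sum_(i <- r | P i) F i x : C^o).
Proof.
move=> H; elim: r => [|i r IH].
  by apply: eq_regular (regular_cst 0) _ => x; rewrite big_nil.
case Pi : (P i).
  by apply: eq_regular (regularD (H i Pi) IH) _ => x; rewrite big_cons Pi.
by apply: eq_regular IH _ => x; rewrite big_cons Pi.
Qed.

Lemma regular_prod (I : Type) (r : seq I) (P : pred I) (F : I -> torus L -> C^o) :
  (forall i, P i -> regular_function (F i)) ->
  regular_function (fun x => \prod_(i <- r | P i) F i x : C^o).
Proof.
move=> H; elim: r => [|i r IH].
  by apply: eq_regular (regular_cst 1) _ => x; rewrite big_nil.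
case Pi : (P i).
  by apply: eq_regular (regularM (H i Pi) IH) _ => x; rewrite big_cons Pi.
by apply: eq_regular IH _ => x; rewrite big_cons Pi.
Qed.

Lemma regularX f k : regular_function f -> regular_function (fun x => f x ^+ k : C^o).
Proof.
move=> rf; elim: k => [|k IH]; first exact: regular_cst.
by apply: eq_regular (regularM rf IH) _ => x; rewrite exprS.
Qed.

(* The degree-[d] homogeneous term at [topi u] of a function on the torus, evaluated at [v]. *)
Definition taylor u f v (d : nat) : C :=
  (d`!%:R)^-1 * derive1n d (fun t : C => f (topi L (u + t *: v))) 0.

Lemma taylorE s f u v d : (forall v, f (topi L v) = expsum s v) ->
  taylor u f v d =
  \sum_(p <- s) p.1 * cexp (pairing u p.2) * (pairing v p.2 ^+ d / d`!%:R).
Proof.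
move=> fE; rewrite /taylor.
have -> : (fun t : C => f (topi L (u + t *: v))) =
  (fun t : C => \sum_(p <- s) (p.1 * cexp (pairing u p.2)) * cexp (t * pairing v p.2) : C^o).
  apply/funext => t; rewrite fE; apply: eq_bigr => p _.
  by rewrite pairingDl pairingZl cexpD mulrA.
rewrite derive1n_exp_sum mulr_sumr; apply: eq_bigr => p _.
by rewrite mul0r cexp0; ring.
Qed.

Lemma taylor_lin (a : C) f h u v d : regular_function f -> regular_function h ->
  taylor u (fun x => a * f x + h x : C^o) v d = a * taylor u f v d + taylor u h v d.
Proof.
move=> /regular_functionP[s _ fE] /regular_functionP[s' _ hE].
rewrite (taylorE _ _ _ fE) (taylorE _ _ _ hE).
rewrite (@taylorE ([seq (a * p.1, p.2) | p <- s] ++ s')) => [|w].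
  rewrite big_cat big_map mulr_sumr; congr (_ + _).
  by apply: eq_bigr => p _; rewrite !mulrA.
rewrite fE hE /expsum big_cat big_map mulr_sumr; congr (_ + _).
by apply: eq_bigr => p _; rewrite mulrA.
Qed.

Lemma taylor_cst (a : C) u v d : taylor u (fun _ => a : C^o) v d = a *+ (d == 0)%N.
Proof.
rewrite (@taylorE [:: (a, 0)]) => [|w]; last by rewrite /expsum big_seq1 /= pairing0r cexp0 mulr1.
rewrite big_seq1 /= !pairing0r cexp0 mulr1; case: d => [|d].
  by rewrite expr0 fact0 divr1 mulr1.
by rewrite expr0n mul0r mulr0.
Qed.

Lemma taylor_chr l u v d : dual_lattice L l ->
  taylor u (chr l) v d = cexp (pairing u l) * (pairing v l ^+ d / d`!%:R).
Proof.
move=> Ll; have E w : chr l (topi L w) = expsum [:: (1, l)] w.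
  by rewrite /expsum big_seq1 mul1r chr_topi.
by rewrite (taylorE _ _ _ E) big_seq1 mul1r.
Qed.

Lemma eq_taylor f h u v d : f =1 h -> taylor u f v d = taylor u h v d.
Proof. by move=> /funext ->. Qed.

Lemma taylorD f h u v d : regular_function f -> regular_function h ->
  taylor u (fun x => f x + h x : C^o) v d = taylor u f v d + taylor u h v d.
Proof.
move=> rf rh; rewrite -[taylor u f v d]mul1r -taylor_lin //.
by apply: eq_taylor => x; rewrite mul1r.
Qed.

Lemma taylorZ (a : C) f u v d : regular_function f ->
  taylor u (fun x => a * f x : C^o) v d = a * taylor u f v d.
Proof.
move=> rf; rewrite -[RHS]addr0 -[X in _ + X](mul0rn C (d == 0)%N) -(taylor_cst 0 u v) -taylor_lin //.
  by apply: eq_taylor => x; rewrite addr0.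
exact: regular_cst.
Qed.

Lemma taylorB f h u v d : regular_function f -> regular_function h ->
  taylor u (fun x => f x - h x : C^o) v d = taylor u f v d - taylor u h v d.
Proof.
move=> rf rh; rewrite addrC -mulN1r -taylor_lin //.
by apply: eq_taylor => x; rewrite mulN1r addrC.
Qed.

Lemma taylor_sum (I : Type) (r : seq I) (P : pred I) (F : I -> torus L -> C^o) u v d :
  (forall i, P i -> regular_function (F i)) ->
  taylor u (fun x => \sum_(i <- r | P i) F i x : C^o) v d =
  \sum_(i <- r | P i) taylor u (F i) v d.
Proof.
move=> H; elim: r => [|i r IH].
  rewrite big_nil; transitivity (taylor u (fun _ => 0 : C^o) v d).
    by apply: eq_taylor => x; rewrite big_nil.
  by rewrite taylor_cst mul0rn.
rewrite big_cons -IH; case Pi : (P i); last by apply: eq_taylor => x; rewrite big_cons Pi.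
rewrite -taylorD; [|exact: H|exact: regular_sum].
by apply: eq_taylor => x; rewrite big_cons Pi.
Qed.

(** On a product of two characters this is the binomial formula for $(\langle v,l\rangle + \langle
    v,m\rangle)^d/d!$; the general case follows by bilinearity. *)
Lemma taylorM f h u v d : regular_function f -> regular_function h ->
  taylor u (fun x => f x * h x : C^o) v d =
  \sum_(i < d.+1) taylor u f v i * taylor u h v (d - i).
Proof.
move=> /regular_functionP[s _ fE] /regular_functionP[s' _ hE].
under eq_bigr do rewrite (taylorE _ _ _ fE) (taylorE _ _ _ hE).
rewrite (@taylorE [seq (p.1 * q.1, p.2 + q.2) | p <- s, q <- s']) => [|w]; last first.
  by rewrite fE hE expsumM.
under [RHS]eq_bigr do rewrite mulr_suml.
rewrite exchange_big big_allpairs_dep; apply: eq_bigr => p _ /=.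
under [RHS]eq_bigr do rewrite mulr_sumr.
rewrite exchange_big; apply: eq_bigr => q _ /=.
rewrite !pairingDr cexpD [pairing v p.2 + _]addrC exprDn.
rewrite mulr_suml mulr_sumr; apply: eq_bigr => i _.
have id : (i <= d)%N by rewrite -ltnS.
have f0 k : (k`!%:R : C) != 0 by rewrite pnatr_eq0 -lt0n fact_gt0.
rewrite -(bin_fact id) !natrM; field; rewrite !f0 /=.
by rewrite pnatr_eq0 -lt0n bin_gt0.
Qed.

Lemma taylor0 f u v : taylor u f v 0 = f (topi L u).
Proof. by rewrite /taylor derive1n0 scale0r addr0 fact0 invr1 mul1r. Qed.

Lemma taylor_homo f u v (t : C) d : regular_function f ->
  taylor u f (t *: v) d = t ^+ d * taylor u f v d.
Proof.
move=> /regular_functionP[s _ fE]; rewrite !(taylorE _ _ _ fE) mulr_sumr.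
by apply: eq_bigr => p _; rewrite pairingZl exprMn; ring.
Qed.

(** The coefficients along [v] are the moments of the weights [p.1 * cexp (pairing u p.2)] at the
    nodes [pairing v p.2]. When they all vanish, interpolation allows the powers to be replaced by
    [cexp], which gives the value at [u + v]. *)
Lemma taylor_eq0_along f u v : regular_function f ->
  (forall d, taylor u f v d = 0) -> f (topi L (u + v)) = 0.
Proof.
move=> /regular_functionP[s _ fE] H; rewrite fE /expsum.
under eq_bigr do rewrite pairingDl cexpD mulrA.
apply: (moments_eq0 (a := fun p => p.1 * cexp (pairing u p.2)) (x := fun p => pairing v p.2)) => d.
have := H d; rewrite (taylorE _ _ _ fE) => Hd.
have E : \sum_(p <- s) p.1 * cexp (pairing u p.2) * pairing v p.2 ^+ d = d`!%:R *
    \sum_(p <- s) p.1 * cexp (pairing u p.2) * (pairing v p.2 ^+ d / d`!%:R).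
  rewrite mulr_sumr; apply: eq_bigr => p _.
  by rewrite [RHS]mulrC !mulrA divfK // pnatr_eq0 -lt0n fact_gt0.
by rewrite Hd mulr0 in E.
Qed.

Lemma taylor_eq0 f u : regular_function f ->
  (forall v d, taylor u f v d = 0) -> f =1 fun=> 0.
Proof.
move=> rf H x; rewrite -(topi_repr x).
by have -> : repr x = u + (repr x - u); [rewrite addrC subrK | apply: taylor_eq0_along].
Qed.

Lemma taylor_translate f u u' v d : topi L u = topi L u' -> taylor u f v d = taylor u' f v d.
Proof.
move=> E; rewrite /taylor.
have -> // : (fun t : C => f (topi L (u + t *: v))) = (fun t : C => f (topi L (u' + t *: v))).
by apply/funext => t; rewrite !topiD E.
Qed.

Lemma invariant_derivativeE s f a v : (forall v, f (topi L v) = expsum s v) ->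
  invariant_derivative a f (topi L v) =
  expsum [seq (p.1 * pairing a p.2, p.2) | p <- s] v.
Proof.
move=> fE; rewrite /invariant_derivative /expsum big_map.
have -> : (fun t : C => f (topi L v + topi L (t *: a))) =
  (fun t : C => \sum_(p <- s) p.1 * cexp (pairing v p.2 + t * pairing a p.2) : C^o).
  apply/funext => t; rewrite -topiD fE; apply: eq_bigr => p _.
  by rewrite pairingDl pairingZl.
by rewrite derive1_affine_sum; apply: eq_bigr => p _; rewrite mul0r addr0.
Qed.

Lemma regular_invariant_derivative f a : regular_function f ->
  regular_function (invariant_derivative a f : torus L -> C^o).
Proof.
move=> /regular_functionP[s Ls fE]; apply/regular_functionP.
exists [seq (p.1 * pairing a p.2, p.2) | p <- s]; last by move=> v; exact: invariant_derivativeE.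
by move=> p /mapP[q /Ls Lq ->].
Qed.

Lemma taylor_invariant_derivative f u v a d : regular_function f ->
  taylor u (invariant_derivative a f : torus L -> C^o) v d =
  directional_derivative a (fun v => taylor u f v d.+1) v.
Proof.
move=> /regular_functionP[s Ls fE].
rewrite (taylorE _ _ _ (fun v => invariant_derivativeE a v fE)) big_map /directional_derivative.
have -> : (fun t : C => taylor u f (v + t *: a) d.+1 : C^o) =
  (fun t : C => \sum_(p <- s) p.1 * cexp (pairing u p.2) / (d.+1)`!%:R *
     (pairing v p.2 + t * pairing a p.2) ^+ d.+1 : C^o).
  apply/funext => t; rewrite (taylorE _ _ _ fE); apply: eq_bigr => p _.
  by rewrite pairingDl pairingZl; ring.
rewrite derive1_affine_pow_sum; apply: eq_bigr => p _ /=.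
rewrite mul0r addr0 factS natrM; field.
by rewrite nat1r !pnatr_eq0 -lt0n fact_gt0.
Qed.

(** Euler's identity for the homogeneous term of degree [d.+1]. *)
Lemma directional_derivative_homo f u v d : regular_function f ->
  directional_derivative v (fun v => taylor u f v d.+1) v = d.+1%:R * taylor u f v d.+1.
Proof.
move=> rf; rewrite -taylor_invariant_derivative //.
move/regular_functionP: rf => [s Ls fE].
rewrite (taylorE _ _ _ (fun v' => invariant_derivativeE v v' fE)) big_map (taylorE _ _ _ fE) mulr_sumr.
apply: eq_bigr => p _ /=; rewrite exprS factS natrM; field.
by rewrite nat1r !pnatr_eq0 -lt0n fact_gt0.
Qed.

End Torus.

(** * Reflections, their roots, and stabilizers of points of the torus *)

Lemma rank1_decomp (K : fieldType) (n : nat) (A : 'M[K]_n) : \rank A = 1%N ->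
  exists l : 'cV[K]_n, exists a : 'rV[K]_n, A = l *m a.
Proof.
move=> r1; have := mulmx_base A; move: (col_base A) (row_base A); rewrite r1 => l a <-.
by exists l, a.
Qed.

Section Reflections.
Context {R : realType} {gT : finGroupType} {W : {group gT}} {n : nat}.
Local Notation C := (Cplx R).
Variable rW : mx_representation C W n.
Variable L : zmodClosed 'rV[C]_n.
Variables (alpha : gT -> 'cV[C]_n) (alphav : gT -> 'rV[C]_n).
Hypothesis Linv : invariant_lattice rW L.
Hypothesis RD : root_data rW L alpha alphav.
Implicit Types (u v a : 'rV[C]_n) (s w : gT) (f h : torus L -> C^o).

Lemma reflection_in s : reflection rW s -> s \in W.
Proof. by case/andP. Qed.

(** Rank one gives [rW s] the form $1 + l b$. The two anti-invariance relations make [b]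
    proportional to the coroot and [l] to the root, and the pairing 2 forces the product of the two
    factors to be $-1$. *)
Lemma reprE s : reflection rW s -> rW s = 1%:M - alpha s *m alphav s.
Proof.
move=> rs; have [_ /eqP/rank1_decomp[l [b rE]]] := andP rs.
have rsE : rW s = 1%:M + l *m b by rewrite -rE addrC subrK.
have H1 := coroot_anti RD rs; have H2 := root_anti RD rs; have H3 := root_pairing RD rs.
rewrite rsE mulmxDr mulmx1 in H1; rewrite rsE mulmxDl mul1mx in H2.
pose x := pairing (alphav s) l; pose y := (b *m alpha s) 0 0.
have {}H1 : x *: b = - (2 *: alphav s).
  rewrite mulmxA [alphav s *m l]mx11_scalar mul_scalar_mx in H1.
  by rewrite /x /pairing -[LHS](addKr (alphav s)) H1 -opprD scaler_nat mulr2n.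
have {}H2 : y *: l = - (2 *: alpha s).
  rewrite -mulmxA [b *m alpha s]mx11_scalar mul_mx_scalar in H2.
  by rewrite -[LHS](addKr (alpha s)) H2 -opprD scaler_nat mulr2n.
(* Pairing $x b = -2\alpha_s^\vee$ with $\alpha_s$ gives this value; in particular both scalars are
   invertible. *)
have xy : x * y = - 4.
  have -> : x * y = pairing (x *: b) (alpha s) by rewrite pairingZl.
  by rewrite H1 pairingNl pairingZl H3 -natrM.
have xn0 : x != 0 by apply/eqP => x0; move/eqP: xy; rewrite x0 mul0r eq_sym oppr_eq0 pnatr_eq0.
have yn0 : y != 0 by apply/eqP => y0; move/eqP: xy; rewrite y0 mulr0 eq_sym oppr_eq0 pnatr_eq0.
have bE : b = (- (2 / x)) *: alphav s.
  by rewrite -[LHS](scalerK xn0) H1 scalerN scalerA scaleNr [x^-1 * _]mulrC.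
have lE : l = (- (2 / y)) *: alpha s.
  by rewrite -[LHS](scalerK yn0) H2 scalerN scalerA scaleNr [y^-1 * _]mulrC.
rewrite rsE bE lE -scalemxAl -scalemxAr scalerA.
have -> : - (2 / y) * - (2 / x) = -1.
  rewrite mulrNN mulrACA -invfM [y * x]mulrC xy.
  by rewrite -natrM invrN mulrN divff // pnatr_eq0.
by rewrite scaleN1r.
Qed.

Lemma reflection_act s v : reflection rW s ->
  v *m rW s = v - pairing v (alpha s) *: alphav s.
Proof.
move=> rs; rewrite reprE // mulmxBr mulmx1 mulmxA [v *m alpha s]mx11_scalar.
by rewrite mul_scalar_mx.
Qed.

Lemma reflection_coact s (l : 'cV[C]_n) : reflection rW s ->
  rW s *m l = l - pairing (alphav s) l *: alpha s.
Proof.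
move=> rs; rewrite reprE // mulmxBl mul1mx -mulmxA [alphav s *m l]mx11_scalar.
by rewrite mul_mx_scalar.
Qed.

Lemma alpha_neq0 s : reflection rW s -> alpha s != 0.
Proof.
move=> rs; apply/eqP => a0; have := root_pairing RD rs.
by rewrite a0 pairing0r => /eqP; rewrite eq_sym pnatr_eq0.
Qed.

Lemma alphav_neq0 s : reflection rW s -> alphav s != 0.
Proof.
move=> rs; apply/eqP => a0; have := root_pairing RD rs.
by rewrite a0 pairing0l => /eqP; rewrite eq_sym pnatr_eq0.
Qed.

Lemma scale_coroot_int s (z : C) : reflection rW s -> z *: alphav s \in L ->
  exists m : int, z = m%:~R.
Proof.
move=> rs zL; have [] := coroot_generator RD rs zL.
  by rewrite -scalemxAl (coroot_anti RD rs) scalerN.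
move=> m; rewrite -scaler_int => /eqP; rewrite -subr_eq0 -scalerBl scaler_eq0.
by rewrite (negbTE (alphav_neq0 rs)) orbF subr_eq0 => /eqP ->; exists m.
Qed.

(** The vector $v - s v$ lies in [L] and is the coroot times the pairing in question; the coroot
    generates the part of [L] on its line. *)
Lemma alpha_dual s : reflection rW s -> dual_lattice L (alpha s).
Proof.
move=> rs v Lv; apply: (scale_coroot_int rs).
have -> : pairing v (alpha s) *: alphav s = v - v *m rW s.
  by rewrite reflection_act // opprB addrC subrK.
by rewrite rpredB // Linv // reflection_in.
Qed.

Lemma dual_act w l : w \in W -> dual_lattice L l -> dual_lattice L (rW w *m l).
Proof. by move=> Ww Ll v Lv; rewrite -pairing_mx; apply: Ll; exact: Linv. Qed.

Lemma torus_act_topi w v : w \in W -> torus_act rW w (topi L v) = topi L (v *m rW w).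
Proof.
move=> Ww; rewrite /torus_act; apply/topi_eq.
rewrite -mulmxBl scalemxAl; apply: Linv => //.
by apply/topi_eq; rewrite topi_repr.
Qed.

Lemma torus_actM w w' x : w \in W -> w' \in W ->
  torus_act rW w' (torus_act rW w x) = torus_act rW (w * w')%g x :> torus L.
Proof.
move=> Ww Ww'; rewrite -[x in LHS]topi_repr -[x in RHS]topi_repr.
by rewrite !torus_act_topi ?groupM // -mulmxA repr_mxM.
Qed.

Lemma torus_act1 x : torus_act rW 1%g x = x :> torus L.
Proof. by rewrite /torus_act repr_mx1 mulmx1 topi_repr. Qed.

Lemma regular_act f w : w \in W -> regular_function f ->
  regular_function (fun x => f (torus_act rW w x) : C^o).
Proof.
move=> Ww /regular_functionP[s Ls fE]; apply/regular_functionP.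
exists [seq (p.1, rW w *m p.2) | p <- s].
  by move=> p /mapP[q /Ls Lq ->]; exact: dual_act.
move=> v; rewrite (torus_act_topi _ Ww) fE /expsum big_map; apply: eq_bigr => p _ /=.
by rewrite pairing_mx.
Qed.

Lemma taylor_act f u v d w : w \in W ->
  taylor u (fun x => f (torus_act rW w x) : C^o) v d = taylor (u *m rW w) f (v *m rW w) d.
Proof.
move=> Ww; rewrite /taylor.
have -> // : (fun t : C => f (torus_act rW w (topi L (u + t *: v)))) =
  (fun t : C => f (topi L (u *m rW w + t *: (v *m rW w)))).
by apply/funext => t; rewrite torus_act_topi // mulmxDl scalemxAl.
Qed.

(** The reflection moves [u] by $\langle u,\alpha_s\rangle$ times the coroot. Since the coroot
    generates its line in [L], this is a period exactly when the scalar lies in $2\pi i\mathbb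
    Z$. *)
Lemma fixed_pointE s u : reflection rW s ->
  fixed_points rW s (topi L u) <-> cexp (pairing u (alpha s)) = 1.
Proof.
move=> rs; rewrite /fixed_points /= torus_act_topi ?reflection_in //.
rewrite topi_eq reflection_act // addrAC subrr add0r scalerN scalerA rpredN.
split=> [/(scale_coroot_int rs)[m Em]|/eqP/cexp_eq1P[m ->]].
  by apply/eqP/cexp_eq1P; exists m; rewrite -Em mulrA divff ?twopii_neq0 // mul1r.
rewrite mulKf ?twopii_neq0 // scaler_int; apply: rpredMz; exact: (coroot_lattice RD rs).
Qed.

Lemma stabilizer_reflection s u : reflection rW s ->
  (s \in stabilizer rW (topi L u)) = (cexp (pairing u (alpha s)) == 1).
Proof.
move=> rs; rewrite inE reflection_in //=; apply/eqP/eqP => /fixed_pointE; exact.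
Qed.

Lemma reflection_conj s w : w \in W -> reflection rW s -> reflection rW (s ^ w)%g.
Proof.
move=> Ww /andP[Ws /eqP rs]; apply/andP; split; first by rewrite groupJ.
have -> : rW (s ^ w)%g - 1%:M = rW w^-1%g *m (rW s - 1%:M) *m rW w.
  have Vw : rW w^-1%g *m rW w = 1%:M by rewrite -repr_mxM ?groupV // mulVg repr_mx1.
  by rewrite conjgE !repr_mxM ?groupM ?groupV // mulmxBr mulmx1 mulmxBl -!mulmxA Vw.
rewrite mxrankMfree ?row_free_unit ?repr_mx_unit //.
by rewrite eqmxMfull ?row_full_unit ?repr_mx_unit ?groupV // rs.
Qed.

(** The roots are chosen separately for each reflection, so conjugation matches them only up to a
    scalar; the ratios of pairings in Dunkl operators do not see it. *)
Lemma alpha_conj s w : w \in W -> reflection rW s ->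
  exists2 k : C, k != 0 & rW w *m alpha (s ^ w)%g = k *: alpha s.
Proof.
move=> Ww rs; have rsw := reflection_conj Ww rs.
have Ws := reflection_in rs.
have H := root_anti RD rsw.
have H' : rW s *m (rW w *m alpha (s ^ w)%g) = - (rW w *m alpha (s ^ w)%g).
  rewrite -mulmxN -H !mulmxA -!repr_mxM ?groupJ // conjgE.
  by rewrite !mulgA mulgV mul1g.
rewrite reflection_coact // in H'.
pose k := pairing (alphav s) (rW w *m alpha (s ^ w)%g).
have E : rW w *m alpha (s ^ w)%g = (k / 2) *: alpha s.
  apply: (scalerI (a := 2)); first by rewrite pnatr_eq0.
  rewrite scalerA mulrC divfK ?pnatr_eq0 //.
  have -> : 2 *: (rW w *m alpha (s ^ w)%g) = rW w *m alpha (s ^ w)%g + rW w *m alpha (s ^ w)%g.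
    by rewrite scaler_nat mulr2n.
  by move/eqP: H'; rewrite subr_eq addrC -subr_eq opprK => /eqP.
exists (k / 2) => //; apply/eqP => k0; move: E; rewrite k0 scale0r => /(congr1 (mulmx (rW w^-1%g))).
rewrite mulmxA -repr_mxM ?groupV // mulVg repr_mx1 mul1mx mulmx0 => /eqP.
exact/negP/alpha_neq0.
Qed.

Lemma in_stabilizer (g : torus L) w :
  (w \in stabilizer rW g) = (w \in W) && (torus_act rW w g == g).
Proof. by rewrite inE. Qed.

Lemma stabilizer_conj (g : torus L) s w : w \in W -> s \in W ->
  ((s ^ w)%g \in stabilizer rW (torus_act rW w g)) = (s \in stabilizer rW g).
Proof.
move=> Ww Ws; have Wsw := groupJ Ws Ww.
rewrite !in_stabilizer Ws Wsw !andTb (torus_actM _ Ww Wsw).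
have -> : (w * s ^ w)%g = (s * w)%g by rewrite conjgE !mulgA mulgV mul1g.
rewrite -(torus_actM _ Ws Ww); apply/eqP/eqP => [|-> //].
move=> /(congr1 (torus_act rW w^-1%g)); have Wv : (w^-1)%g \in W by rewrite groupV.
by rewrite !(torus_actM _ Ww Wv) mulgV !torus_act1.
Qed.

End Reflections.

Section RootSystem.
Context {R : realType} {gT : finGroupType} {W : {group gT}} {n : nat}.
Local Notation C := (Cplx R).
Variable rW : mx_representation C W n.
Variable L : zmodClosed 'rV[C]_n.
Variables (alpha : gT -> 'cV[C]_n) (alphav : gT -> 'rV[C]_n).
Hypothesis RD : root_data rW L alpha alphav.

(* A root of any root system for [W] is proportional to [alpha s] for its reflection [s]. *)
Lemma roots_separate : weyl_group_repr rW -> forall v : 'rV[C]_n,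
  (forall s, reflection rW s -> pairing v (alpha s) = 0) -> v = 0.
Proof.
move=> [_ [Phi [coroot [RS Hrefl _]]]] v Hv.
have Hal al : al \in Phi -> pairing v al = 0.
  move=> Pal; have [s Ws rs] := Hrefl _ Pal.
  have ca := root_coroot RS Pal.
  have al0 : al != 0 by apply: contraNneq (root_neq0 RS) => <-.
  have cr0 : coroot al != 0.
    by apply/eqP => c0; move: ca; rewrite c0 pairing0l => /eqP; rewrite eq_sym pnatr_eq0.
  have refl : reflection rW s.
    apply/andP; split => //; rewrite rs /reflection_mx addrAC subrr add0r mxrank_opp.
    apply/eqP/anti_leq/andP; split.
      by rewrite (leq_trans (mxrankM_maxl _ _)) // rank_leq_col.
    rewrite lt0n mxrank_eq0; apply/eqP => H0.
    have := congr1 (fun M => coroot al *m M) H0.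
    rewrite mulmx0 mulmxA [coroot al *m al]mx11_scalar mul_scalar_mx -/(pairing _ _) ca => /eqP.
    by rewrite scaler_eq0 pnatr_eq0 (negbTE cr0).
  have := reprE RD refl; rewrite rs /reflection_mx => /addrI/oppr_inj E.
  have := congr1 (fun M => v *m M *m al) E.
  rewrite !mulmxA [v *m alpha s]mx11_scalar -/(pairing v _) (Hv _ refl).
  rewrite mul_scalar_mx scale0r mul0mx [v *m al]mx11_scalar mul_scalar_mx -scalemxAl.
  rewrite [coroot al *m al]mx11_scalar -/(pairing _ _) -/(pairing _ _) ca => /matrixP/(_ 0 0).
  by rewrite !mxE eqxx mulr1n => /eqP; rewrite mulf_eq0 pnatr_eq0 orbF => /eqP.
have {}Hal l : pairing v l = 0.
  have : l \in <<Phi>>%VS by rewrite (root_span RS) memvf.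
  move=> /(coord_span (X := in_tuple Phi)) ->; rewrite /pairing mulmx_sumr summxE big1 // => i _.
  by rewrite -/(pairing v _) pairingZr Hal ?mulr0 // mem_nth.
apply/matrixP => i j; rewrite ord1 mxE -(Hal (delta_mx j 0)) pairingE.
rewrite (bigD1 j) //= big1 ?addr0 => [|k kj]; rewrite !mxE ?eqxx ?mulr1 //.
by rewrite (negbTE kj) mulr0.
Qed.

End RootSystem.

(** * Reflection hypertori, their equations, and division by them *)

Section Hypertori.
Context {R : realType} {gT : finGroupType} {W : {group gT}} {n : nat}.
Local Notation C := (Cplx R).
Variable rW : mx_representation C W n.
Variable L : zmodClosed 'rV[C]_n.
Variables (alpha : gT -> 'cV[C]_n) (alphav : gT -> 'rV[C]_n).
Variable chi : set (torus L) -> torus L -> C.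
Hypothesis Linv : invariant_lattice rW L.
Hypothesis RD : root_data rW L alpha alphav.
Hypothesis HE : hypertorus_equations rW chi.
Implicit Types (u v a : 'rV[C]_n) (s w : gT) (f h : torus L -> C^o) (T : set (torus L)).

(** The level set of [chi T] lies in the fixed locus of [s], so along a direction killed by the
    exponent [l] the character of [alpha s] stays 1; hence [alpha s] is a multiple [k] of [l].
    Moving by $2\pi i b$ with $\langle b,l\rangle = 1$ stays in [T], so [k] is an integer. A point
    of [T] determines the constant [z], and the character of [alpha s] becomes the [k]-th power of
    [chi T]. *)
Lemma hypertorusE s T : reflection rW s -> hypertori rW s T ->
  exists z : C, exists l : 'cV[C]_n, exists k : int,
  [/\ dual_lattice L l, k != 0, alpha s = k%:~R *: l,
      forall v, chi T (topi L v) = z * cexp (pairing v l)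
    & forall v, cexp (pairing v (alpha s)) = chi T (topi L v) ^ k].
Proof.
move=> rs HT; have [|[z z0 [l Ll chiE]] Tdef] := HE (T := T); first by exists s.
have [x0 Hx0 Tx0] := HT.
have TH : T `<=` fixed_points rW s by move=> y; rewrite -Tx0; exact: connected_component_sub.
have Tx : T x0 by rewrite -Tx0; exact: connected_component_refl.
pose v0 := repr x0.
have inT v : T (topi L v) <-> z * cexp (pairing v l) = 1.
  by rewrite -[X in X (topi L v)]Tdef /= chiE.
have z1 : z * cexp (pairing v0 l) = 1 by apply/inT; rewrite topi_repr.
have inH v : T (topi L v) -> cexp (pairing v (alpha s)) = 1.
  by move=> /TH/(fixed_pointE Linv RD _ rs).
have kerl v : pairing v l = 0 -> pairing v (alpha s) = 0.
  move=> vl; apply/eqP; apply: contraT => va.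
  have H t : cexp (t * pairing v (alpha s)) = 1.
    have /inH : T (topi L (v0 + t *: v)).
      by apply/inT; rewrite pairingDl pairingZl vl mulr0 addr0.
    rewrite pairingDl pairingZl cexpD (_ : cexp (pairing v0 _) = 1) ?mul1r //.
    by apply: inH; rewrite topi_repr.
  (* At this parameter the exponent is half a period, so $1 = 2m$ for an integer [m]. *)
  have := H (twopii / 2 / pairing v (alpha s)); rewrite divfK // => /eqP/cexp_eq1P[m Em].
  move: Em => /(mulfI twopii_neq0) /(congr1 ( *%R 2)); rewrite divff ?pnatr_eq0 //.
  rewrite -[2]/(2%:~R) -intrM => /eqP; rewrite -[1]/(1%:~R) eqr_int => /eqP.
  by case: m => [] [|[|m]].
have l0 : l != 0.
  apply/eqP => l0; have := alpha_neq0 RD rs.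
  rewrite (pairing_eq0 (l := alpha s)) ?eqxx // => v; apply: kerl.
  by rewrite l0 pairing0r.
have [b bl] : exists b, pairing b l = 1.
  have [b bl] : exists b, pairing b l != 0.
    apply: contrapT => H; move/eqP: l0; apply; apply: pairing_eq0 => v.
    by apply/eqP; apply: contrapT => /negP vl; apply: H; exists v.
  by exists ((pairing b l)^-1 *: b); rewrite pairingZl mulVf.
have alE : alpha s = pairing b (alpha s) *: l.
  apply/subr0_eq; apply: pairing_eq0 => v; rewrite pairingBr pairingZr.
  have -> : pairing v (alpha s) = pairing (v - pairing v l *: b) (alpha s) + pairing v l * pairing b (alpha s).
    by rewrite pairingBl pairingZl subrK.
  rewrite (kerl (v - pairing v l *: b)); last by rewrite pairingBl pairingZl bl mulr1 subrr.
  by rewrite add0r mulrC subrr.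
have Ha0 : cexp (pairing v0 (alpha s)) = 1 by apply: inH; rewrite topi_repr.
have [k kE] : exists k : int, pairing b (alpha s) = k%:~R.
  have /inH : T (topi L (v0 + twopii *: b)).
    by apply/inT; rewrite pairingDl pairingZl bl mulr1 cexpD cexp_twopii mulr1.
  rewrite pairingDl cexpD Ha0 mul1r pairingZl => /eqP/cexp_eq1P[m].
  by move=> /(mulfI twopii_neq0) ->; exists m.
rewrite kE in alE.
exists z, l, k; split => //.
  by apply: contraNneq (alpha_neq0 RD rs) => k0; rewrite alE k0 scale0r.
move=> v; rewrite chiE alE pairingZr cexpMz exprzMl ?unitfE ?cexp_neq0 //.
have -> : z = cexp (- pairing v0 l).
  by rewrite cexpN -[LHS](mulfK (cexp_neq0 (pairing v0 l))) z1 mul1r.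
by rewrite -[X in X * _]cexpMz mulrN cexpN -pairingZr -alE Ha0 invr1 mul1r.
Qed.

Lemma hypertorus_regular T : reflection_hypertorus rW T -> regular_function (chi T : torus L -> C^o).
Proof.
move=> HT; have [[z _ [l Ll chiE]] _] := HE HT.
by apply: eq_regular (regularZ z (regular_chr Ll)) _ => x; rewrite -(topi_repr x) chiE chr_topi.
Qed.

Lemma hypertorus_neq0 T x : reflection_hypertorus rW T -> chi T x != 0.
Proof.
move=> HT; have [[z z0 [l Ll chiE]] _] := HE HT.
by rewrite -(topi_repr x) chiE mulf_neq0 ?cexp_neq0.
Qed.

Lemma hypertorus_eq1 T x : reflection_hypertorus rW T -> chi T x = 1 <-> T x.
Proof. by move=> HT; have [_ {2}<-] := HE HT. Qed.

Lemma hypertori_in s T : reflection rW s -> hypertori rW s T -> reflection_hypertorus rW T.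
Proof. by move=> rs HT; exists s. Qed.

Lemma hypertorus_component s T x : hypertori rW s T -> T x ->
  T = torus_component (fixed_points rW s) x.
Proof. by move=> [y _ <-]; exact: same_connected_component. Qed.

Lemma component_hypertorus s x : fixed_points rW s x ->
  hypertori rW s (torus_component (fixed_points rW s) (x : torus L)).
Proof. by exists x. Qed.

Lemma component_self s (x : torus L) : fixed_points rW s x -> torus_component (fixed_points rW s) x x.
Proof. exact: connected_component_refl. Qed.

Lemma hypertorus_sub s T x : hypertori rW s T -> T x -> fixed_points rW s x.
Proof. by move=> [y _ <-]; exact: connected_component_sub. Qed.

(* A level set of [chi T] is stable under [ker (alpha s)], and [fixed_points s] consists of at most
   two cosets of the image of [ker (alpha s)]. *)
Lemma finite_hypertori s : reflection rW s -> finite_set (hypertori rW s : set (set (torus L))).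
Proof.
move=> rs; pose Z v : set (torus L) := torus_component (fixed_points rW s) (topi L v).
apply: (sub_finite_set (B := [set Z 0; Z ((twopii / 2) *: alphav s)])); last first.
  by apply: finite_set2.
move=> T HT; have [z [l [k [Ll k0 alE chiE _]]]] := hypertorusE rs HT.
have rT := hypertori_in rs HT.
have shift u v : pairing v (alpha s) = 0 -> T (topi L u) -> T (topi L (u - v)).
  move=> va /(hypertorus_eq1 _ rT) Tu; apply/(hypertorus_eq1 _ rT); rewrite -Tu !chiE.
  suff -> : pairing (u - v) l = pairing u l by [].
  move/eqP: va; rewrite pairingBl alE pairingZr mulf_eq0 intr_eq0 (negbTE k0) /= => /eqP ->.
  by rewrite subr0.
have [x0 Hx0 _] := HT.
have Tx0 : exists x, T x.
  by case: HT => x Hx <-; exists x; apply: connected_component_refl.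
have {Tx0} [x Tx] := Tx0; pose u := repr x.
have Tu : T (topi L u) by rewrite topi_repr.
have Fu := hypertorus_sub HT Tu.
have /eqP/cexp_eq1P[m Em] := (fixed_pointE Linv RD u rs).1 Fu.
have aa := root_pairing RD rs.
have Lav : alphav s \in L by exact: (coroot_lattice RD rs).
(* Translation by a coroot period changes [m] by 2, because the coroot pairs to 2 with the root;
   only the parity of [m] distinguishes cosets. *)
pose b := (m %% 2)%Z; pose q := (m %/ 2)%Z.
have mE : m = q * 2 + b by exact: divz_eq.
pose p := (twopii / 2 * b%:~R) *: alphav s.
have Tp : T (topi L p).
  rewrite -(@topi_twopii _ _ _ p (alphav s *~ q)) ?rpredMz //.
  rewrite (_ : p + _ = u - (u - p - twopii *: (alphav s *~ q))); last first.
    by rewrite -[X in _ = _ - X]addrA -opprD subKr.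
  apply: shift Tu; rewrite !pairingBl Em /p (_ : alphav s *~ q = q%:~R *: alphav s); last by rewrite scaler_int.
  rewrite !pairingZl aa mE intrD intrM.
  by field.
have b01 : b = 0 \/ b = 1.
  have : (0 <= b < 2)%R by rewrite modz_ge0 // ltz_mod.
  by case: b {p Tp mE} => [[|[|k']]|k'] //; [left|right].
rewrite (hypertorus_component HT Tp) /p; case: b01 => ->; [left|right].
  by rewrite mulr0 scale0r.
by rewrite mulr1.
Qed.

Lemma HregP u : Hreg rW (topi L u) <->
  forall s, reflection rW s -> cexp (pairing u (alpha s)) != 1.
Proof.
split=> [Hu s rs|Hu T [s rs HT] Tu].
  apply/eqP => /(fixed_pointE Linv RD u rs) Fu.
  apply: (Hu (torus_component (fixed_points rW s) (topi L u))); last exact: component_self.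
  by exists s => //; exact: component_hypertorus.
by have /eqP := Hu s rs; apply; apply/(fixed_pointE Linv RD u rs)/hypertorus_sub/Tu.
Qed.

(** On a character $e^p$ with $m = \langle\alpha_s^\vee, p\rangle$ the difference is
    $e^p(e^{-m\alpha_s} - 1)$, and $e^{\alpha_s} = \chi_T^k$. So it contains the factor
    $\chi_T^{-mk} - 1$, which is divisible by $\chi_T - 1$; for negative powers the inverse of
    $\chi_T$ is again regular. *)
Lemma reflection_quotient s T f : reflection rW s -> hypertori rW s T -> regular_function f ->
  exists2 q : torus L -> C^o, regular_function q &
    forall x, (chi T x - 1) * q x = f (torus_act rW s x) - f x.
Proof.
move=> rs HT /regular_functionP[r Lr fE].
have [z [l [k [Ll k0 alE chiE chik]]]] := hypertorusE rs HT.
have rT := hypertori_in rs HT.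
have rchi := hypertorus_regular rT.
have rchiV : regular_function (fun x => (chi T x)^-1 : C^o).
  apply: eq_regular (regularZ z^-1 (regular_chr (dual_latticeN Ll))) _ => x.
  by rewrite -(topi_repr x) chiE chr_topi ?pairingNr ?cexpN ?invfM //; exact: dual_latticeN.
have pow (m : int) : exists2 q : torus L -> C^o, regular_function q &
    forall x, (chi T x - 1) * q x = chi T x ^ m - 1.
  case: m => m.
    exists (fun x => \sum_(i < m) chi T x ^+ i); last by move=> x; rewrite -exprnP subrX1.
    by apply: regular_sum => i _; exact: regularX.
  exists (fun x => - (chi T x)^-1 ^+ m.+1 * \sum_(i < m.+1) chi T x ^+ i).
    apply: regularM; last by apply: regular_sum => i _; exact: regularX.
    apply: eq_regular (regularZ (-1) (regularX m.+1 rchiV)) _ => x; by rewrite mulN1r.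
  move=> x; rewrite NegzE -exprnN mulrCA -subrX1 mulrBr mulr1 mulNr opprK -exprMn.
  by rewrite mulVf ?hypertorus_neq0 // expr1n exprVn addrC.
have term (p : C * 'cV[C]_n) : p \in r -> exists2 q : torus L -> C^o, regular_function q &
    forall v, (chi T (topi L v) - 1) * q (topi L v) =
       p.1 * cexp (pairing (v *m rW s) p.2) - p.1 * cexp (pairing v p.2).
  move=> /Lr Lp.
  have [m mE] := Lp _ (coroot_lattice RD rs).
  have [q rq qE] := pow (- (m * k)).
  exists (fun x => p.1 * (chr p.2 x * q x)).
    by apply: regularZ; apply: regularM => //; exact: regular_chr.
  move=> v; rewrite chr_topi // mulrCA [_ * (_ * q _)]mulrCA qE.
  rewrite pairing_mx (reflection_coact RD _ rs) pairingBr pairingZr mE cexpD cexpN cexpMz chik.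
  rewrite mulrBr mulr1 mulrBr; congr (_ - _).
  by rewrite [m * k]mulrC -invr_expz -exprz_exp.
have [q rq qE] : exists2 q : torus L -> C^o, regular_function q &
    forall v, (chi T (topi L v) - 1) * q (topi L v) =
       \sum_(p <- r) (p.1 * cexp (pairing (v *m rW s) p.2) - p.1 * cexp (pairing v p.2)).
  elim: (r) term => [|p r' IH] term.
    exists (fun _ => 0); first exact: regular_cst.
    by move=> v; rewrite big_nil mulr0.
  have [q1 rq1 q1E] := term p (mem_head _ _).
  have [|q2 rq2 q2E] := IH; first by move=> p' pr; apply: term; rewrite inE pr orbT.
  exists (fun x => q1 x + q2 x); first exact: regularD.
  by move=> v; rewrite big_cons mulrDr q1E q2E.
exists q => // x; rewrite -(topi_repr x) qE (torus_act_topi Linv) ?(reflection_in rs) //.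
by rewrite !fE /expsum -sumrB.
Qed.

End Hypertori.

(** * Generic vectors and density of the regular points *)

Lemma nonroot_exists (K : numDomainType) (p : {poly K}) : p != 0 -> exists t, p.[t] != 0.
Proof.
move=> p0; apply: contrapT => H.
suff : (size [seq i%:R : K | i <- iota 0 (size p)] < size p)%N by rewrite size_map size_iota ltnn.
apply: max_poly_roots => //.
  apply/allP => x _; rewrite /root; apply: contrapT => /negP px; apply: H; exists x.
  exact: px.
by rewrite map_inj_uniq ?iota_uniq // => i j /eqP; rewrite eqr_nat => /eqP.
Qed.

(** On the moment curve $(1, t, t^2, \dots)$ each nonzero linear form becomes a nonzero polynomial
    in $t$, and the product of these has a nonroot. *)
Lemma generic_vector (K : numFieldType) (n : nat) (I : finType) (P : pred I) (l : I -> 'cV[K]_n) :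
  (forall i, P i -> l i != 0) -> exists v : 'rV[K]_n, forall i, P i -> pairing v (l i) != 0.
Proof.
move=> l0; pose p := \prod_(i | P i) rVpoly (l i)^T.
have p0 : p != 0.
  apply/prodf_neq0 => x Px.
  apply/eqP => H; have /eqP := l0 x Px; apply; apply: trmx_inj.
  by rewrite -[LHS]rVpolyK H trmx0 linear0.
have [t pt] := nonroot_exists p0.
exists (\row_j t ^+ j) => i Pi.
have -> : pairing (\row_j t ^+ j) (l i) = (rVpoly (l i)^T).[t].
  rewrite pairingE (horner_coef_wide _ (size_poly _ _)); apply: eq_bigr => j _.
  by rewrite coef_rVpoly_ord !mxE mulrC.
by move: pt; rewrite /p horner_prod => /prodf_neq0; apply.
Qed.

Section Density.
Context {R : realType} {n : nat}.
Local Notation C := (Cplx R).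
Variable L : zmodClosed 'rV[C]_n.

(* Seen on the first two Taylor coefficients. *)
Lemma chr_sub1_torsionfree l (f : torus L -> C^o) : dual_lattice L l -> l != 0 ->
  regular_function f -> (forall x, f x * (chr l x - 1) = 0) -> f =1 fun=> 0.
Proof.
move=> Ll l0 rf H x; rewrite -(topi_repr x); set u := repr x.
have [v vl] : exists v, pairing v l != 0.
  apply: contrapT => Hn; move/eqP: l0; apply; apply: pairing_eq0 => v.
  by apply/eqP; apply: contrapT => /negP vl; apply: Hn; exists v.
have rc : regular_function (fun x : torus L => chr l x - 1 : C^o).
  by apply: regularB; [exact: regular_chr | exact: regular_cst].
have tc d : taylor u (fun x : torus L => chr l x - 1 : C^o) v d =
    cexp (pairing u l) * (pairing v l ^+ d / d`!%:R) - 1 *+ (d == 0%N).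
  rewrite taylorB ?taylor_cst; [|exact: regular_chr|exact: regular_cst].
  by rewrite taylor_chr.
have HM d : taylor u (fun x => f x * (chr l x - 1) : C^o) v d = 0.
  by rewrite (eq_taylor _ _ _ H) taylor_cst mul0rn.
rewrite -(taylor0 f u v).
have H0 := HM 0; rewrite taylorM // big_ord1 subnn tc expr0 fact0 divr1 mulr1 in H0.
have H1 := HM 1; rewrite taylorM // big_ord_recr big_ord1 /= subn0 subnn !tc expr0 expr1 fact0 !divr1 !mulr1 subr0 in H1.
move/eqP: H0; rewrite mulf_eq0 => /orP[/eqP //|/eqP z0].
rewrite z0 mulr0 addr0 in H1; move/eqP: H1.
by rewrite mulf_eq0 (negbTE (mulf_neq0 (cexp_neq0 _) vl)) orbF => /eqP.
Qed.

End Density.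

Section RegularPoints.
Context {R : realType} {gT : finGroupType} {W : {group gT}} {n : nat}.
Local Notation C := (Cplx R).
Variable rW : mx_representation C W n.
Variable L : zmodClosed 'rV[C]_n.
Variables (alpha : gT -> 'cV[C]_n) (alphav : gT -> 'rV[C]_n).
Hypothesis Linv : invariant_lattice rW L.
Hypothesis RD : root_data rW L alpha alphav.

Definition discriminant (x : torus L) : C^o := \prod_(s | reflection rW s) (chr (alpha s) x - 1).

Lemma regular_discriminant : regular_function discriminant.
Proof.
apply: regular_prod => s rs; apply: regularB; last exact: regular_cst.
by apply: regular_chr; exact: (alpha_dual Linv RD).
Qed.

Lemma discriminant_neq0 x : Hreg rW x <-> discriminant x != 0.
Proof.
rewrite -(topi_repr x) (HregP Linv RD); split => [H|/prodf_neq0 H] .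
  by apply/prodf_neq0 => s rs; rewrite chr_topi ?subr_eq0 ?H //; exact: (alpha_dual Linv RD).
by move=> s rs; have := H s rs; rewrite chr_topi ?subr_eq0 //; exact: (alpha_dual Linv RD).
Qed.

(** The difference times the discriminant vanishes everywhere, and the factors $e^{\alpha_s} - 1$
    can be cancelled one at a time. Through this lemma a function extended by 0 from [Hreg]
    determines the regular function it comes from. *)
Lemma regular_eq_on_Hreg (f h : torus L -> C^o) : regular_function f -> regular_function h ->
  (forall x, Hreg rW x -> f x = h x) -> f =1 h.
Proof.
move=> rf rh H.
have : forall x, (f x - h x) * discriminant x = 0.
  move=> x; have [->|/discriminant_neq0/H ->] := eqVneq (discriminant x) 0; first by rewrite mulr0.
  by rewrite subrr mul0r.
suff Hind (e : torus L -> C^o) : regular_function e ->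
    (forall x, e x * discriminant x = 0) -> forall x, e x = 0.
  by move=> /Hind H0 x; apply/subr0_eq/H0/regularB.
rewrite /discriminant; elim: (index_enum gT) e => [|s r IH] e re He x.
  by have := He x; rewrite big_nil mulr1.
case rs : (reflection rW s); last by apply: IH => // y; have := He y; rewrite big_cons rs.
have La := alpha_dual Linv RD rs.
apply: (chr_sub1_torsionfree La (alpha_neq0 RD rs) re).
apply: IH => [|y]; last by have := He y; rewrite big_cons rs mulrA.
by apply: regularM => //; apply: regularB; [exact: regular_chr | exact: regular_cst].
Qed.

Lemma Hreg_stabilizer (x : torus L) : Hreg rW x <-> forall s, reflection rW s -> s \notin stabilizer rW x.
Proof.
rewrite -(topi_repr x) (HregP Linv RD).
by split=> H s rs; have := H s rs; rewrite (stabilizer_reflection Linv RD).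
Qed.

Lemma Hreg_act w (x : torus L) : w \in W -> Hreg rW x -> Hreg rW (torus_act rW w x).
Proof.
move=> Ww /Hreg_stabilizer Hx; apply/Hreg_stabilizer => s rs.
have Wv : (w^-1)%g \in W by rewrite groupV.
have rs' := reflection_conj Wv rs.
have Ws' := reflection_in rs'.
by have := Hx _ rs'; rewrite -(stabilizer_conj Linv x Ww Ws') conjgKV.
Qed.

(** Because of this, extension by 0 outside [Hreg] does not affect derivatives at points of
    [Hreg]. *)
Lemma Hreg_near (x : torus L) (a : 'rV[C]_n) : Hreg rW x ->
  \forall t \near (0 : C), Hreg rW (x + topi L (t *: a)).
Proof.
move=> Hx; have := regular_discriminant => /regular_functionP[r _ rE].
have dE : (fun t : C => discriminant (x + topi L (t *: a)) : C^o) =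
    (fun t : C => \sum_(p <- r) p.1 * cexp (pairing (repr x) p.2 + t * pairing a p.2) : C^o).
  apply/funext => t; rewrite -{1}(topi_repr x) -topiD rE; apply: eq_bigr => p _.
  by rewrite pairingDl pairingZl.
have ct : {for (0 : C), continuous (fun t : C => discriminant (x + topi L (t *: a)) : C^o)}.
  rewrite dE; apply: differentiable_continuous; apply/derivable1_diffP.
  have H p : is_derive (0 : C) 1 (fun t : C => p.1 * cexp (pairing (repr x) p.2 + t * pairing a p.2) : C^o)
     (p.1 * (pairing a p.2 * cexp (pairing (repr x) p.2 + 0 * pairing a p.2))).
    exact: (is_deriveZ p.1 (derivable_cexp_affine (pairing (repr x) p.2) (pairing a p.2) 0)).
  by have [] := is_derive_big r H.
have d0 : discriminant (x + topi L (0 *: a)) != 0.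
  by rewrite scale0r /topi raddf0 addr0; apply/discriminant_neq0.
have := ct; move=> /cvgr_neq0 => /(_ d0) H.
near=> t; apply/discriminant_neq0; near: t; exact: H.
Unshelve. all: by end_near. Qed.

Lemma Hreg_exists : exists x : torus L, Hreg rW x.
Proof.
apply: contrapT => H.
have := regular_eq_on_Hreg (regular_cst L 1) (regular_cst L 0).
have Hn (x : torus L) : Hreg rW x -> 1 = 0 :> C by move=> Hx; case: H; exists x.
by move=> /(_ Hn 0)/eqP; rewrite oner_eq0.
Qed.

End RegularPoints.

(** * Formal inversion and division of power series *)

Section PowerSeries.
Context {K : fieldType}.
Implicit Types u w q phi : nat -> K.

(** Course-of-values recursion: the list of earlier values is built structurally, and each new value
    is computed from it. *)
Lemma seq_recursion (T : Type) (x0 : T) (F : seq T -> T) :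
  exists w : nat -> T, forall d, w d = F (mkseq w d).
Proof.
pose build := fix build d := if d is d'.+1 then rcons (build d') (F (build d')) else [::].
have sb d : size (build d) = d by elim: d => //= d IH; rewrite size_rcons IH.
pose w d := nth x0 (build d.+1) d.
have bE d : build d = mkseq w d.
  elim: d => //= d IH; rewrite /mkseq -addn1 iotaD map_cat /= -/(mkseq w d) -IH add0n -cats1.
  by rewrite /w /= nth_rcons sb ltnn eqxx.
by exists w => d; rewrite -bE /w /= nth_rcons sb ltnn eqxx.
Qed.

Lemma power_series_inverse u : u 0 != 0 ->
  exists w, forall d, \sum_(i < d.+1) u i * w (d - i)%N = (d == 0%N)%:R.
Proof.
move=> u0; pose F (s : seq K) :=
  ((size s == 0%N)%:R - \sum_(i < size s) u i.+1 * s`_(size s - i.+1)) / u 0.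
have [w wE] := seq_recursion 0 F; exists w => d.
rewrite big_ord_recl subn0 {1}wE /F size_mkseq mulrC divfK //.
rewrite [X in _ - X + _](_ : _ = \sum_(i < d) u (bump 0 i) * w (d - bump 0 i)%N) ?subrK //.
apply: eq_bigr => i _; rewrite nth_mkseq //.
by rewrite subnSK // leq_subr.
Qed.

(** Associativity $w(uq) = (wu)q$, taken in polynomials truncated above degree [d], which have the
    same coefficients up to [d]. *)
Lemma conv_inverse u w q phi :
  (forall d, \sum_(i < d.+1) u i * w (d - i)%N = (d == 0%N)%:R) ->
  (forall d, \sum_(i < d.+1) u i * q (d - i)%N = phi d) ->
  forall d, q d = \sum_(i < d.+1) w i * phi (d - i)%N.
Proof.
move=> uw uq d; pose p (f : nat -> K) := \poly_(i < d.+1) f i.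
have pE f k : (k <= d)%N -> (p f)`_k = f k by move=> kd; rewrite coef_poly ltnS kd.
have pM f h k : (k <= d)%N -> (p f * p h)`_k = \sum_(i < k.+1) f i * h (k - i)%N.
  move=> kd; rewrite coefM; apply: eq_bigr => i _.
  by rewrite !pE // (leq_trans _ kd) // ?leq_subr // -ltnS.
have := congr1 (fun r : {poly K} => r`_d) (mulrA (p w) (p u) (p q)).
rewrite coefM [in RHS]coefM.
have -> : \sum_(j < d.+1) (p w)`_j * (p u * p q)`_(d - j) = \sum_(i < d.+1) w i * phi (d - i)%N.
  by apply: eq_bigr => i _; rewrite pE ?pM ?uq ?leq_subr // -ltnS.
move=> ->; rewrite big_ord_recl /= [p w * p u]mulrC pM // uw mul1r subn0 pE // big1 ?addr0 //.
by move=> i _; rewrite pM ?uw ?mul0r.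
Qed.
End PowerSeries.

Section FormalDivision.
Context {K : numFieldType}.

(* Division by the Taylor series of [z exp (t x) - 1]; at [z = 1] the inverse has a simple pole in [x]. *)
Lemma formal_division (z : K) : exists b : nat -> K, forall (x : K) (q phi : nat -> K),
  (z = 1 -> x != 0) ->
  (forall d, \sum_(i < d.+1) (z * (x ^+ i / i`!%:R) - (i == 0%N :> nat)%:R) * q (d - i)%N = phi d) ->
  forall d, q d = (z == 1)%:R * (phi d.+1 / x) + \sum_(j < d.+1) b j * x ^+ j * phi (d - j)%N.
Proof.
have [z1|z1] := eqVneq z 1; last first.
  (* The inverse at [x = 1], with its coefficient of degree [i] scaled by [x ^+ i], is the inverse
     for every [x]; so [b] can be chosen before [x]. *)
  have [|w wE] := @power_series_inverse _ (fun i => z / i`!%:R - (i == 0%N)%:R).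
    by rewrite fact0 divr1 subr_eq0.
  exists w => x q phi _ H d; rewrite mul0r add0r.
  apply: (@conv_inverse _ (fun i => (z / i`!%:R - (i == 0%N)%:R) * x ^+ i) (fun i => w i * x ^+ i)) => {}d.
    rewrite (eq_bigr (fun i : 'I_d.+1 => x ^+ d * ((z / i`!%:R - (i == 0%N :> nat)%:R) * w (d - i)%N))).
      by rewrite -mulr_sumr wE; case: d => [|d]; rewrite ?mulr1 ?mulr0 ?expr0.
    move=> i _; have -> : x ^+ d = x ^+ (d - i) * x ^+ i by rewrite -exprD subnK // leq_ord.
  by ring.
  rewrite -H; apply: eq_bigr => i _; congr (_ * _).
  by case: (i : nat) => [|i']; rewrite /= ?expr0 ?subr0; ring.
(* For [z = 1] a factor [x] is split off and the series with coefficients $1/(i+1)!$ is inverted.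
   Its constant term 1 produces the pole term, and the shifted remainder is [b]. *)
have [|w wE] := @power_series_inverse _ (fun i => (i.+1`!%:R : K)^-1).
  by rewrite invr1 oner_neq0.
have w0 : w 0 = 1 by have := wE 0; rewrite big_ord1 subnn invr1 mul1r.
exists (fun j => w j.+1) => x q phi /(_ z1) x0; rewrite z1 => H d; rewrite mul1r.
have H0 : phi 0 = 0 by rewrite -H big_ord1 expr0 fact0 divr1 mulr1 subrr mul0r.
have HS e : phi e.+1 / x = \sum_(i < e.+1) ((i.+1`!%:R)^-1 * x ^+ i) * q (e - i)%N.
  rewrite -H big_ord_recl /= expr0 fact0 divr1 mulr1 subrr mul0r add0r mulr_suml.
  by apply: eq_bigr => i _; rewrite /bump /= add1n subSS subr0 mul1r exprS; field; rewrite x0 pnatr_eq0 -lt0n fact_gt0.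
rewrite (@conv_inverse _ (fun i => (i.+1`!%:R)^-1 * x ^+ i) (fun i => w i * x ^+ i) q (fun e => phi e.+1 / x)) => [|{}d|{}d]; last by rewrite HS.
  rewrite big_ord_recl /= w0 expr0 subn0 !mul1r; congr (_ + _).
  rewrite big_ord_recr /= subnn H0 mulr0 addr0; apply: eq_bigr => i _.
  rewrite /bump /= add1n subnSK // exprS; field; exact: x0.
rewrite (eq_bigr (fun i : 'I_d.+1 => x ^+ d * ((i.+1`!%:R)^-1 * w (d - i)%N))).
  by rewrite -mulr_sumr wE; case: d => [|d]; rewrite ?mulr1 ?mulr0 ?expr0.
move=> i _; have -> : x ^+ d = x ^+ (d - i) * x ^+ i by rewrite -exprD subnK // leq_ord.
by ring.
Qed.
End FormalDivision.

Section Restriction.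
Context {T : Type} {V : zmodType}.
Implicit Types (f : T -> V) (D : set T).

Lemma restrict_in f D x : D x -> (f \_ D) x = f x.
Proof. by move=> Dx; rewrite patchE mem_set. Qed.
Lemma restrict_out f D x : ~ D x -> (f \_ D) x = 0.
Proof. by move=> Dx; rewrite patchE memNset. Qed.
Lemma eq_restrict f f' D : (forall x, D x -> f x = f' x) -> f \_ D = f' \_ D.
Proof.
move=> H; apply/funext => x; have [Dx|Dx] := pselect (D x).
  by rewrite !restrict_in // H.
by rewrite !restrict_out.
Qed.

Lemma restrict0 D : (fun _ : T => 0 : V) \_ D = (fun _ => 0).
Proof. by apply/funext => x; rewrite patchE; case: ifP. Qed.
End Restriction.

Lemma restrict_lin (T : Type) (K : pzRingType) (D : set T) (a : K) (f h : T -> K^o) :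
  (fun x => a * f x + h x : K^o) \_ D = (fun x => a * (f \_ D) x + (h \_ D) x).
Proof.
apply/funext => x; have [Dx|Dx] := pselect (D x); first by rewrite !restrict_in.
by rewrite !restrict_out // mulr0 addr0.
Qed.

(** * Local expansion of the trigonometric Dunkl operators *)

Section TrigonometricDunkl.
Context {R : realType} {gT : finGroupType} {W : {group gT}} {n : nat}.
Local Notation C := (Cplx R).
Variable rW : mx_representation C W n.
Variable L : zmodClosed 'rV[C]_n.
Variables (alpha : gT -> 'cV[C]_n) (alphav : gT -> 'rV[C]_n).
Variables (chi : set (torus L) -> torus L -> C) (c : set (torus L) -> C).
Hypothesis Linv : invariant_lattice rW L.
Hypothesis RD : root_data rW L alpha alphav.
Hypothesis HE : hypertorus_equations rW chi.
Local Notation HregL := (@Hreg R gT W n rW L).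
Implicit Types (u v a : 'rV[C]_n) (s w : gT) (f h : torus L -> C^o) (T : set (torus L)).

(** The derivative of $\chi_T$ along [a] is $\langle a,l\rangle\chi_T$, so with $q = (sf -
    f)/(\chi_T - 1)$ the term is $\langle a,l\rangle\chi_T q = \langle a,l\rangle(q + (sf - f))$,
    and the coefficients of [q] come from [formal_division]. On the wall of [s] the division fails,
    but the whole term vanishes when [a] is parallel to that wall. *)
Lemma hypertorus_term s T f a : reflection rW s -> hypertori rW s T -> regular_function f ->
  exists2 q : torus L -> C^o, regular_function q &
  (forall x, Hreg rW x -> invariant_derivative a (chi T) x / (chi T x - 1) *
     (f (torus_act rW s x) - f x) = q x) /\
  forall u, exists rho : nat -> C, forall v d,
   (chi T (topi L u) = 1 -> pairing v (alpha s) != 0 \/ pairing a (alpha s) = 0) ->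
   taylor u q v d =
     (chi T (topi L u) == 1)%:R * (pairing a (alpha s) / pairing v (alpha s) *
        (taylor (u *m rW s) f (v *m rW s) d.+1 - taylor u f v d.+1)) +
     \sum_(j < d.+1) rho j * pairing v (alpha s) ^+ j *
        (taylor (u *m rW s) f (v *m rW s) (d - j) - taylor u f v (d - j)).
Proof.
move=> rs HT rf.
have [z [l [k [Ll k0 alE chiE chik]]]] := hypertorusE Linv RD HE rs HT.
have rT := hypertori_in rs HT.
have rchi := hypertorus_regular HE rT.
have [q rq qE] := reflection_quotient Linv RD HE rs HT rf.
have Ws := reflection_in rs.
have rsf := regular_act Linv Ws rf.
have rchi1 : regular_function (fun x => chi T x - 1 : C^o).
  by apply: regularB => //; exact: regular_cst.
have kn : (k%:~R : C) != 0 by rewrite intr_eq0.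
exists (fun x => pairing a l * (chi T x * q x)); first by apply: regularZ; exact: regularM.
split=> [x Hx|u].
  have c1 : chi T x - 1 != 0.
    by rewrite subr_eq0; apply/eqP => /(hypertorus_eq1 HE x rT); exact: Hx.
  rewrite -qE mulrA divfK // mulrA; congr (_ * _).
  have E v : chi T (topi L v) = expsum [:: (z, l)] v by rewrite chiE /expsum big_seq1.
  rewrite -(topi_repr x) (invariant_derivativeE _ _ E) chiE /expsum big_seq1 /=; ring.
have [b bE] := formal_division (chi T (topi L u)).
(* [b j] accompanies the [j]-th power of [pairing v l], whence the division by the power of [k] once
   this is rewritten with [alpha s]; the summand at [j = 0] accounts for $\chi q = q + (\chi -
   1)q$. *)
exists (fun j => pairing a l * (b j / k%:~R ^+ j + (j == 0%N)%:R)) => v d Hv.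
pose phi e := taylor (u *m rW s) f (v *m rW s) e - taylor u f v e.
have phiE e : taylor u (fun x => (chi T x - 1) * q x : C^o) v e = phi e.
  rewrite (eq_taylor _ _ _ qE) taylorB // (taylor_act Linv) //.
have -> : taylor u (fun x => pairing a l * (chi T x * q x) : C^o) v d =
    pairing a l * (taylor u q v d + phi d).
  rewrite taylorZ; last exact: regularM.
  rewrite -phiE -taylorD //; last exact: regularM.
  by congr (_ * _); apply: eq_taylor => x; ring.
have al v' : pairing v' (alpha s) = k%:~R * pairing v' l by rewrite alE pairingZr.
have [a0|a0] := eqVneq (pairing a l) 0.
  rewrite !al a0 !(mul0r, mulr0) big1 ?addr0 // => j _.
  by rewrite !mul0r.
have taylorc e : taylor u (fun x => chi T x - 1 : C^o) v e =
    chi T (topi L u) * (pairing v l ^+ e / e`!%:R) - (e == 0%N)%:R.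
  rewrite taylorB ?taylor_cst //; last exact: regular_cst.
  have E v' : chi T (topi L v') = expsum [:: (z, l)] v' by rewrite chiE /expsum big_seq1.
  by rewrite (taylorE _ _ _ E) big_seq1 chiE.
have x0 : chi T (topi L u) = 1 -> pairing v l != 0.
  move=> /Hv; rewrite !al => -[|/eqP]; first by rewrite mulf_eq0 negb_or => /andP[].
  by rewrite mulf_eq0 (negbTE kn) (negbTE a0).
have -> := bE (pairing v l) (taylor u q v) phi x0 _ d; last first.
  by move=> e; rewrite -phiE taylorM //; apply: eq_bigr => i _; rewrite taylorc.
rewrite -addrA mulrDr; congr (_ + _).
  case: eqP => [/x0 v0|_]; last by rewrite !mul0r mulr0.
  by rewrite !mul1r -/(phi d.+1) !al; field; rewrite v0 kn.
rewrite mulrDr mulr_sumr !(big_ord_recl d) /= subn0 expr0.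
rewrite addrAC; congr (_ + _).
  by rewrite -/(phi d) !expr0; field.
apply: eq_bigr => j _; rewrite -/(phi _) al /bump /= add1n exprMn addr0.
by field; rewrite expf_neq0.
Qed.

Lemma invariant_derivative_restrict a f x : Hreg rW x ->
  invariant_derivative a (f \_ HregL) x = invariant_derivative a f x.
Proof.
move=> Hx; rewrite /invariant_derivative !derive1E; apply: near_eq_derive.
near=> t; rewrite restrict_in //; near: t; exact: (Hreg_near Linv RD a Hx).
Unshelve. all: by end_near. Qed.

(* The local expansion of a trigonometric Dunkl operator: the rational Dunkl operator of the stabilizer,
   up to terms built from multiplication operators, reflections and translations of the base point. *)
Lemma trig_dunkl_taylor f a : regular_function f ->
  exists2 G : torus L -> C^o, regular_function G &
  trig_dunkl_operator rW chi c a (f \_ HregL) = G \_ HregL /\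
  forall u, exists rho : gT -> nat -> C, forall v d,
   (forall s, reflection rW s -> s \in stabilizer rW (topi L u) ->
      pairing v (alpha s) != 0 \/ pairing a (alpha s) = 0) ->
   taylor u G v d = directional_derivative a (fun v => taylor u f v d.+1) v +
     \sum_(s | (s \in stabilizer rW (topi L u)) && reflection rW s)
       local_parameter rW c (topi L u) s * (pairing a (alpha s) / pairing v (alpha s)) *
        (taylor u f (v *m rW s) d.+1 - taylor u f v d.+1) +
     \sum_(s | reflection rW s) \sum_(j < d.+1) rho s j * pairing v (alpha s) ^+ j *
        (taylor (u *m rW s) f (v *m rW s) (d - j) - taylor u f v (d - j)).
Proof.
move=> rf.
(* The quotients are chosen for all pairs at once; for pairs that are not a reflection with one of
   its hypertori, 0 is a filler. *)
have Hq (sT : gT * set (torus L)) : exists q : torus L -> C^o,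
  reflection rW sT.1 -> hypertori rW sT.1 sT.2 -> regular_function q /\
  (forall x, Hreg rW x -> invariant_derivative a (chi sT.2) x / (chi sT.2 x - 1) *
     (f (torus_act rW sT.1 x) - f x) = q x) /\
  forall u, exists rho : nat -> C, forall v d,
   (chi sT.2 (topi L u) = 1 -> pairing v (alpha sT.1) != 0 \/ pairing a (alpha sT.1) = 0) ->
   taylor u q v d =
     (chi sT.2 (topi L u) == 1)%:R * (pairing a (alpha sT.1) / pairing v (alpha sT.1) *
        (taylor (u *m rW sT.1) f (v *m rW sT.1) d.+1 - taylor u f v d.+1)) +
     \sum_(j < d.+1) rho j * pairing v (alpha sT.1) ^+ j *
        (taylor (u *m rW sT.1) f (v *m rW sT.1) (d - j) - taylor u f v (d - j)).
  have [[rs HT]|H] := pselect (reflection rW sT.1 /\ hypertori rW sT.1 sT.2).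
    by have [q rq qE] := hypertorus_term a rs HT rf; exists q.
  by exists (fun _ => 0) => rs HT; case: H.
have {Hq} [q qP] := choice Hq.
pose e s := finmap.enum_fset (fset_set (hypertori rW s : set (set (torus L)))).
have eP s T : reflection rW s -> T \in e s <-> hypertori rW s T.
  move=> rs; have := in_fset_set (finite_hypertori Linv RD HE rs) T.
  move=> H; have -> : (T \in e s) = (T \in hypertori rW s) by exact: H.
  by split => [/set_mem|/mem_set].
have esum s (F : set (torus L) -> C) : reflection rW s ->
    \sum_(T \in hypertori rW s) F T = \sum_(T <- e s) F T.
  by move=> rs; rewrite fsbig_finite //; exact: (finite_hypertori Linv RD HE rs).
pose G : torus L -> C^o := fun x => invariant_derivative a f x +
  \sum_(s | reflection rW s) \sum_(T <- e s) c T * q (s, T) x.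
have rG2 s : reflection rW s ->
    regular_function (fun x => \sum_(T <- e s) c T * q (s, T) x : C^o).
  move=> rs; have H T : T \in e s -> regular_function (fun x => c T * q (s, T) x : C^o).
    by move=> /(eP _ _ rs) HT; apply: regularZ; have [] := qP (s, T) rs HT.
  elim: (e s) H => [|T r IH] H.
    by apply: eq_regular (regular_cst L 0) _ => x; rewrite big_nil.
  apply: (eq_regular (f := fun x => c T * q (s, T) x + \sum_(T <- r) c T * q (s, T) x)).
    apply: regularD; first by apply: H; rewrite mem_head.
    by apply: IH => T' Tr; apply: H; rewrite inE Tr orbT.
  by move=> x; rewrite big_cons.
have rG1 := regular_invariant_derivative a rf.
exists G; first by apply: regularD => //; exact: regular_sum.
split.
  rewrite /trig_dunkl_operator; apply: eq_restrict => x Hx.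
  rewrite invariant_derivative_restrict // /G; congr (_ + _).
  apply: eq_big => [s|s /andP[Ws rs]]; first by case/boolP: (reflection rW s) => [/reflection_in ->|_]; rewrite ?andbF.
  rewrite esum // !big_seq; apply: eq_bigr => T /(eP _ _ rs) HT.
  have [_ [<- // _]] := qP (s, T) rs HT.
  by rewrite !restrict_in ?mulrA //; exact: (Hreg_act Linv RD).
move=> u.
have Hrho (sT : gT * set (torus L)) : exists rho : nat -> C,
   reflection rW sT.1 -> hypertori rW sT.1 sT.2 -> forall v d,
   (chi sT.2 (topi L u) = 1 -> pairing v (alpha sT.1) != 0 \/ pairing a (alpha sT.1) = 0) ->
   taylor u (q sT) v d =
     (chi sT.2 (topi L u) == 1)%:R * (pairing a (alpha sT.1) / pairing v (alpha sT.1) *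
        (taylor (u *m rW sT.1) f (v *m rW sT.1) d.+1 - taylor u f v d.+1)) +
     \sum_(j < d.+1) rho j * pairing v (alpha sT.1) ^+ j *
        (taylor (u *m rW sT.1) f (v *m rW sT.1) (d - j) - taylor u f v (d - j)).
  have [[rs HT]|H] := pselect (reflection rW sT.1 /\ hypertori rW sT.1 sT.2).
    by have [_ [_ /(_ u)[rho rhoE]]] := qP sT rs HT; exists rho.
  by exists (fun _ => 0) => rs HT; case: H.
have {Hrho} [rho rhoE] := choice Hrho.
exists (fun s j => \sum_(T <- e s) c T * rho (s, T) j) => v d Hv.
have -> : taylor u G v d = taylor u (invariant_derivative a f : torus L -> C^o) v d +
    \sum_(s | reflection rW s) \sum_(T <- e s) c T * taylor u (q (s, T)) v d.
  rewrite /G taylorD //; last exact: regular_sum.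
  congr (_ + _); rewrite taylor_sum //; apply: eq_bigr => s rs.
  have H T : T \in e s -> regular_function (q (s, T)).
    by move=> /(eP _ _ rs) HT; have [] := qP (s, T) rs HT.
  elim: (e s) H => [|T r IH] H.
    rewrite big_nil (@eq_taylor _ _ _ _ (fun _ => 0)) ?taylor_cst ?mul0rn // => x.
    by rewrite big_nil.
  have rT : regular_function (q (s, T)) by apply: H; rewrite mem_head.
  have Hr T' : T' \in r -> regular_function (q (s, T')).
    by move=> Tr; apply: H; rewrite inE Tr orbT.
  have rr : regular_function (fun x => \sum_(T <- r) c T * q (s, T) x : C^o).
    elim: r {IH H} Hr => [|T' r IH] Hr.
      by apply: eq_regular (regular_cst L 0) _ => x; rewrite big_nil.
    apply: (eq_regular (f := fun x => c T' * q (s, T') x + \sum_(T <- r) c T * q (s, T) x)).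
      apply: regularD; first by apply: regularZ; apply: Hr; rewrite mem_head.
      by apply: IH => T'' Tr; apply: Hr; rewrite inE Tr orbT.
    by move=> x; rewrite big_cons.
  rewrite big_cons -(IH Hr) -taylor_lin //.
  by apply: eq_taylor => x; rewrite big_cons.
rewrite taylor_invariant_derivative // -addrA; congr (_ + _).
rewrite [X in _ = X + _]big_mkcondl -big_split /=; apply: eq_bigr => s rs.
rewrite [X in _ = _ + X](_ : _ = \sum_(T <- e s) c T * \sum_(j < d.+1) rho (s, T) j * pairing v (alpha s) ^+ j *
        (taylor (u *m rW s) f (v *m rW s) (d - j) - taylor u f v (d - j))); last first.
  under [RHS]eq_bigr do rewrite mulr_sumr.
  rewrite exchange_big /=; apply: eq_bigr => j _; rewrite !mulr_suml.
  by apply: eq_bigr => T _; ring.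
pose X := pairing a (alpha s) / pairing v (alpha s) *
        (taylor (u *m rW s) f (v *m rW s) d.+1 - taylor u f v d.+1).
transitivity (\sum_(T <- e s) c T * ((chi T (topi L u) == 1)%:R * X) +
  \sum_(T <- e s) c T * \sum_(j < d.+1) rho (s, T) j * pairing v (alpha s) ^+ j *
        (taylor (u *m rW s) f (v *m rW s) (d - j) - taylor u f v (d - j))).
  rewrite -big_split /= !big_seq; apply: eq_bigr => T /(eP _ _ rs) HT.
  rewrite -mulrDr; congr (_ * _); apply: (rhoE (s, T)) => //= c1.
  apply: Hv => //; rewrite in_stabilizer (reflection_in rs) /=; apply/eqP.
  by have /(hypertorus_sub HT) := (hypertorus_eq1 HE _ (hypertori_in rs HT)).1 c1.
congr (_ + _); case: ifP => sS; last first.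
  rewrite big_seq big1 // => T /(eP _ _ rs) HT.
  case: eqP => [c1|_]; last by rewrite mul0r mulr0.
  have /(hypertorus_sub HT) Fx := (hypertorus_eq1 HE _ (hypertori_in rs HT)).1 c1.
  by move: sS; rewrite in_stabilizer (reflection_in rs) /= => /eqP; case.
have Fx : fixed_points rW s (topi L u) by move: sS; rewrite in_stabilizer => /andP[_ /eqP].
(* [T0] is the only hypertorus of [s] through the base point, so among the pole terms only its own
   survives, with coefficient [local_parameter]. *)
pose T0 := torus_component (fixed_points rW s) (topi L u).
have HT0 : hypertori rW s T0 by exact: component_hypertorus.
have T0e : T0 \in e s by apply/(eP _ _ rs).
have ue : uniq (e s) by exact: finmap.fset_uniq.
rewrite (bigD1_seq T0) //= big_seq_cond big1 => [|T /andP[/(eP _ _ rs) HT TT0]]; last first.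
  case: eqP => [c1|_]; last by rewrite mul0r mulr0.
  have Tx := (hypertorus_eq1 HE _ (hypertori_in rs HT)).1 c1.
  by move: TT0; rewrite (hypertorus_component HT Tx) eqxx.
have -> : chi T0 (topi L u) = 1.
  by apply/(hypertorus_eq1 HE _ (hypertori_in rs HT0)); exact: component_self.
have E : taylor (u *m rW s) f (v *m rW s) d.+1 = taylor u f (v *m rW s) d.+1.
  by apply: taylor_translate; rewrite -(torus_act_topi Linv _ (reflection_in rs)).
by rewrite /X E eqxx mul1r addr0 mulrA.
Qed.

End TrigonometricDunkl.

(** * Polynomial functions on the reflection representation *)

Lemma mpoly_ring_ind (K : comNzRingType) (n : nat) (P : mpoly.mpoly n K -> Prop) :
  (forall c, P (mpoly.mpolyC n c)) -> (forall i, P (mpoly.mpolyX K (mpoly.mnm1 i))) ->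
  (forall p q, P p -> P q -> P (p + q)) -> (forall p q, P p -> P q -> P (p * q)) ->
  forall p, P p.
Proof.
move=> PC PX PD PM; elim/mpoly.mpolyind => [|c m p _ _ Pp]; first by rewrite -mpoly.mpolyC0.
apply: (PD) => //; rewrite -mpoly.mul_mpolyC; apply: (PM) => //.
rewrite mpoly.mpolyXE_id; apply: big_ind => [||i _]; [exact: PC|exact: PM|].
elim: (mpoly.fun_of_multinom m i) => [|k IH]; first by rewrite expr0; exact: PC.
by rewrite exprS; apply: (PM).
Qed.

Section MpolyDerivative.
Context {K : numDomainType} {n : nat}.
Implicit Types p : mpoly.mpoly n K.

Lemma mdeg_mderiv i p k : (forall m, m \in mpoly.msupp p -> (mpoly.mdeg m < k.+1)%N) ->
  forall m, m \in mpoly.msupp (mpoly.mderiv i p) -> (mpoly.mdeg m < k)%N.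
Proof.
move=> pk m mi.
have /pk : mpoly.mnm_add m (mpoly.mnm1 i) \in mpoly.msupp p.
  rewrite mpoly.mcoeff_msupp; apply: contraTneq mi => E.
  by rewrite mpoly.mcoeff_msupp mpoly.mcoeff_mderiv E mul0rn eqxx.
by rewrite mpoly.mdegD mpoly.mdeg1 addn1.
Qed.

(** In characteristic 0 a monomial with a positive exponent survives differentiation in that
    variable. *)
Lemma mderiv_eq0 p : (forall i, mpoly.mderiv i p = 0) ->
  p = mpoly.mpolyC n (mpoly.mcoeff mpoly.mnm0 p).
Proof.
move=> H; apply/mpoly.mpolyP => m; rewrite mpoly.mcoeffC.
have [->|m0] := eqVneq m mpoly.mnm0; first by rewrite mulr1.
rewrite mulr0; apply/eqP; apply: contraT => pm.
have [i mi] : exists i, (0 < mpoly.fun_of_multinom m i)%N.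
  apply: contrapT => Hn; case/eqP: m0; apply/mpoly.mnmP => i; rewrite mpoly.mnm0E.
  by apply/eqP; rewrite -leqn0 leqNgt; apply/negP => mi; apply: Hn; exists i.
have := congr1 (mpoly.mcoeff (mpoly.mnm_sub m (mpoly.mnm1 i))) (H i).
rewrite mpoly.mcoeff_mderiv mpoly.mcoeff0.
have -> : mpoly.mnm_add (mpoly.mnm_sub m (mpoly.mnm1 i)) (mpoly.mnm1 i) = m.
  apply/mpoly.mnmP => j; rewrite mpoly.mnmDE mpoly.mnmBE mpoly.mnm1E.
  by case: eqP => [<-|_]; rewrite ?subnK ?subn0 ?addn0.
by move/eqP; rewrite mulrn_eq0 (negbTE pm).
Qed.
End MpolyDerivative.

Section PolynomialFunctions.
Context {R : realType} {n : nat}.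
Local Notation C := (Cplx R).
Implicit Types (u v a : 'rV[C]_n) (f g : 'rV[C]_n -> C^o).

Definition mev (p : mpoly.mpoly n C) : 'rV[C]_n -> C^o := fun v => mpoly.meval (fun i => v 0 i) p.

Lemma eq_polynomial f g : polynomial_function f -> f =1 g -> polynomial_function g.
Proof. by move=> pf /funext <-. Qed.

Lemma polynomial_cst (c : C) : polynomial_function (fun _ : 'rV[C]_n => c : C^o).
Proof. by exists (mpoly.mpolyC n c) => v; rewrite mpoly.mevalC. Qed.

Lemma polynomialD f g : polynomial_function f -> polynomial_function g ->
  polynomial_function (fun v => f v + g v : C^o).
Proof. by move=> [p pE] [q qE]; exists (p + q) => v; rewrite mpoly.mevalD pE qE. Qed.

Lemma polynomialM f g : polynomial_function f -> polynomial_function g ->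
  polynomial_function (fun v => f v * g v : C^o).
Proof. by move=> [p pE] [q qE]; exists (p * q) => v; rewrite mpoly.mevalM pE qE. Qed.

Lemma polynomialZ (c : C) f : polynomial_function f ->
  polynomial_function (fun v => c * f v : C^o).
Proof. by move=> pf; apply: polynomialM => //; exact: polynomial_cst. Qed.

Lemma polynomial_sum (I : Type) (r : seq I) (P : pred I) (F : I -> 'rV[C]_n -> C^o) :
  (forall i, P i -> polynomial_function (F i)) ->
  polynomial_function (fun v => \sum_(i <- r | P i) F i v : C^o).
Proof.
move=> H; elim: r => [|i r IH].
  by apply: eq_polynomial (polynomial_cst 0) _ => x; rewrite big_nil.
case Pi : (P i).
  by apply: eq_polynomial (polynomialD (H i Pi) IH) _ => x; rewrite big_cons Pi.
by apply: eq_polynomial IH _ => x; rewrite big_cons Pi.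
Qed.

Lemma polynomial_prod (I : Type) (r : seq I) (P : pred I) (F : I -> 'rV[C]_n -> C^o) :
  (forall i, P i -> polynomial_function (F i)) ->
  polynomial_function (fun v => \prod_(i <- r | P i) F i v : C^o).
Proof.
move=> H; elim: r => [|i r IH].
  by apply: eq_polynomial (polynomial_cst 1) _ => x; rewrite big_nil.
case Pi : (P i).
  by apply: eq_polynomial (polynomialM (H i Pi) IH) _ => x; rewrite big_cons Pi.
by apply: eq_polynomial IH _ => x; rewrite big_cons Pi.
Qed.

Lemma polynomialX f k : polynomial_function f -> polynomial_function (fun v => f v ^+ k : C^o).
Proof.
move=> pf; elim: k => [|k IH]; first exact: polynomial_cst.
by apply: eq_polynomial (polynomialM pf IH) _ => x; rewrite exprS.
Qed.

Lemma polynomial_pairing (l : 'cV[C]_n) : polynomial_function (fun v => pairing v l : C^o).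
Proof.
have H j : polynomial_function (fun v : 'rV[C]_n => v 0 j * l j 0 : C^o).
  apply: polynomialM; last exact: polynomial_cst.
  by exists (mpoly.mpolyX C (mpoly.mnm1 j)) => v; rewrite mpoly.mevalXU.
by apply: eq_polynomial (polynomial_sum (index_enum 'I_n) (fun j _ => H j)) _ => v; rewrite pairingE.
Qed.

Lemma polynomial_ind (Q : ('rV[C]_n -> C^o) -> Prop) :
  (forall c : C, Q (fun=> c)) -> (forall i, Q (fun v => v 0 i)) ->
  (forall f g, Q f -> Q g -> Q (fun v => f v + g v)) ->
  (forall f g, Q f -> Q g -> Q (fun v => f v * g v)) ->
  forall f, polynomial_function f -> Q f.
Proof.
move=> QC QX QD QM f [p pE]; have -> : f = mev p by apply/funext.
elim/mpoly_ring_ind: p {f pE} => [c|i|p q Qp Qq|p q Qp Qq].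
- have -> : mev (mpoly.mpolyC n c) = (fun=> c) by apply/funext => v; exact: mpoly.mevalC.
  exact: QC.
- have -> : mev (mpoly.mpolyX C (mpoly.mnm1 i)) = (fun v => v 0 i).
    by apply/funext => v; exact: mpoly.mevalXU.
  exact: QX.
- have -> : mev (p + q) = (fun v => mev p v + mev q v) by apply/funext => v; exact: mpoly.mevalD.
  exact: QD.
- have -> : mev (p * q) = (fun v => mev p v * mev q v) by apply/funext => v; exact: mpoly.mevalM.
  exact: QM.
Qed.

Lemma polynomial_act f (A : 'M[C]_n) : polynomial_function f ->
  polynomial_function (fun v => f (v *m A) : C^o).
Proof.
move: f; apply: polynomial_ind => [c|i|f g pf pg|f g pf pg].
- exact: polynomial_cst.
- apply: eq_polynomial (polynomial_pairing (col i A)) _ => v.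
  by rewrite pairingE mxE; apply: eq_bigr => j _; rewrite mxE.
- exact: polynomialD.
- exact: polynomialM.
Qed.

Lemma polynomial_line f u v : polynomial_function f ->
  exists P : {poly C}, forall t : C, f (u + t *: v) = P.[t].
Proof.
move: f; apply: polynomial_ind => [c|i|f g [P PE] [Q QE]|f g [P PE] [Q QE]].
- by exists c%:P => t; rewrite hornerC.
- exists ((u 0 i)%:P + (v 0 i) *: 'X) => t.
  by rewrite !mxE hornerD hornerC hornerZ hornerX mulrC.
- by exists (P + Q) => t; rewrite hornerD PE QE.
- by exists (P * Q) => t; rewrite hornerM PE QE.
Qed.

Lemma is_derive_mev p v a (t : C) :
  is_derive t 1 (fun t : C => mev p (v + t *: a) : C^o)
    (\sum_i a 0 i * mev (mpoly.mderiv i p) (v + t *: a)).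
Proof.
elim/mpoly_ring_ind: p t => [c|i|p q Hp Hq|p q Hp Hq] t.
- rewrite big1 => [|i _]; last by rewrite mpoly.mderivC /mev mpoly.meval0 mulr0.
  have -> : (fun t : C => mev (mpoly.mpolyC n c) (v + t *: a)) = cst (c : C^o).
    by apply/funext => x; exact: mpoly.mevalC.
  exact: is_derive_cst.
- have -> : (fun t : C => mev (mpoly.mpolyX C (mpoly.mnm1 i)) (v + t *: a)) = (fun t : C => v 0 i + t * a 0 i : C^o).
    by apply/funext => x; rewrite /mev mpoly.mevalXU !mxE.
  rewrite (bigD1 i) //= big1 => [|j ji]; last first.
    by rewrite mpoly.mderivX mpoly.mnm1E eq_sym (negbTE ji) scale0r /mev mpoly.meval0 mulr0.
  rewrite mpoly.mderivX mpoly.mnm1E eqxx scale1r.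
  have -> : mpoly.mnm_sub (mpoly.mnm1 i) (mpoly.mnm1 i) = mpoly.mnm0 :> mpoly.multinom n.
    by apply/mpoly.mnmP => j; rewrite mpoly.mnmBE subnn mpoly.mnm0E.
  rewrite mpoly.mpolyX0 /mev mpoly.meval1 mulr1 addr0; exact: is_derive_affine.
- have -> : (fun t : C => mev (p + q) (v + t *: a) : C^o) =
     ((fun t : C => mev p (v + t *: a) : C^o) + (fun t : C => mev q (v + t *: a) : C^o)).
    by apply/funext => x; exact: mpoly.mevalD.
  rewrite (eq_bigr (fun i => a 0 i * mev (mpoly.mderiv i p) (v + t *: a) + a 0 i * mev (mpoly.mderiv i q) (v + t *: a))).
    by rewrite big_split; exact: is_deriveD.
  by move=> i _; rewrite -mulrDr mpoly.mderivD /mev mpoly.mevalD.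
- have -> : (fun t : C => mev (p * q) (v + t *: a) : C^o) =
     ((fun t : C => mev p (v + t *: a) : C) * (fun t : C => mev q (v + t *: a) : C)).
    by apply/funext => x; exact: mpoly.mevalM.
  have := @is_deriveM C C^o _ _ _ _ _ _ (Hp t) (Hq t); rewrite /GRing.scale /=.
  congr (is_derive _ _ _ _).
  rewrite !mulr_sumr -big_split /=; apply: eq_bigr => i _.
  rewrite mpoly.mderivM /mev mpoly.mevalD !mpoly.mevalM mulrDr addrC.
  by congr (_ + _); rewrite mulrCA //; congr (_ * _); exact: mulrC.
Qed.

Lemma directional_derivative_mev p v a :
  directional_derivative a (mev p) v = \sum_i a 0 i * mev (mpoly.mderiv i p) v.
Proof.
rewrite /directional_derivative derive1E.
by rewrite (@derive_val _ _ _ _ _ _ _ (is_derive_mev p v a 0)) scale0r addr0.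
Qed.

Lemma directional_derivative_delta p v i :
  directional_derivative (delta_mx 0 i) (mev p) v = mev (mpoly.mderiv i p) v.
Proof.
rewrite directional_derivative_mev (bigD1 i) //= big1 => [|j ji].
  by rewrite mxE !eqxx mul1r addr0.
by rewrite mxE eqxx (negbTE ji) mul0r.
Qed.

Lemma polynomial_near_neq0 f v a : polynomial_function f -> f v != 0 ->
  \forall t \near (0 : C), f (v + t *: a) != 0.
Proof.
move=> [p pE] fv; have -> : f = mev p by apply/funext.
have ct : {for (0 : C), continuous (fun t : C => mev p (v + t *: a) : C^o)}.
  apply: differentiable_continuous; apply/derivable1_diffP.
  by have [] := is_derive_mev p v a 0.
have H0 : mev p (v + 0 *: a) != 0 by rewrite scale0r addr0 /mev -pE.
exact: (cvgr_neq0 _ ct H0).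
Qed.

Lemma polynomial_taylor (L : zmodClosed 'rV[C]_n) u (f : torus L -> C^o) d : regular_function f ->
  polynomial_function (fun v => taylor u f v d : C^o).
Proof.
move=> /regular_functionP[s _ fE].
have H p : polynomial_function (fun v => p.1 * cexp (pairing u p.2) * (pairing v p.2 ^+ d / d`!%:R) : C^o).
  apply: polynomialZ; apply: polynomialM; last exact: polynomial_cst.
  by apply: polynomialX; exact: polynomial_pairing.
apply: eq_polynomial (polynomial_sum s (P := predT) (fun p _ => H p)) _ => v.
by rewrite (taylorE _ _ _ fE).
Qed.

End PolynomialFunctions.

Section GeneratedAlgebra.
Context {K : pzRingType} {V : lmodType K}.

Lemma submodule_generated (S : set (V -> V)) (N : set V) : N 0 ->
  (forall a u v, N u -> N v -> N (a *: u + v)) ->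
  (forall X v, S X -> N v -> N (X v)) -> submodule (generated_algebra S) N.
Proof.
move=> N0 NL NS; split=> // X v HX; elim: HX v => [|X' SX|a X' Y' _ IX _ IY|X' Y' _ IX _ IY] v Nv //.
- exact: NS.
- by apply: NL; [exact: IX | exact: IY].
- by apply: IX; exact: IY.
Qed.

End GeneratedAlgebra.

(** * Submodules of the rational polynomial representation *)

Section RationalCherednik.
Context {R : realType} {gT : finGroupType} {W : {group gT}} {n : nat}.
Local Notation C := (Cplx R).
Variable rW : mx_representation C W n.
Variable L : zmodClosed 'rV[C]_n.
Variables (alpha : gT -> 'cV[C]_n) (alphav : gT -> 'rV[C]_n).
Hypothesis Linv : invariant_lattice rW L.
Hypothesis RD : root_data rW L alpha alphav.
Variables (Gamma : {set gT}) (k : gT -> C).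
Hypothesis GW : Gamma \subset W.
Hypothesis Ggrp : group_set Gamma.
Local Notation hregG := (hreg rW Gamma alpha).
Implicit Types (u v a : 'rV[C]_n) (s w : gT) (f g : 'rV[C]_n -> C^o).

Lemma hreg_act w v : w \in Gamma -> hregG v -> hregG (v *m rW w).
Proof.
move=> Gw Hv s rs Gs; have Ww := fintype.subsetP GW _ Gw.
have Wv : (w^-1)%g \in W by rewrite groupV.
have rs' := reflection_conj Wv rs.
have [z z0 E] := alpha_conj RD Ww rs'.
have Gs' : (s ^ w^-1)%g \in Group Ggrp by rewrite groupJ // groupV.
by rewrite pairing_mx -(conjgKV w s) E pairingZr mulf_neq0 ?Hv.
Qed.

Lemma hreg_actV w v : w \in Gamma -> hregG (v *m rW w) -> hregG v.
Proof.
move=> Gw Hv; have Ww := fintype.subsetP GW _ Gw.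
have Gv : (w^-1)%g \in Group Ggrp by rewrite groupV.
by have := hreg_act Gv Hv; rewrite -mulmxA -repr_mxM ?groupV // mulgV repr_mx1 mulmx1.
Qed.

Definition rational_discriminant v : C^o := \prod_(s in Gamma | reflection rW s) pairing v (alpha s).

Lemma hregE v : hregG v <-> rational_discriminant v != 0.
Proof.
split=> [H|/prodf_neq0 H s rs Gs]; last by apply: H; rewrite Gs.
by apply/prodf_neq0 => s /andP[Gs rs]; exact: H.
Qed.

Lemma polynomial_discriminant : polynomial_function rational_discriminant.
Proof. by apply: polynomial_prod => s _; exact: polynomial_pairing. Qed.

(** On a line through any point in a direction off all walls, [f] and the product of the roots are
    polynomials in one variable with product 0, and the second is nonzero. *)
Lemma polynomial_eq0_hreg f : polynomial_function f -> (forall v, hregG v -> f v = 0) -> f =1 fun=> 0.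
Proof.
move=> pf H u.
have [v Hv] : exists v, forall s, reflection rW s -> pairing v (alpha s) != 0.
  exact: generic_vector (fun s rs => alpha_neq0 RD rs).
have [P PE] := polynomial_line u v pf.
pose Q := \prod_(s | reflection rW s) ((pairing u (alpha s))%:P + pairing v (alpha s) *: 'X).
have Q0 : Q != 0.
  apply/prodf_neq0 => s rs; apply/eqP => /(congr1 (fun p : {poly C} => p`_1)).
  by rewrite coefD coefC coefZ coefX mulr1 add0r coef0 => /eqP; rewrite (negbTE (Hv _ rs)).
have PQ : P * Q = 0.
  apply/eqP; apply: contraT => /nonroot_exists[t]; rewrite hornerM mulf_eq0 negb_or => /andP[Pt Qt].
  case/eqP: Pt; rewrite -PE; apply: H => s rs Gs.
  move: Qt; rewrite /Q horner_prod => /prodf_neq0/(_ s rs).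
  by rewrite hornerD hornerC hornerZ hornerX pairingDl pairingZl mulrC.
move/eqP: PQ; rewrite mulf_eq0 (negbTE Q0) orbF => /eqP P0.
by have := PE 0; rewrite scale0r addr0 P0 horner0.
Qed.

Lemma directional_derivative_restrict f v a : hregG v ->
  directional_derivative a (f \_ hregG) v = directional_derivative a f v.
Proof.
move=> Hv; rewrite /directional_derivative !derive1E; apply: near_eq_derive.
have Hn : \forall t \near (0 : C), rational_discriminant (v + t *: a) != 0.
  by apply: polynomial_near_neq0; [exact: polynomial_discriminant | exact/hregE].
near=> t; rewrite restrict_in //; apply/hregE; near: t; exact: Hn.
Unshelve. all: by end_near. Qed.

Lemma dunkl_restrict f a : dunkl_operator rW Gamma alpha k a (f \_ hregG) =
  (fun v => directional_derivative a f v + \sum_(s in Gamma | reflection rW s)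
     k s * (pairing a (alpha s) / pairing v (alpha s)) * (f (v *m rW s) - f v)) \_ hregG.
Proof.
apply: eq_restrict => v Hv; rewrite directional_derivative_restrict //; congr (_ + _).
apply: eq_bigr => s /andP[Gs rs]; rewrite !restrict_in //; exact: hreg_act.
Qed.

Section Submodule.
Variable J : set ('rV[C]_n -> C^o).
Hypothesis JS : submodule (generated_algebra (cherednik_generator rW Gamma alpha k)) J.
Local Notation J' f := (J (f \_ hregG)).

Lemma submodule_lin (a : C) f g : J' f -> J' g -> J' (fun v => a * f v + g v : C^o).
Proof.
case: JS => [_ JL _] Jf Jg; have := JL a _ _ Jf Jg; congr (J _).
exact/esym/restrict_lin.
Qed.

Lemma submodule_zero : J' (fun _ => 0 : C^o).
Proof.
case: JS => [J0 _ _]; move: J0; congr (J _).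
exact/esym/restrict0.
Qed.

Lemma submoduleZ (a : C) f : J' f -> J' (fun v => a * f v : C^o).
Proof.
move=> Jf; have := submodule_lin a Jf submodule_zero; congr (J _).
by apply: eq_restrict => v _; rewrite addr0.
Qed.

Lemma submoduleD f g : J' f -> J' g -> J' (fun v => f v + g v : C^o).
Proof.
move=> Jf Jg; have := submodule_lin 1 Jf Jg; congr (J _).
by apply: eq_restrict => v _; rewrite mul1r.
Qed.

Lemma submoduleB f g : J' f -> J' g -> J' (fun v => f v - g v : C^o).
Proof.
move=> Jf Jg; have := submodule_lin (-1) Jg Jf; congr (J _).
by apply: eq_restrict => v _; rewrite mulN1r addrC.
Qed.

Lemma submodule_sum (I : Type) (r : seq I) (P : pred I) (F : I -> 'rV[C]_n -> C^o) :
  (forall i, P i -> J' (F i)) -> J' (fun v => \sum_(i <- r | P i) F i v : C^o).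
Proof.
move=> H; elim: r => [|i r IH].
  by move: submodule_zero; congr (J _); apply: eq_restrict => v _; rewrite big_nil.
case Pi : (P i); last by move: IH; congr (J _); apply: eq_restrict => v _; rewrite big_cons Pi.
by have := submoduleD (H i Pi) IH; congr (J _); apply: eq_restrict => v _; rewrite big_cons Pi.
Qed.

Lemma submoduleM p f : polynomial_function p -> J' f -> J' (fun v => p v * f v : C^o).
Proof.
move=> pp; move: p pp f; apply: polynomial_ind => [c|i|p q Hp Hq|p q Hp Hq] f Jf.
- exact: submoduleZ.
- case: JS => [_ _ JA]; have := JA _ _ (gen_algebra_gen (cherednik_linear_form rW Gamma alpha k (delta_mx i 0))) Jf.
  congr (J _); apply/funext => v.
  have -> : pairing v (delta_mx i 0) = v 0 i.
    rewrite pairingE (bigD1 i) //= big1 => [|j ji]; last by rewrite mxE (negbTE ji) mulr0.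
    by rewrite mxE !eqxx mulr1 addr0.
  have [Hv|Hv] := pselect (hregG v); first by rewrite !restrict_in.
  by rewrite !restrict_out // mulr0.
- have := submoduleD (Hp _ Jf) (Hq _ Jf); congr (J _).
  by apply: eq_restrict => v _; rewrite mulrDl.
- have := Hp _ (Hq _ Jf); congr (J _).
  by apply: eq_restrict => v _; rewrite mulrA.
Qed.

Lemma submodule_act w f : w \in Gamma -> J' f -> J' (fun v => f (v *m rW w) : C^o).
Proof.
move=> Gw; case: JS => [_ _ JA] /(JA _ _ (gen_algebra_gen (cherednik_group rW alpha k Gw))).
have -> // : (fun v => (f \_ hregG) (v *m rW w)) = (fun v => f (v *m rW w) : C^o) \_ hregG.
apply/funext => v; have [Hv|Hv] := pselect (hregG v).
  by rewrite (restrict_in _ Hv) restrict_in //; exact: hreg_act.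
by rewrite (restrict_out _ Hv) restrict_out // => /(hreg_actV Gw).
Qed.

Lemma submodule_dunkl a f : J' f ->
  J' (fun v => directional_derivative a f v + \sum_(s in Gamma | reflection rW s)
     k s * (pairing a (alpha s) / pairing v (alpha s)) * (f (v *m rW s) - f v) : C^o).
Proof.
rewrite -dunkl_restrict; case: JS => [_ _ JA].
by move=> /(JA _ _ (gen_algebra_gen (cherednik_dunkl rW Gamma alpha k a))).
Qed.

(* Inverting the discriminant turns Dunkl operators into derivations. *)
Lemma submodule_derivative a f : J' f ->
  J' (fun v => rational_discriminant v * directional_derivative a f v : C^o).
Proof.
move=> Jf.
have J1 := submoduleM polynomial_discriminant (submodule_dunkl a Jf).
(* The discriminant cancels the pole along the wall of [s], leaving a polynomial multiple of $sf -
   f$, which lies in [J]. *)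
pose F s v : C^o := k s * pairing a (alpha s) *
  (\prod_(s' in Gamma | reflection rW s' && (s' != s)) pairing v (alpha s')) * (f (v *m rW s) - f v).
have J2 : J' (fun v => \sum_(s in Gamma | reflection rW s) F s v : C^o).
  apply: submodule_sum => s /andP[Gs rs]; apply: submoduleM; last first.
    by apply: submoduleB => //; exact: submodule_act.
  by apply: polynomialZ; apply: polynomial_prod => s' _; exact: polynomial_pairing.
have := submoduleB J1 J2; congr (J _); apply: eq_restrict => v Hv.
rewrite mulrDr -addrA [X in _ + X](_ : _ = 0) ?addr0 //.
rewrite mulr_sumr -sumrB big1 // => s /andP[Gs rs].
rewrite /F /rational_discriminant (bigD1 s) /=; last by rewrite Gs.
under [in X in _ - X]eq_bigl do rewrite andbA.
have := Hv s rs Gs => v0; field; exact: v0.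
Qed.

(** A nonzero polynomial is differentiated down to a nonzero constant, each derivative costing one
    power of the discriminant $D$. Since $D\,\partial_i(D^m) = D^m E$, the element
    $D\,\partial_i(D^m p)$ of [J] differs from $D^{m+1}\partial_i p$ by a multiple of $D^m p$. *)
Lemma submodule_discriminant : (exists2 p, mev p \_ hregG != 0 & J' (mev p)) ->
  exists N, J' (fun v => rational_discriminant v ^+ N : C^o).
Proof.
move=> [p p0 Jp]; have {}p0 : p != 0.
  apply: contraNneq p0 => ->; apply/eqP/funext => v; rewrite patchE /mev.
  by case: ifP; rewrite ?mpoly.meval0.
have [D DE] := polynomial_discriminant.
have HD m i : exists E, D * mpoly.mderiv i (D ^+ m) = D ^+ m * E.
  elim: m => [|m [E HE]].
    by exists 0; rewrite expr0 -mpoly.mpolyC1 mpoly.mderivC !mulr0.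
  exists (mpoly.mderiv i D + E); rewrite exprS mpoly.mderivM mulrDr mulrCA [D * (D * _)]mulrCA HE.
  by ring.
have [d Hd] : exists d, forall m, m \in mpoly.msupp p -> (mpoly.mdeg m < d)%N.
  by eexists => m; exact: mpoly.msize_mdeg_lt.
have {}Jp : J' (mev (D ^+ 0 * p)) by rewrite expr0 mul1r.
have [m Jm] : exists m, J' (mev (D ^+ m * p)) by exists 0%N.
elim: d p p0 m {Jp} Jm Hd => [|d IH] p p0 m Jp Hd.
  case/negP: p0; apply/eqP/mpoly.mpolyP => m'; rewrite mpoly.mcoeff0; apply/eqP.
  by rewrite -[_ == _]negbK -mpoly.mcoeff_msupp; apply/negP => /Hd.
have [H|H] := pselect (forall i, mpoly.mderiv i p = 0).
  have pE := mderiv_eq0 H; set c := mpoly.mcoeff _ _ in pE.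
  have c0 : c != 0 by apply: contraNneq p0 => c0; rewrite pE c0 mpoly.mpolyC0.
  exists m; have := submoduleZ c^-1 Jp; congr (J _); apply: eq_restrict => v _.
  rewrite pE /mev mpoly.mevalM mpoly.mevalC mulrCA mulVf // mulr1 rmorphXn /= -/(mev D v).
  by rewrite DE.
have [i Hi] : exists i, mpoly.mderiv i p != 0.
  apply: contrapT => Hn; apply: H => i; apply/eqP; apply: contrapT => /negP Hi.
  by apply: Hn; exists i.
have [E HE] := HD m i.
apply: (IH _ Hi m.+1); last by apply: mdeg_mderiv.
have J1 := submodule_derivative (delta_mx 0 i) Jp.
have J2 : J' (fun v => mev E v * mev (D ^+ m * p) v).
  by apply: submoduleM => //; exists E.
have := submoduleB J1 J2; congr (J _); apply: eq_restrict => v _.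
rewrite directional_derivative_delta DE -/(mev D v) /mev -!mpoly.mevalM -mpoly.mevalB.
congr (mpoly.meval _ _); rewrite mpoly.mderivM mulrDr mulrA HE exprS; ring.
Qed.

End Submodule.

End RationalCherednik.

(** * The group action on hypertori and on local parameters *)

Lemma continuous_mulmxr (K : numFieldType) (m n : nat) (A : 'M[K]_(m, n)) :
  continuous (fun v : 'rV[K]_m => v *m A).
Proof.
move=> v B; case=> P HP PB.
have H : \forall x \near v, forall j, P 0 j ((x *m A) 0 j).
  apply: (@filter_forall _ 'I_n (fun j x => P 0 j ((x *m A) 0 j)) (nbhs v) _) => j.
  have ct : (fun x : 'rV[K]_m => (x *m A) 0 j) @ v --> (v *m A) 0 j.
    have -> : (fun x : 'rV[K]_m => (x *m A) 0 j) = (fun x => \sum_i x 0 i * A i j).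
      by apply/funext => x; rewrite mxE.
    rewrite mxE; elim: (index_enum 'I_m) => [|i r IH].
      have -> : (fun x : 'rV[K]_m => \sum_(i <- [::]) x 0 i * A i j) = (fun=> 0).
        by apply/funext => x; rewrite big_nil.
      rewrite big_nil.
      exact: (@cvg_cst _ _ _ (nbhs v) _).
    rewrite big_cons; under eq_fun do rewrite big_cons.
    apply: (@cvgD K K^o _ (nbhs v) _ (fun x : 'rV[K]_m => x 0 i * A i j) _ (v 0 i * A i j)) => //.
    by apply: (@cvgM K _ (nbhs v) _ (fun x : 'rV[K]_m => x 0 i) (fun=> A i j));
      [exact: coord_continuous | exact: (@cvg_cst _ _ _ (nbhs v) _)].
  exact: (ct _ (HP 0 j)).
rewrite nbhs_simpl /=; apply: filterS H => x Hx; apply: PB => i j; rewrite ord1; exact: Hx.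
Qed.

Lemma mulmx_reprM (K : fieldType) (gT : finGroupType) (W : {group gT}) (m n : nat)
    (rW : mx_representation K W n) (v : 'M[K]_(m, n)) (w w' : gT) : w \in W -> w' \in W ->
  v *m rW (w * w')%g = v *m rW w *m rW w'.
Proof. by move=> Ww Ww'; rewrite repr_mxM // mulmxA. Qed.

Lemma mem_eq_restrict (T : Type) (V : zmodType) (J : set (T -> V)) (D : set T) (f f' : T -> V) :
  (forall x, D x -> f x = f' x) -> J (f \_ D) -> J (f' \_ D).
Proof. by move=> /eq_restrict ->. Qed.

Section ConjugationInvariance.
Context {R : realType} {gT : finGroupType} {W : {group gT}} {n : nat}.
Local Notation C := (Cplx R).
Variable rW : mx_representation C W n.
Variable L : zmodClosed 'rV[C]_n.
Hypothesis Linv : invariant_lattice rW L.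

Lemma continuous_torus_act w : w \in W ->
  continuous (torus_act rW w : quotient_topology (Quotient.quot (periods L)) ->
     quotient_topology (Quotient.quot (periods L))).
Proof.
move=> Ww; apply/quotient_continuous.
have -> : torus_act rW w \o \pi_(quotient_topology (Quotient.quot (periods L))) =
  \pi_(quotient_topology (Quotient.quot (periods L))) \o (fun v : 'rV[C]_n => v *m rW w).
  by apply/funext => v; exact: (torus_act_topi Linv).
move=> v; apply: continuous_comp; first exact: continuous_mulmxr.
exact: pi_continuous.
Qed.

(** The image is connected, contains the image of [g], and is fixed by the conjugate reflection, so
    maximality of components gives one inclusion; the same for the inverse of [w] gives the
    other. *)
Lemma torus_act_component w s (g : torus L) : w \in W -> s \in W -> fixed_points rW s g ->
  torus_act rW w @` torus_component (fixed_points rW s) g =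
  torus_component (fixed_points rW (s ^ w)%g) (torus_act rW w g).
Proof.
have imp w' s' (g' : torus L) : w' \in W -> s' \in W -> fixed_points rW s' g' ->
    torus_act rW w' @` torus_component (fixed_points rW s') g' `<=`
    torus_component (fixed_points rW (s' ^ w')%g) (torus_act rW w' g').
  move=> Ww Ws Fg.
  apply: (@connected_component_max (quotient_topology (Quotient.quot (periods L)))
    (fixed_points rW (s' ^ w')%g) (torus_act rW w' @` torus_component (fixed_points rW s') g')).
  - by exists g' => //; exact: connected_component_refl.
  - move=> _ [x /connected_component_sub Fx <-]; rewrite /fixed_points /=.
    have Wsw : (s' ^ w')%g \in W by rewrite groupJ.
    rewrite (torus_actM Linv _ Ww Wsw) conjgE !mulgA mulgV mul1g -(torus_actM Linv _ Ws Ww).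
    by rewrite Fx.
  - apply: (@connected_continuous_connected (quotient_topology (Quotient.quot (periods L)))
      (quotient_topology (Quotient.quot (periods L))) (torus_component (fixed_points rW s') g') (torus_act rW w')); first exact: component_connected.
    by apply: continuous_subspaceT; exact: continuous_torus_act.
move=> Ww Ws Fg; apply/seteqP; split; first exact: imp.
move=> y Hy; have Wv : (w^-1)%g \in W by rewrite groupV.
have Wsw : (s ^ w)%g \in W by rewrite groupJ.
have Fg' : fixed_points rW (s ^ w)%g (torus_act rW w g).
  rewrite /fixed_points /= (torus_actM Linv _ Ww Wsw) conjgE !mulgA mulgV mul1g -(torus_actM Linv _ Ws Ww).
  by rewrite Fg.
have := imp _ _ _ Wv Wsw Fg'; rewrite (torus_actM Linv _ Ww Wv) mulgV torus_act1 conjgK.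
move=> /(_ (torus_act rW w^-1%g y)) H; exists (torus_act rW w^-1%g y).
  by apply: H; exists y.
by rewrite (torus_actM Linv _ Wv Ww) mulVg torus_act1.
Qed.

Lemma local_parameter_conj (c : set (torus L) -> C) w s (g : torus L) : conjugation_invariant rW c ->
  w \in W -> reflection rW s -> s \in stabilizer rW g ->
  local_parameter rW c (torus_act rW w g) (s ^ w)%g = local_parameter rW c g s.
Proof.
move=> Hc Ww rs; rewrite in_stabilizer => /andP[Ws /eqP Fg].
rewrite /local_parameter -(torus_act_component Ww Ws Fg); apply: Hc => //.
by exists s => //; exists g.
Qed.

Lemma stabilizer_group (g : torus L) : group_set (stabilizer rW g).
Proof.
apply/group_setP; split; first by rewrite in_stabilizer group1 torus_act1 eqxx.
move=> x y; rewrite !in_stabilizer => /andP[Wx /eqP Ex] /andP[Wy /eqP Ey].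
by rewrite groupM // -(torus_actM Linv _ Wx Wy) Ex Ey eqxx.
Qed.

Lemma stabilizer_sub (g : torus L) : stabilizer rW g \subset W.
Proof. by apply/fintype.subsetP => w; rewrite in_stabilizer => /andP[]. Qed.

End ConjugationInvariance.

(** * From a rational submodule to a trigonometric one *)

Section FromRational.
Context {R : realType} {gT : finGroupType} {W : {group gT}} {n : nat}.
Local Notation C := (Cplx R).
Variable rW : mx_representation C W n.
Variable L : zmodClosed 'rV[C]_n.
Variables (alpha : gT -> 'cV[C]_n) (alphav : gT -> 'rV[C]_n).
Variable c : set (torus L) -> C.
Hypothesis Linv : invariant_lattice rW L.
Hypothesis RD : root_data rW L alpha alphav.
Local Notation HregL := (@Hreg R gT W n rW L).
Implicit Types (u v a : 'rV[C]_n) (s w : gT) (f h : torus L -> C^o) (T : set (torus L)).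

Variable u : 'rV[C]_n.
Local Notation g := (topi L u).
Local Notation Gamma := (stabilizer rW g).
Local Notation kappa := (local_parameter rW c g).
Local Notation hregG := (hreg rW Gamma alpha).

Variable J : set ('rV[C]_n -> C^o).
Hypothesis JS : submodule (generated_algebra (cherednik_generator rW Gamma alpha kappa)) J.

Let GW := stabilizer_sub rW g.
Let Ggrp := stabilizer_group Linv g.

(** The coefficient at the orbit point [u *m rW w] is pulled back by [w] before it is compared with
    [J]. Different [w] leading to the same orbit point give the same condition, because [J] is
    stable under the stabilizer. *)
Definition taylor_in f := forall w d, w \in W ->
  J ((fun v => taylor (u *m rW w) f (v *m rW w) d : C^o) \_ hregG).

Lemma taylor_in_lin (z : C) f h : regular_function f -> regular_function h ->
  taylor_in f -> taylor_in h -> taylor_in (fun x => z * f x + h x : C^o).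
Proof.
move=> rf rh Hf Hh w d Ww; have := submodule_lin JS z (Hf w d Ww) (Hh w d Ww).
by congr (J _); apply: eq_restrict => v _; rewrite taylor_lin.
Qed.

Lemma taylor_inM p f : regular_function p -> regular_function f ->
  taylor_in f -> taylor_in (fun x => p x * f x : C^o).
Proof.
move=> rp rf Hf w d Ww.
have H i : J ((fun v => taylor (u *m rW w) p (v *m rW w) i * taylor (u *m rW w) f (v *m rW w) (d - i) : C^o) \_ hregG).
  apply: (submoduleM JS) (Hf w (d - i)%N Ww).
  by apply: (@polynomial_act _ _ (fun v => taylor (u *m rW w) p v i)); exact: polynomial_taylor.
have := submodule_sum JS (index_enum 'I_d.+1) (P := predT) (fun i _ => H i).
by congr (J _); apply: eq_restrict => v _; rewrite taylorM.
Qed.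

Lemma taylor_in_act f w : w \in W -> taylor_in f -> taylor_in (fun x => f (torus_act rW w x) : C^o).
Proof.
move=> Ww Hf w' d Ww'; have := Hf (w' * w)%g d (groupM Ww' Ww).
congr (J _); apply: eq_restrict => v _.
by rewrite (taylor_act Linv _ _ _ _ Ww) !(mulmx_reprM _ _ Ww' Ww).
Qed.

(** A form of divisibility that passes to products; it serves to factor the rational discriminant
    out of the discriminant of the torus. *)
Definition taylor_dvd w (q : 'rV[C]_n -> C^o) f := forall d, exists r : 'rV[C]_n -> C^o,
  polynomial_function r /\ forall v, taylor (u *m rW w) f (v *m rW w) d = q v * r v.

Lemma taylor_dvdM w (q q' : 'rV[C]_n -> C^o) f f' : regular_function f -> regular_function f' ->
  taylor_dvd w q f -> taylor_dvd w q' f' ->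
  taylor_dvd w (fun v => q v * q' v) (fun x => f x * f' x).
Proof.
move=> rf rf' H H' d; have [r rP] := choice H; have [r' rP'] := choice H'.
exists (fun v => \sum_(i < d.+1) r i v * r' (d - i)%N v); split.
  by apply: polynomial_sum => i _; apply: polynomialM; [have [] := rP i | have [] := rP' (d - i)%N].
move=> v; rewrite taylorM // mulr_sumr; apply: eq_bigr => i _.
by have [_ ->] := rP i; have [_ ->] := rP' (d - i)%N; rewrite mulrACA.
Qed.

Lemma taylor_dvd1 w f : regular_function f -> taylor_dvd w (fun _ => 1) f.
Proof.
move=> rf d; exists (fun v => taylor (u *m rW w) f (v *m rW w) d); split; last by move=> v; rewrite mul1r.
by apply: (@polynomial_act _ _ (fun v => taylor (u *m rW w) f v d)); exact: polynomial_taylor.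
Qed.

Lemma regular_root_factor s : reflection rW s -> regular_function (fun x : torus L => chr (alpha s) x - 1 : C^o).
Proof.
move=> rs; apply: regularB; last exact: regular_cst.
by apply: regular_chr; exact: (alpha_dual Linv RD).
Qed.

(** The character of the conjugate root is 1 at the orbit point, so the constant term of the series
    cancels and the later coefficients are multiples of positive powers of the root. *)
Lemma taylor_dvd_root w s : w \in W -> reflection rW s -> s \in Gamma ->
  taylor_dvd w (fun v => pairing v (alpha s)) (fun x => chr (alpha (s ^ w)%g) x - 1).
Proof.
move=> Ww rs Gs d.
have rsw := reflection_conj Ww rs; have Ws := reflection_in rs.
have La := alpha_dual Linv RD rsw.
have [z z0 E] := alpha_conj RD Ww rs.
have cu : cexp (pairing (u *m rW w) (alpha (s ^ w)%g)) = 1.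
  apply/eqP; rewrite -(stabilizer_reflection Linv RD _ rsw).
  have -> : topi L (u *m rW w) = torus_act rW w g by rewrite (torus_act_topi Linv).
  by rewrite (stabilizer_conj Linv g Ww Ws).
have tE v : taylor (u *m rW w) (fun x : torus L => chr (alpha (s ^ w)%g) x - 1 : C^o) (v *m rW w) d =
    (z * pairing v (alpha s)) ^+ d / d`!%:R - 1 *+ (d == 0%N).
  rewrite taylorB ?taylor_cst ?taylor_chr ?cu ?mul1r //.
  - by rewrite pairing_mx E pairingZr.
  - exact: regular_chr.
  - exact: regular_cst.
case: d tE => [|d] tE.
  exists (fun _ => 0); split; first exact: polynomial_cst.
  by move=> v; rewrite tE expr0 fact0 divr1 subrr mulr0.
exists (fun v => z * (z * pairing v (alpha s)) ^+ d * (d.+1`!%:R)^-1); split.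
  apply: polynomialM; last exact: polynomial_cst.
  apply: polynomialZ; apply: polynomialX; apply: polynomialZ; exact: polynomial_pairing.
by move=> v; rewrite tE subr0 exprS; ring.
Qed.

(** Reindexing by conjugation with [w] aligns the factors at the orbit point with the roots at [u];
    a reflection outside the stabilizer contributes the divisor 1. *)
Lemma taylor_dvd_discriminant w : w \in W ->
  taylor_dvd w (rational_discriminant rW alpha Gamma) (discriminant rW alpha).
Proof.
move=> Ww.
have -> : discriminant rW alpha = (fun x : torus L => \prod_(s | reflection rW s) (chr (alpha (s ^ w)%g) x - 1)).
  apply/funext => x; rewrite /discriminant.
  rewrite (@reindex_inj _ _ _ _ _ (fun s => reflection rW s) (fun s => chr (alpha s) x - 1) (conjg_inj w)).
  apply: eq_bigl => s.
  apply/idP/idP => rs; last exact: reflection_conj Ww rs.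
  have Wv : (w^-1)%g \in W by rewrite groupV.
  by rewrite -(conjgK w s); exact: reflection_conj Wv rs.
have -> : rational_discriminant rW alpha Gamma =
    (fun v => \prod_(s | reflection rW s) (if s \in Gamma then pairing v (alpha s) else 1)).
  by apply/funext => v; rewrite /rational_discriminant big_mkcondl.
elim: (index_enum gT) => [|s r IH].
  have -> : (fun v : 'rV[C]_n => \prod_(s <- [::] | reflection rW s) (if s \in Gamma then pairing v (alpha s) else 1)) = (fun _ => 1).
    by apply/funext => v; rewrite big_nil.
  by apply: taylor_dvd1; apply: regular_prod => s rs; apply: regular_root_factor; exact: reflection_conj Ww rs.
have [rs|rs] := boolP (reflection rW s); last first.
  move: IH; congr (taylor_dvd w _ _); apply/funext => x; by rewrite big_cons (negbTE rs).
have rsw := reflection_conj Ww rs.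
have H1 : taylor_dvd w (fun v => if s \in Gamma then pairing v (alpha s) else 1) (fun x => chr (alpha (s ^ w)%g) x - 1).
  case Gs : (s \in Gamma); first exact: taylor_dvd_root.
  by apply: taylor_dvd1; exact: regular_root_factor.
have rp : regular_function (fun x : torus L => \prod_(s <- r | reflection rW s) (chr (alpha (s ^ w)%g) x - 1) : C^o).
  by apply: regular_prod => s' rs'; apply: regular_root_factor; exact: reflection_conj Ww rs'.
have := taylor_dvdM (regular_root_factor rsw) rp H1 IH.
by congr (taylor_dvd w _ _); apply/funext => x; rewrite big_cons rs.
Qed.

Lemma taylor_dvdX w q f N : regular_function f -> taylor_dvd w q f ->
  taylor_dvd w (fun v => q v ^+ N) (fun x => f x ^+ N).
Proof.
move=> rf qf; elim: N => [|N IH]; first by apply: taylor_dvd1; exact: regular_cst.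
have := taylor_dvdM rf (regularX N rf) qf IH.
by congr (taylor_dvd w _ _); apply/funext => x; rewrite exprS.
Qed.

Lemma taylor_in_discriminant N : J ((fun v => rational_discriminant rW alpha Gamma v ^+ N : C^o) \_ hregG) ->
  taylor_in (fun x => discriminant rW alpha x ^+ N).
Proof.
move=> JN w d Ww.
have [r [rp rE]] := taylor_dvdX N (regular_discriminant Linv RD) (taylor_dvd_discriminant Ww) d.
have := submoduleM JS rp JN; apply: mem_eq_restrict => v _.
by rewrite rE mulrC.
Qed.

Variable chi : set (torus L) -> torus L -> C.
Hypothesis HE : hypertorus_equations rW chi.
Hypothesis Hc : conjugation_invariant rW c.

(** Pulled back by [w], the expansion at the orbit point becomes the rational Dunkl operator along
    [a *m rW w^-1] on the coefficient of degree [d.+1], plus polynomial multiples of coefficients of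
    degree at most [d] at orbit points. Both parts lie in [J]. *)
Lemma taylor_in_dunkl f a (G : torus L -> C^o) : regular_function f -> taylor_in f ->
  regular_function G -> trig_dunkl_operator rW chi c a (f \_ HregL) = G \_ HregL -> taylor_in G.
Proof.
move=> rf Hf rG GE w d Ww.
have [G' rG' [G'E Hexp]] := trig_dunkl_taylor c Linv RD HE a rf.
have {GE} GG' : G =1 G'.
  apply: (regular_eq_on_Hreg Linv RD rG rG') => x Hx.
  by rewrite -(restrict_in G Hx) -GE G'E restrict_in.
have {Hexp} [rho Hexp] := Hexp (u *m rW w).
have Wv : (w^-1)%g \in W by rewrite groupV.
pose psi v := taylor (u *m rW w) f (v *m rW w) d.+1 : C^o.
have J1 := submodule_dunkl RD GW Ggrp JS (a *m rW w^-1%g) (Hf w d.+1 Ww).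
pose B s j v : C^o := rho s j * pairing (v *m rW w) (alpha s) ^+ j *
   (taylor (u *m rW w *m rW s) f (v *m rW w *m rW s) (d - j) - taylor (u *m rW w) f (v *m rW w) (d - j)).
have J2 : J ((fun v => \sum_(s | reflection rW s) \sum_(j < d.+1) B s j v : C^o) \_ hregG).
  apply: (submodule_sum JS) => s rs; apply: (submodule_sum JS) => j _.
  have Ws := reflection_in rs.
  have pol : polynomial_function (fun v => rho s j * pairing (v *m rW w) (alpha s) ^+ j : C^o).
    apply: polynomialZ; apply: polynomialX.
    by apply: eq_polynomial (polynomial_pairing (rW w *m alpha s)) _ => v; rewrite pairing_mx.
  have H1 : J ((fun v => taylor (u *m rW w *m rW s) f (v *m rW w *m rW s) (d - j) : C^o) \_ hregG).
    apply: (mem_eq_restrict _ (Hf (w * s)%g (d - j)%N (groupM Ww Ws))) => v _.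
    by rewrite !(mulmx_reprM _ _ Ww Ws).
  exact: (submoduleM JS pol (submoduleB JS H1 (Hf w (d - j)%N Ww))).
have := submoduleD JS J1 J2; congr (J _); apply: eq_restrict => v Hv.
rewrite (eq_taylor _ _ _ GG').
have VK x : x *m rW w^-1%g *m rW w = x :> 'rV[C]_n.
  by rewrite -(mulmx_reprM rW x Wv Ww) mulVg repr_mx1 mulmx1.
have actw : torus_act rW w g = topi L (u *m rW w) by exact: (torus_act_topi Linv).
have conj_in s : reflection rW s -> ((s ^ w)%g \in stabilizer rW (topi L (u *m rW w))) = (s \in Gamma).
  by move=> rs; rewrite -actw; exact: (stabilizer_conj Linv g Ww (reflection_in rs)).
rewrite Hexp; last first.
  move=> s rs Ss; left.
  have rs' := reflection_conj Wv rs; have [z z0 E] := alpha_conj RD Ww rs'.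
  have Gs' : (s ^ w^-1)%g \in Gamma by rewrite -conj_in // conjgKV.
  by rewrite -(conjgKV w s) pairing_mx E pairingZr mulf_neq0 ?Hv.
apply: (congr2 +%R); last by [].
apply: (congr2 +%R).
  rewrite /directional_derivative; apply: (congr1 (fun e : C -> C^o => derive1 e 0)); apply/funext => t.
  by rewrite mulmxDl -scalemxAl VK.
(* Conjugation by [w] carries the reflections in the stabilizer of [g] to those at the orbit point.
   The parameters agree by invariance of [c], and the scalar between the roots cancels in the ratio
   of pairings. *)
rewrite [RHS](reindex_inj (conjg_inj w)) /=.
apply: eq_big => [s|s /andP[Gs rs]].
  apply/andP/andP => -[Gs rs].
    by split; [rewrite conj_in | exact: reflection_conj Ww rs].
  have rs' : reflection rW s by rewrite -(conjgK w s); exact: reflection_conj Wv rs.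
  by split; [rewrite -conj_in | ].
have Ws := reflection_in rs.
have [z z0 E] := alpha_conj RD Ww rs.
have -> : local_parameter rW c (topi L (u *m rW w)) (s ^ w)%g = kappa s.
  by rewrite -actw; exact: (local_parameter_conj Linv Hc Ww rs Gs).
have -> : v *m rW w *m rW (s ^ w)%g = v *m rW s *m rW w.
  rewrite -(mulmx_reprM rW v Ww (groupJ Ws Ww)) -(mulmx_reprM rW v Ws Ww).
  by rewrite conjgE !mulgA mulgV mul1g.
have -> // : pairing a (alpha (s ^ w)%g) / pairing (v *m rW w) (alpha (s ^ w)%g) =
    pairing (a *m rW w^-1%g) (alpha s) / pairing v (alpha s).
have aE : pairing a (alpha (s ^ w)%g) = z * pairing (a *m rW w^-1%g) (alpha s).
  by rewrite -pairingZr -E -pairing_mx VK.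
rewrite aE (pairing_mx v) E pairingZr.
have v0 := Hv s rs Gs; field.
by rewrite v0 z0.
Qed.

End FromRational.

Section ReducibleFromRational.
Context {R : realType} {gT : finGroupType} {W : {group gT}} {n : nat}.
Local Notation C := (Cplx R).
Variable rW : mx_representation C W n.
Variable L : zmodClosed 'rV[C]_n.
Variables (alpha : gT -> 'cV[C]_n) (alphav : gT -> 'rV[C]_n).
Variables (chi : set (torus L) -> torus L -> C) (c : set (torus L) -> C).
Hypothesis Linv : invariant_lattice rW L.
Hypothesis RD : root_data rW L alpha alphav.
Hypothesis HE : hypertorus_equations rW chi.
Hypothesis Hc : conjugation_invariant rW c.
Local Notation HregL := (@Hreg R gT W n rW L).

Theorem reducible_of_Red (g : torus L) : Red_at rW alpha g c ->
  reducible_module (daha rW chi c) (polynomial_representation rW L).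
Proof.
rewrite -(topi_repr g); set u := repr g; move=> [J [JS JP J0 JT]].
pose Jin (f : torus L -> C^o) := taylor_in rW alpha u J f.
have rD := regular_discriminant Linv RD.
exists [set F | exists f : torus L -> C^o, [/\ regular_function f, Jin f & F = f \_ HregL]].
split.
- apply: submodule_generated.
  + exists (fun _ => 0); split; first exact: regular_cst.
      move=> w d Ww; apply: mem_eq_restrict (submodule_zero JS) => v _.
      by rewrite taylor_cst mul0rn.
    exact/esym/restrict0.
  + move=> a F H [f [rf Hf ->]] [h [rh Hh ->]].
    exists (fun x => a * f x + h x); split; [exact: regular_lin | exact: (taylor_in_lin JS) |].
    exact/esym/restrict_lin.
  + move=> X F; case=> [p rp|w Ww|a] [f [rf Hf ->]].
    * exists (fun x => p x * f x); split; [exact: regularM | exact: (taylor_inM JS) |].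
      apply/funext => x; have [Hx|Hx] := pselect (HregL x); first by rewrite !restrict_in.
      by rewrite !restrict_out // mulr0.
    * exists (fun x => f (torus_act rW w x)); split; [exact: (regular_act Linv) | exact: (taylor_in_act Linv) |].
      apply/funext => x; have [Hx|Hx] := pselect (HregL x).
        by rewrite (restrict_in _ Hx) restrict_in //; exact: (Hreg_act Linv RD Ww Hx).
      rewrite (restrict_out _ Hx) restrict_out // => Hw; apply: Hx.
      have Wv : (w^-1)%g \in W by rewrite groupV.
      by have := Hreg_act Linv RD Wv Hw; rewrite (torus_actM Linv _ Ww Wv) mulgV torus_act1.
    * have [G rG [GE _]] := trig_dunkl_taylor c Linv RD HE a rf.
      exists G; split => //; exact: (taylor_in_dunkl Linv RD JS HE Hc rf Hf rG GE).
- by move=> _ [f [rf _ ->]]; exists f.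
- have [f0 Jf0 nf0] : exists2 f, J f & f <> 0.
    apply: contrapT => H; apply: J0; apply/seteqP; split => f /=; last first.
      by move=> ->; case: JS.
    by move=> Jf; apply: contrapT => nf; apply: H; exists f.
  have [p [q qE] pE] := JP _ Jf0.
  have pq : p = mev q by apply/funext.
  have [N JN] : exists N, J ((fun v => rational_discriminant rW alpha (stabilizer rW (topi L u)) v ^+ N : C^o) \_ (hreg rW (stabilizer rW (topi L u)) alpha)).
    apply: (submodule_discriminant RD (stabilizer_sub rW _) (stabilizer_group Linv _) JS).
    exists q; last by rewrite -pq pE.
    by rewrite -pq pE; apply/eqP.
  have HD := taylor_in_discriminant Linv RD JS JN.
  move=> N0; have [x Hx] := Hreg_exists Linv RD.
  have : [set F | exists f : torus L -> C^o, [/\ regular_function f, Jin f & F = f \_ HregL]]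
     ((fun x => discriminant rW alpha x ^+ N : C^o) \_ HregL).
    by exists (fun x => discriminant rW alpha x ^+ N); split => //; exact: regularX.
  rewrite N0 /= => /(congr1 (fun F => F x)); rewrite restrict_in // => /eqP.
  by apply/negP; rewrite expf_neq0 //; apply/(discriminant_neq0 Linv RD).
- move=> NT.
  have : polynomial_representation rW L ((fun _ => 1 : C^o) \_ HregL).
    by exists (fun _ => 1) => //; exact: regular_cst.
  rewrite -NT => -[f [rf Jf fE]].
  have f1 : f =1 (fun _ => 1).
    apply: (regular_eq_on_Hreg Linv RD rf (regular_cst L 1)) => x Hx.
    by rewrite -(restrict_in f Hx) -fE restrict_in.
  (* Properness is read off from the constant coefficient at [g]: if 1 satisfied the condition, [J]
     would contain 1 and hence all polynomials. *)
  have J1 : J ((fun _ => 1 : C^o) \_ (hreg rW (stabilizer rW (topi L u)) alpha)).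
    apply: mem_eq_restrict (Jf 1%g 0%N (group1 W)) => v _.
    by rewrite taylor0 f1.
  apply: JT; apply/seteqP; split=> // _ [p pp <-].
  apply: mem_eq_restrict (submoduleM JS pp J1) => v _.
  by rewrite mulr1.
Qed.

End ReducibleFromRational.

(** * The Nullstellensatz for the torus *)

Lemma uncountable_real (R : realType) : ~ countable [set: R].
Proof.
move=> ct; have : countable (`[0, 1]%classic : set R) by apply: sub_countable ct; exact: subset_card_le.
move=> /countable_lebesgue_measure0; rewrite lebesgue_measure_itv /= lte_fin ltr01.
by rewrite oppr0 adde0 => /eqP; rewrite eqe oner_eq0.
Qed.

Lemma infinite_injection (T : pointedType) (A : set T) : infinite_set A ->
  exists f : nat -> T, injective f /\ forall i, A (f i).
Proof.
move=> /infiniteP/pcard_leP[f]; exists f; split=> [i j /inj|i].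
  by apply; rewrite inE.
by have := @funS _ _ _ _ f i I.
Qed.

(** Countably many finite classes cannot cover the uncountable set of reals. *)
Lemma pigeonhole_real (R : realType) (P : nat -> R -> Prop) : (forall r, exists d, P d r) ->
  exists d, exists f : nat -> R, injective f /\ forall i, P d (f i).
Proof.
move=> H; apply: contrapT => Hn; apply: (@uncountable_real R).
have -> : [set: R] = \bigcup_(d in [set: nat]) [set r | P d r].
  by apply/seteqP; split=> // r _; have [d Pd] := H r; exists d.
apply: bigcup_countable => // d _; apply: finite_set_countable.
apply: contrapT => /infinite_injection[f [fi fP]].
by apply: Hn; exists d, f.
Qed.

Lemma linear_dependence (K : fieldType) (N : nat) (A : 'M[K]_(N.+1, N)) :
  exists2 b : 'rV[K]_N.+1, b != 0 & b *m A = 0.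
Proof.
have : kermx A != 0.
  rewrite kermx_eq0 /row_free; apply/eqP => rA.
  by have := rank_leq_col A; rewrite rA ltnn.
move=> /rowV0Pn[b /sub_kermxP bA b0]; by exists b.
Qed.

Lemma sumrB_mem (I : eqType) (V : zmodType) (s : seq I) (F G : I -> V) :
  \sum_(i <- s | i \in s) (F i - G i) = \sum_(i <- s) F i - \sum_(i <- s) G i.
Proof. by rewrite sumrB -!big_seq. Qed.

Section Nullstellensatz.
Context {R : realType} {n : nat}.
Local Notation C := (Cplx R).
Variable L : zmodClosed 'rV[C]_n.
Implicit Types (f h x : torus L -> C^o) (I : set (torus L -> C^o)).

Record regular_ideal I : Prop := RegularIdeal {
  ideal_sub : forall f, I f -> regular_function f;
  ideal_lin : forall (a : C) f h, I f -> I h -> I (fun t => a * f t + h t : C^o);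
  ideal_mul : forall p f, regular_function p -> I f -> I (fun t => p t * f t : C^o);
  ideal_zero : I (fun _ => 0 : C^o) }.

Lemma eq_ideal I f h : I f -> f =1 h -> I h.
Proof. by move=> If /funext <-. Qed.

Lemma idealD I f h : regular_ideal I -> I f -> I h -> I (fun t => f t + h t : C^o).
Proof.
move=> II If Ih; apply: eq_ideal (ideal_lin II 1 If Ih) _ => t; by rewrite mul1r.
Qed.

Lemma idealB I f h : regular_ideal I -> I f -> I h -> I (fun t => f t - h t : C^o).
Proof.
move=> II If Ih; apply: eq_ideal (ideal_lin II (-1) Ih If) _ => t; by rewrite mulN1r addrC.
Qed.

Lemma ideal_sum I (J : Type) (r : seq J) (P : pred J) (F : J -> torus L -> C^o) : regular_ideal I ->
  (forall j, P j -> I (F j)) -> I (fun t => \sum_(j <- r | P j) F j t : C^o).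
Proof.
move=> II H; elim: r => [|j r IH].
  by apply: eq_ideal (ideal_zero II) _ => t; rewrite big_nil.
case Pj : (P j); last by apply: eq_ideal IH _ => t; rewrite big_cons Pj.
by apply: eq_ideal (idealD II (H j Pj) IH) _ => t; rewrite big_cons Pj.
Qed.

Definition ideal_add I (x : torus L -> C^o) : set (torus L -> C^o) :=
  [set f | exists f0 h, [/\ I f0, regular_function h & forall t, f t = f0 t + x t * h t]].

Lemma ideal_addP I x : regular_ideal I -> regular_function x ->
  [/\ regular_ideal (ideal_add I x), I `<=` ideal_add I x & ideal_add I x x].
Proof.
move=> II rx; split.
- split.
  + move=> f [f0 [h [If rh fE]]]; apply: eq_regular (regularD (ideal_sub II If) (regularM rx rh)) _ => t.
    by rewrite fE.
  + move=> a f f' [f0 [h [If rh fE]]] [f0' [h' [If' rh' fE']]].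
    exists (fun t => a * f0 t + f0' t), (fun t => a * h t + h' t); split.
    * exact: (ideal_lin II).
    * exact: regular_lin.
    * by move=> t; rewrite fE fE'; ring.
  + move=> p f rp [f0 [h [If rh fE]]].
    exists (fun t => p t * f0 t), (fun t => p t * h t); split.
    * exact: (ideal_mul II).
    * exact: regularM.
    * by move=> t; rewrite fE; ring.
  + exists (fun _ => 0), (fun _ => 0); split; [exact: (ideal_zero II) | exact: regular_cst |].
    by move=> t; rewrite mulr0 addr0.
- move=> f If; exists f, (fun _ => 0); split; [by [] | exact: regular_cst |].
  by move=> t; rewrite mulr0 addr0.
- exists (fun _ => 0), (fun _ => 1); split; [exact: (ideal_zero II) | exact: regular_cst |].
  by move=> t; rewrite mulr1 add0r.
Qed.

Variable B : 'M[C]_n.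
Hypothesis Bunit : B \in unitmx.
Hypothesis LB : forall v, v \in L <-> exists m : 'rV[int]_n, v = map_mx intr m *m B.

Let l (j : 'I_n) : 'cV[C]_n := col j (invmx B).

Lemma dual_basis j : dual_lattice L (l j).
Proof.
move=> v /LB[m ->]; exists (m 0 j).
by rewrite /pairing /l colE !mulmxA mulmxK // -colE !mxE.
Qed.

Lemma dual_lattice_coord (e : 'cV[C]_n) : dual_lattice L e ->
  exists m : 'I_n -> int, e = \sum_j (m j)%:~R *: l j.
Proof.
move=> Le.
have H j : exists m : int, pairing (row j B) e = m%:~R.
  apply: Le; apply/LB; exists (delta_mx 0 j).
  by rewrite rowE; congr (_ *m _); apply/matrixP => a b; rewrite !mxE; case: andP.
have [m mE] := choice H; exists m.
have -> : e = invmx B *m (B *m e) by rewrite mulmxA mulVmx // mul1mx.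
apply/matrixP => a b; rewrite ord1 !mxE summxE; apply: eq_bigr => j _.
have <- : pairing (row j B) e = (B *m e) j 0 by rewrite /pairing -row_mul mxE.
by rewrite mE [RHS]mxE /l mxE mulrC.
Qed.

(** Laurent polynomials in the basis characters with all exponents in $[-d, d]$. The shift by [d]
    indexes the spanning characters by a finite type, so this is a space of bounded dimension. *)
Definition level (d : nat) f := exists a : {ffun 'I_n -> 'I_d.*2.+1} -> C,
  forall t, f t = \sum_k a k * chr (\sum_j ((k j : nat)%:Z - d%:Z)%:~R *: l j) t.

Lemma dual_lattice_sum (m : 'I_n -> int) : dual_lattice L (\sum_j (m j)%:~R *: l j).
Proof.
apply: (big_ind (dual_lattice L)); [exact: dual_lattice0 | exact: dual_latticeD |].
by move=> j _; apply: dual_latticeMz; exact: dual_basis.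
Qed.

Lemma regular_level f : regular_function f -> exists d, level d f.
Proof.
move=> /regular_functionP[s Ls fE].
have H (p : C * 'cV[C]_n) : exists m : 'I_n -> int, p \in s -> p.2 = \sum_j (m j)%:~R *: l j.
  case ps : (p \in s); last by exists (fun _ => 0).
  by have [m mE] := dual_lattice_coord (Ls p ps); exists m.
have [m mE] := choice H.
pose d := \max_(p <- s) \max_j `|m p j|%N.
have dP p j : p \in s -> (`|m p j| <= d)%N.
  move=> ps; rewrite /d (big_rem p) //= leq_max; apply/orP; left.
  exact: (leq_bigmax (F := fun j => `|m p j|%N)).
exists d.
pose k p : {ffun 'I_n -> 'I_d.*2.+1} := [ffun j => inord (absz (m p j + d%:Z)%R)].
have kE p j : p \in s -> (k p j : nat)%:Z - d%:Z = m p j.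
  move=> ps; have := dP p j ps; rewrite ffunE => H1.
  have H2 : - d%:Z <= m p j <= d%:Z by rewrite -ler_norml -abszE lez_nat.
  have H3 : 0 <= m p j + d%:Z by rewrite -lerBlDr sub0r; case/andP: H2.
  rewrite inordK ?gez0_abs ?addrK // ltnS -lez_nat gez0_abs //.
  by rewrite -addnn PoszD lerD2r; case/andP: H2.
exists (fun k' => \sum_(p <- s | k p == k') p.1) => t.
rewrite -(topi_repr t) fE /expsum.
under [RHS]eq_bigr do rewrite mulr_suml.
rewrite (exchange_big_dep predT) //= big_seq [RHS]big_seq; apply: eq_bigr => p ps.
rewrite (big_pred1 (k p)) => [|k']; last by rewrite /= eq_sym.
congr (_ * _); rewrite chr_topi ?(mE p ps); last exact: dual_lattice_sum.
by congr (cexp (pairing _ _)); apply: eq_bigr => j _; rewrite kE.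
Qed.

(* If all [x - c] were invertible modulo [I], uncountably many inverses would have their coefficients in one
   finite-dimensional space, and a linear relation among them yields a polynomial in [x] that lies in [I]. *)
Lemma ideal_specialize I x : regular_ideal I -> ~ I (fun _ => 1) -> regular_function x ->
  exists c : C, ~ ideal_add I (fun t => x t - c : C^o) (fun _ => 1).
Proof.
move=> II I1 rx; apply: contrapT => Hn.
have inv (c : C) : exists h, regular_function h /\ I (fun t => 1 - (x t - c) * h t : C^o).
  have [f0 [h [If rh fE]]] : ideal_add I (fun t => x t - c : C^o) (fun _ => 1).
    by apply: contrapT => H; apply: Hn; exists c.
  by exists h; split => //; apply: eq_ideal If _ => t; rewrite (fE t) addrK.
have [q qP] := choice inv.
(* Real values of [c] suffice: infinitely many of their inverses have a common level [d]. *)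
have [d [r [ri rP]]] := @pigeonhole_real R (fun d y => level d (q (y%:C)%C))
  (fun y => regular_level (qP (y%:C)%C).1).
pose z i : C := (r i)%:C%C.
have zi : injective z by move=> i j [] /ri.
have [a aE] := choice rP.
pose N := #|{ffun 'I_n -> 'I_d.*2.+1}|.
have [b b0 bA] := linear_dependence (\matrix_(i < N.+1, k < N) a i (enum_val k)).
have bq t : \sum_i b 0 i * q (z i) t = 0.
  under eq_bigr do rewrite aE mulr_sumr.
  rewrite exchange_big big1 //= => k _.
  have /matrixP/(_ 0 (enum_rank k)) := bA; rewrite !mxE => H.
  under eq_bigr do rewrite mulrA.
  rewrite -mulr_suml (_ : \sum_i _ = 0) ?mul0r // -[RHS]H.
  by apply: eq_bigr => i _; rewrite !mxE enum_rankK.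
(* The relation $\sum_i b_i (x - z_i)^{-1} = 0$ with denominators cleared. At a node with $b_i \neq
   0$ a single summand survives, so [p] is nonzero. *)
pose p : {poly C} := \sum_(i < N.+1) b 0 i *: \prod_(j < N.+1 | j != i) ('X - (z j)%:P).
have p0 : p != 0.
  have [i bi] : exists i, b 0 i != 0 by apply/existsP; apply: contraNT b0 => /existsPn H;
    apply/eqP/matrixP => i' j'; rewrite ord1 mxE; apply/eqP; have := H j'; rewrite negbK.
  apply/eqP => /(congr1 (fun e : {poly C} => e.[z i])); rewrite horner0 /p horner_sum (bigD1 i) //=.
  rewrite [X in _ + X]big1 ?addr0 => [|j ji]; last first.
    by rewrite hornerZ horner_prod (bigD1 i) 1?eq_sym //= hornerXsubC subrr mul0r mulr0.
  rewrite hornerZ horner_prod => /eqP; rewrite mulf_eq0 (negbTE bi) /=.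
  apply/negP/prodf_neq0 => j ji; rewrite hornerXsubC subr_eq0.
  by apply: contraNneq ji => /zi/ord_inj ->.
have rpol (e : {poly C}) : regular_function (fun t => e.[x t] : C^o).
  elim/poly_ind: e => [|e c IH].
    by apply: eq_regular (regular_cst L 0) _ => t; rewrite horner0.
  apply: eq_regular (regularD (regularM IH rx) (regular_cst L c)) _ => t.
  by rewrite hornerMXaddC.
have Ip : I (fun t => p.[x t] : C^o).
  (* Each summand lies in [I]; the parts containing [q] add up to a multiple of the relation [bq],
     which leaves [p] evaluated at [x]. *)
  pose F i t : C^o := b 0 i * (\prod_(j < N.+1 | j != i) ('X - (z j)%:P)).[x t] * (1 - (x t - z i) * q (z i) t).
  have IF : I (fun t => \sum_(i < N.+1) F i t).
    apply: ideal_sum => // i _; apply: (ideal_mul II); last by have [] := qP (z i).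
    apply: regularZ; exact: rpol.
  apply: eq_ideal IF _ => t; rewrite /F /p horner_sum.
  pose M := \prod_(j < N.+1) (x t - z j).
  rewrite (eq_bigr (fun i : 'I_N.+1 => (b 0 i *: \prod_(j < N.+1 | j != i) ('X - (z j)%:P)).[x t] -
      M * (b 0 i * q (z i) t))); first by rewrite sumrB -mulr_sumr bq mulr0 subr0.
  move=> i _.
  rewrite hornerZ mulrBr mulr1; congr (_ - _).
  have -> : M = (x t - z i) * (\prod_(j < N.+1 | j != i) ('X - (z j)%:P)).[x t].
    rewrite /M (bigD1 i) //= horner_prod; congr (_ * _).
    by apply: eq_bigr => j _; rewrite hornerXsubC.
  by ring.
(* Products of linear factors in [x] are invertible modulo [I]. As [p] splits into such factors and
   lies in [I], this puts 1 in [I]. *)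
have invp (e : {poly C}) : (exists s : seq C, e = \prod_(y <- s) ('X - y%:P)) ->
    exists2 h, regular_function h & I (fun t => 1 - e.[x t] * h t : C^o).
  move=> [s ->]; elim: s => [|y s [h rh Ih]].
    exists (fun _ => 1); first exact: regular_cst.
    by apply: eq_ideal (ideal_zero II) _ => t; rewrite big_nil hornerC mulr1 subrr.
  have [rq Iq] := qP y; exists (fun t => q y t * h t); first exact: regularM.
  have rXy : regular_function (fun t => (x t - y) * q y t : C^o).
    by apply: regularM => //; apply: regularB => //; exact: regular_cst.
  apply: eq_ideal (idealD II Iq (ideal_mul II rXy Ih)) _ => t.
  by rewrite big_cons hornerM hornerXsubC; ring.
have [s sE] := closed_field_poly_normal p.
have lc0 : lead_coef p != 0 by rewrite lead_coef_eq0.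
have [h rh Ih] := invp _ (ex_intro _ s erefl).
apply: I1; have Ip' := ideal_mul II (regularZ (lead_coef p)^-1 rh) Ip.
apply: eq_ideal (idealD II Ih Ip') _ => t.
have -> : p.[x t] = lead_coef p * (\prod_(y <- s) ('X - y%:P)).[x t] by rewrite -hornerZ -sE.
move: (lead_coef p) lc0 (_.[x t]) (h t) => e e0 X Y.
by field.
Qed.

(** The basis characters are specialized one by one to constants without 1 entering the ideal. The
    constants are nonzero because characters are units, so they are the values at a point [g], and
    modulo the enlarged ideal every regular function is its value at [g]. *)
Theorem torus_nullstellensatz I : regular_ideal I -> ~ I (fun _ => 1) ->
  exists g, forall f, I f -> f g = 0.
Proof.
move=> II I1.
have [I' [II' sI I1' Ic]] : exists I', [/\ regular_ideal I', I `<=` I', ~ I' (fun _ => 1) &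
    forall j, j \in enum 'I_n -> exists c : C, I' (fun t => chr (l j) t - c : C^o)].
  elim: (enum 'I_n) => [|j s [I' [II' sI I1' Ic]]]; first by exists I; split.
  have rl := regular_chr (dual_basis j).
  have [c cP] := ideal_specialize II' I1' rl.
  have [II2 s2 x2] := ideal_addP II' (regularB rl (regular_cst L c)).
  exists (ideal_add I' (fun t => chr (l j) t - c)); split=> // [f /sI/s2 //|j'].
  by rewrite inE => /orP[/eqP ->|/Ic[c' /s2 H]]; [exists c | exists c'].
have {}Ic j : exists c : C, I' (fun t => chr (l j) t - c : C^o) by apply: Ic; rewrite mem_enum.
have [c cP] := choice Ic.
have c0 j : c j != 0.
  apply/eqP => c0; apply: I1'.
  have rm := regular_chr (dual_latticeN (dual_basis j)).
  apply: eq_ideal (ideal_mul II' rm (cP j)) _ => t.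
  rewrite c0 subr0 -(topi_repr t) !chr_topi; [|exact: dual_basis|exact: (dual_latticeN (dual_basis j))].
  by rewrite pairingNr cexpN mulVf // cexp_neq0.
have [z zE] := choice (fun j => cexp_surj (c0 j)).
(* The logarithms [z j] are the coordinates in the lattice basis of a point at which the basis
   characters take the values [c j]. *)
pose u : 'rV[C]_n := (\row_j z j) *m B; pose g := topi L u.
have gl j : chr (l j) g = c j.
  rewrite chr_topi; last exact: dual_basis.
  by rewrite /pairing /l /u colE !mulmxA mulmxK // -colE !mxE zE.
pose E f := I' (fun t => f t - f g : C^o).
have EM f h : regular_function f -> E f -> E h -> E (fun t => f t * h t).
  move=> rf Ef Eh; apply: eq_ideal (idealD II' (ideal_mul II' rf Eh) (ideal_mul II' (regular_cst L (h g)) Ef)) _ => t.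
  by ring.
have Echr e : dual_lattice L e -> E (chr e).
  move=> /dual_lattice_coord[m ->].
  have : dual_lattice L (\sum_j (m j)%:~R *: l j) /\ E (chr (\sum_j (m j)%:~R *: l j)).
    have chrD e1 e2 : dual_lattice L e1 -> dual_lattice L e2 -> E (chr e1) -> E (chr e2) -> E (chr (e1 + e2)).
      move=> L1 L2 E1 E2; apply: eq_ideal (EM _ _ (regular_chr L1) E1 E2) _ => t.
      rewrite -(topi_repr t) /g !chr_topi; try exact: dual_latticeD; try exact: L1; try exact: L2.
      by rewrite !pairingDr !cexpD.
    have chrN e1 : dual_lattice L e1 -> E (chr e1) -> E (chr (- e1)).
      move=> L1 E1; have L1' := dual_latticeN L1.
      apply: eq_ideal (ideal_mul II' (regularZ (- chr (- e1) g) (regular_chr L1')) E1) _ => t.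
      rewrite -(topi_repr t) /g !chr_topi; try exact: L1; try exact: L1'.
      rewrite !pairingNr !cexpN.
      have := cexp_neq0 (pairing (repr t) e1); have := cexp_neq0 (pairing u e1).
      move: (cexp (pairing (repr t) e1)) (cexp (pairing u e1)) => X Y Y0 X0; field.
      by rewrite X0 Y0.
    have E0 : E (chr 0).
      apply: eq_ideal (ideal_zero II') _ => t.
      rewrite -(topi_repr t) /g !chr_topi; try exact: dual_lattice0.
      by rewrite !pairing0r subrr.
    apply: (big_ind (fun e1 => dual_lattice L e1 /\ E (chr e1))).
    - by split; [exact: dual_lattice0 | ].
    - by move=> e1 e2 [L1 E1] [L2 E2]; split; [exact: dual_latticeD | exact: chrD].
    - move=> j _; split; first by apply: dual_latticeMz; exact: dual_basis.
      have El : E (chr (l j)) by rewrite /E gl.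
      have En k : dual_lattice L (k%:R *: l j) /\ E (chr (k%:R *: l j)).
        elim: k => [|k [IHL IHE]]; first by rewrite scale0r; exact: (conj (@dual_lattice0 _ _ L) E0).
        rewrite -natr1 scalerDl scale1r; split; first by apply: dual_latticeD => //; exact: dual_basis.
        by apply: chrD => //; exact: dual_basis.
      case: (m j) => k; first by have [] := En k.
      by rewrite NegzE mulrNz scaleNr; apply: chrN; have [] := En k.+1.
  by case.
have Ereg f : regular_function f -> E f.
  move=> /regular_functionP[s Ls fE].
  have Es : E (fun t => \sum_(p <- s) p.1 * chr p.2 t).
    have H p : p \in s -> E (fun t => p.1 * chr p.2 t).
      move=> /Ls/Echr Ep; apply: eq_ideal (ideal_mul II' (regular_cst L p.1) Ep) _ => t.
      by rewrite mulrBr.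
    have HI : I' (fun t => \sum_(p <- s | p \in s) (p.1 * chr p.2 t - p.1 * chr p.2 g) : C^o).
      by apply: (ideal_sum _ II') => p ps; exact: H ps.
    apply: eq_ideal HI _ => t.
    exact: (sumrB_mem s (fun p => p.1 * chr p.2 t) (fun p => p.1 * chr p.2 g)).
  have fs : f = (fun t => \sum_(p <- s) p.1 * chr p.2 t).
    have H v : expsum s v = \sum_(p <- s) p.1 * chr p.2 (topi L v).
      by apply: eq_big_seq => p /Ls Lp; rewrite (chr_topi v Lp).
    by apply/funext => t; rewrite -{1}(topi_repr t) fE H (topi_repr t).
  by rewrite fs.
exists g => f If; apply: contrapT => /eqP fg; apply: I1'.
have H := idealB II' (sI _ If) (Ereg f (ideal_sub II If)).
apply: eq_ideal (ideal_mul II' (regular_cst L (f g)^-1) H) _ => t.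
by rewrite opprB addrC subrK mulVf.
Qed.

End Nullstellensatz.

(** * Vanishing order, local coordinates and separation of points *)

Section VanishingOrder.
Context {R : realType} {n : nat}.
Local Notation C := (Cplx R).
Variable L : zmodClosed 'rV[C]_n.
Implicit Types (f h : torus L -> C^o) (u v : 'rV[C]_n).

Definition vanishes u f (m : nat) := forall v j, (j < m)%N -> taylor u f v j = 0.

Lemma vanishesMl u f h m : regular_function f -> regular_function h ->
  vanishes u f m -> vanishes u (fun x => f x * h x : C^o) m.
Proof.
move=> rf rh Vf v j jm; rewrite (taylorM u v j rf rh) big1 // => i _.
by rewrite Vf ?mul0r // (leq_ltn_trans _ jm) // -ltnS ltn_ord.
Qed.

Lemma vanishesMr u f h m : regular_function f -> regular_function h ->
  vanishes u h m -> vanishes u (fun x => f x * h x : C^o) m.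
Proof.
move=> rf rh Vh v j jm; rewrite (taylorM u v j rf rh) big1 // => i _.
by rewrite (Vh v (j - i)%N) ?mulr0 // (leq_ltn_trans (leq_subr _ _) jm).
Qed.

Lemma vanishesX u f m : regular_function f -> f (topi L u) = 0 ->
  vanishes u (fun x => f x ^+ m : C^o) m.
Proof.
move=> rf f0; elim: m => [|m IH] v j //; rewrite ltnS => jm.
have E : (fun x => f x ^+ m.+1 : C^o) =1 (fun x => f x * f x ^+ m) by move=> x; rewrite exprS.
rewrite (eq_taylor u v j E) (taylorM u v j rf (regularX m rf)) big1 // => i _.
have [->|i0] := posnP i; first by rewrite taylor0 f0 mul0r.
by rewrite (IH v (j - i)%N) ?mulr0 //; have := ltn_ord i; lia.
Qed.

Lemma taylorM_lead u f h v m k : regular_function f -> regular_function h ->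
  vanishes u f m -> vanishes u h k ->
  taylor u (fun x => f x * h x : C^o) v (m + k) = taylor u f v m * taylor u h v k.
Proof.
move=> rf rh Vf Vh; rewrite (taylorM u v (m + k)%N rf rh).
have mk : (m < (m + k).+1)%N by lia.
rewrite (bigD1 (Ordinal mk)) //= addKn big1 ?addr0 // => i im.
have [H|H] := ltnP i m; first by rewrite (Vf v _ H) mul0r.
have im' : (i : nat) != m by [].
by rewrite (Vh v (m + k - i)%N) ?mulr0 //; have := ltn_ord i; lia.
Qed.

Variable B : 'M[C]_n.
Hypothesis Bunit : B \in unitmx.
Hypothesis LB : forall v, v \in L <-> exists m : 'rV[int]_n, v = map_mx intr m *m B.

(** The normalized basis characters $e^{l_j}/e^{l_j}(u) - 1$ vanish at [u] with linear terms $l_j$,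
    and the $l_j$ span the dual space. *)
Lemma regular_coordinate u (x : 'cV[C]_n) : exists2 f : torus L -> C^o, regular_function f &
  vanishes u f 1 /\ forall v, taylor u f v 1 = pairing v x.
Proof.
pose l j : 'cV[C]_n := col j (invmx B).
have Ll j : dual_lattice L (l j) := dual_basis Bunit LB j.
pose y := B *m x.
have xE : x = \sum_j y j 0 *: l j.
  have -> : x = invmx B *m y by rewrite /y mulmxA mulVmx // mul1mx.
  apply/matrixP => a b; rewrite ord1 !mxE summxE; apply: eq_bigr => j _.
  by rewrite !mxE mulrC.
pose F j (t : torus L) : C^o := y j 0 * (cexp (pairing u (l j)))^-1 * (chr (l j) t - cexp (pairing u (l j))).
have rc j := regular_cst L (cexp (pairing u (l j))).
have rB j := regularB (regular_chr (Ll j)) (rc j).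
have rF j : regular_function (F j) by exact: regularZ.
have rS : regular_function (fun t => \sum_j F j t : C^o) by apply: regular_sum => j _; exact: rF.
have TF j v d : taylor u (F j) v d = (d != 0%N)%:R * (y j 0 * (pairing v (l j) ^+ d / d`!%:R)).
  rewrite (taylorZ _ u v d (rB j)) (taylorB u v d (regular_chr (Ll j)) (rc j)) taylor_cst.
  rewrite (taylor_chr u v d (Ll j)).
  have := cexp_neq0 (pairing u (l j)); move: (cexp _) (pairing v _) => X p X0.
  case: d => [|d]; rewrite /= ?mulr1n ?mulr0n ?mul0r ?mul1r.
    by rewrite divr1 subrr mulr0.
  by rewrite subr0 mulrA mulfVK.
exists (fun t => \sum_j F j t); first exact: rS.
split=> [v [|//] _|v]; rewrite (taylor_sum _ u v _ (fun j _ => rF j)).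
  by apply: big1 => j _; rewrite TF mul0r.
rewrite [in RHS]xE /pairing mulmx_sumr summxE; apply: eq_bigr => j _.
by rewrite -[RHS]/(pairing v _) pairingZr TF mul1r divr1 expr1.
Qed.

(** If all basis characters agree at both points, the coordinates of $(u - u')/2\pi i$ in the
    lattice basis are integers. *)
Lemma separating_character u u' : topi L u <> topi L u' ->
  exists2 l, dual_lattice L l & cexp (pairing u l) != cexp (pairing u' l).
Proof.
move=> uu'; apply: contrapT => H; apply: uu'; apply/topi_eq.
pose l j : 'cV[C]_n := col j (invmx B).
have P j : exists m : int, pairing (twopii^-1 *: (u - u')) (l j) = m%:~R.
  have E : cexp (pairing (u - u') (l j)) = 1.
    have : cexp (pairing u (l j)) = cexp (pairing u' (l j)).
      apply/eqP; apply: contrapT => /negP N; apply: H; exists (l j) => //.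
      exact: dual_basis.
    by rewrite pairingBl cexpD cexpN => ->; rewrite divff // cexp_neq0.
  have [m mE] := cexp_eq1P _ (introT eqP E); exists m.
  by rewrite pairingZl mE mulKf // twopii_neq0.
have [m mE] := choice P.
apply/LB; exists (\row_j m j).
rewrite -[LHS](mulmxKV Bunit); congr (_ *m _); apply/matrixP => a j; rewrite ord1.
rewrite [RHS]mxE [in RHS]mxE -mE /pairing /l colE mulmxA -colE [RHS]mxE.
by [].
Qed.

End VanishingOrder.

Section MevLinear.
Context {R : realType} {n : nat}.
Local Notation C := (Cplx R).
Implicit Types (p q : mpoly.mpoly n C) (a v : 'rV[C]_n).

Lemma mev_lin (b : C) p q v : mev (b *: p + q) v = b * mev p v + mev q v.
Proof. by rewrite /mev mpoly.mevalD mpoly.mevalZ. Qed.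

Lemma directional_derivative_mev_lin (b : C) p q a v : directional_derivative a (mev (b *: p + q)) v =
  b * directional_derivative a (mev p) v + directional_derivative a (mev q) v.
Proof.
rewrite !directional_derivative_mev mulr_sumr -big_split; apply: eq_bigr => i _.
have -> : mev (mpoly.mderiv i (b *: p + q)) v = b * mev (mpoly.mderiv i p) v + mev (mpoly.mderiv i q) v.
  by rewrite -mev_lin mpoly.mderivD mpoly.mderivZ.
by rewrite mulrDr mulrCA.
Qed.

End MevLinear.

(** * Zeros of a Dunkl-stable ideal and its leading forms *)

Section DunklIdeal.
Context {R : realType} {gT : finGroupType} {W : {group gT}} {n : nat}.
Local Notation C := (Cplx R).
Variable rW : mx_representation C W n.
Variable L : zmodClosed 'rV[C]_n.
Variables (alpha : gT -> 'cV[C]_n) (alphav : gT -> 'rV[C]_n).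
Variables (chi : set (torus L) -> torus L -> C) (c : set (torus L) -> C).
Hypothesis Linv : invariant_lattice rW L.
Hypothesis RD : root_data rW L alpha alphav.
Hypothesis HE : hypertorus_equations rW chi.
Local Notation HregL := (@Hreg R gT W n rW L).
Implicit Types (u v a b : 'rV[C]_n) (s w : gT) (f h : torus L -> C^o).

Variable I : set (torus L -> C^o).
Hypothesis II : regular_ideal I.
Hypothesis IW : forall w f, w \in W -> I f -> I (fun x => f (torus_act rW w x) : C^o).
Hypothesis ID : forall a f (G : torus L -> C^o), I f -> regular_function G ->
  trig_dunkl_operator rW chi c a (f \_ HregL) = G \_ HregL -> I G.

Definition ideal_zero_at (x : torus L) := forall f, I f -> f x = 0.

(* The Dunkl operator along [b] has no pole along [b] and lowers the degree of the Taylor coefficients in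
   the direction [b], which therefore vanish by induction. *)
Lemma ideal_zero_along u b : ideal_zero_at (topi L u) ->
  (forall s, reflection rW s -> s \in stabilizer rW (topi L u) -> pairing b (alpha s) = 0) ->
  ideal_zero_at (topi L (u + b)).
Proof.
move=> Zu Hb f If; apply: taylor_eq0_along; first exact: (ideal_sub II If).
(* The induction runs over all functions of the ideal at once, because it is applied to the image
   [G] of [f] and to the reflected functions. *)
suff H d : forall k, (k <= d)%N -> forall f, I f -> taylor u f b k = 0.
  by move=> d; exact: (H d d).
elim: d => [|d IH] k kd {}f {}If.
  by move: kd; rewrite leqn0 => /eqP ->; rewrite taylor0; exact: Zu.
move: kd; rewrite leq_eqVlt => /orP[/eqP ->|kd]; last exact: IH.
have rf := ideal_sub II If.
have [G rG [GE GT]] := trig_dunkl_taylor c Linv RD HE b rf.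
have IG := ID If rG GE.
have [rho /(_ b d)] := GT u.
rewrite (IH d _ G IG) // (directional_derivative_homo u b d rf) => H.
have {}H := H (fun s rs Gs => or_intror (Hb s rs Gs)).
move: H; rewrite big1 => [|s /andP[Gs rs]]; last by rewrite (Hb s rs Gs) mul0r mulr0 mul0r.
rewrite big1 => [|s rs]; last first.
  have Ws := reflection_in rs.
  apply: big1 => j _; rewrite -(taylor_act Linv f u b (d - j) Ws).
  rewrite (IH (d - j)%N (leq_subr _ _) _ (IW Ws If)) (IH (d - j)%N (leq_subr _ _) _ If).
  by rewrite subrr mulr0.
by rewrite !addr0 => /esym/eqP; rewrite mulf_eq0 pnatr_eq0 /= => /eqP.
Qed.

Lemma ideal_zero_spanning : weyl_group_repr rW -> (exists x, ideal_zero_at x) ->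
  exists2 x, ideal_zero_at x & forall b,
    (forall s, reflection rW s -> s \in stabilizer rW x -> pairing b (alpha s) = 0) -> b = 0.
Proof.
move=> WG [x0 Z0].
have [Rs RsE] : exists Rs : torus L -> {set gT},
    forall x s, (s \in Rs x) = (s \in stabilizer rW x) && reflection rW s.
  by exists (fun x => finset (fun s => (s \in stabilizer rW x) && reflection rW s)) => x s; rewrite finset.in_set.
(* Induction on the number of group elements that are not reflections stabilizing the zero. At 0
   every reflection stabilizes it, and all the roots together span. *)
suff H m : forall x, (#|gT| - #|Rs x| <= m)%N -> ideal_zero_at x ->
   exists2 x, ideal_zero_at x & forall b,
    (forall s, reflection rW s -> s \in stabilizer rW x -> pairing b (alpha s) = 0) -> b = 0.
  exact: (H _ x0 (leqnn _) Z0).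
elim: m => [|m IH] x; rewrite -(topi_repr x); set u := repr x => xm Zx.
  exists (topi L u) => // b Hb; apply: (roots_separate RD WG) => s rs; apply: Hb => //.
  have : Rs (topi L u) = finset.setTfor gT.
    by apply/eqP; rewrite eqEcard finset.subsetT finset.cardsT /= -subn_eq0 -leqn0.
  by move/setP => /(_ s); rewrite RsE finset.in_setT => /andP[].
have [Hx|Hx] := pselect (forall b,
    (forall s, reflection rW s -> s \in stabilizer rW (topi L u) -> pairing b (alpha s) = 0) -> b = 0).
  by exists (topi L u).
have [b [Hb b0]] : exists b, (forall s, reflection rW s -> s \in stabilizer rW (topi L u) ->
    pairing b (alpha s) = 0) /\ b <> 0.
  by apply: contrapT => H; apply: Hx => b Hb; apply: contrapT => b0; apply: H; exists b.
have [s' [rs' bs']] : exists s', reflection rW s' /\ pairing b (alpha s') != 0.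
  apply: contrapT => H; apply: b0; apply: (roots_separate RD WG) => s rs.
  by apply/eqP; apply: contrapT => /negP bs; apply: H; exists s.
(* At this parameter the root of [s'] vanishes, so [s'] joins the stabilizer; the reflections
   already there remain because their roots kill [b]. *)
pose t := - pairing u (alpha s') / pairing b (alpha s').
have Zt : ideal_zero_at (topi L (u + t *: b)).
  by apply: ideal_zero_along => // s rs Gs; rewrite pairingZl Hb // mulr0.
apply: (IH (topi L (u + t *: b))) => //.
have st : s' \in stabilizer rW (topi L (u + t *: b)).
  rewrite (stabilizer_reflection Linv RD) // pairingDl pairingZl /t divfK // addrN cexp0.
  exact: eqxx.
have sub : Rs (topi L u) \proper Rs (topi L (u + t *: b)).
  apply/properP; split.
    apply/fintype.subsetP => s Rs_s; have /andP[Gs rs] := etrans (esym (RsE _ _)) Rs_s.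
    apply: (etrans (RsE _ _)); rewrite rs andbT.
    rewrite (stabilizer_reflection Linv RD) // pairingDl pairingZl (Hb s rs Gs) mulr0 addr0.
    by rewrite -(stabilizer_reflection Linv RD).
  exists s'; first by rewrite (RsE (topi L (u + t *: b))) st.
  apply/negP => Rs'; move/negP: bs'; apply; apply/eqP; apply: (Hb s' rs').
  by have /andP[] := etrans (esym (RsE _ _)) Rs'.
have := proper_card sub; have := max_card (mem (Rs (topi L (u + t *: b)))).
lia.
Qed.

Variable u : 'rV[C]_n.
Local Notation Gamma := (stabilizer rW (topi L u)).
Local Notation kappa := (local_parameter rW c (topi L u)).
Local Notation hregG := (hreg rW Gamma alpha).

Variable B : 'M[C]_n.
Hypothesis Bunit : B \in unitmx.
Hypothesis LB : forall v, v \in L <-> exists m : 'rV[int]_n, v = map_mx intr m *m B.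

(** For each [w] outside the stabilizer a character separates [u] from its image. Shifted to vanish
    at the image, scaled to be 1 at [u] and raised to the power [d], it gives one factor. *)
Lemma orbit_cutoff d : exists P : torus L -> C^o, [/\ regular_function P, P (topi L u) = 1 &
  forall w, w \in W -> w \notin Gamma -> vanishes (u *m rW w) P d].
Proof.
have H w : exists l, w \in W -> w \notin Gamma ->
    dual_lattice L l /\ cexp (pairing u l) != cexp (pairing (u *m rW w) l).
  case Ww : (w \in W); last by exists 0.
  case Gw : (w \in Gamma); first by exists 0.
  have /(separating_character Bunit LB)[l Ll lw] : topi L u <> topi L (u *m rW w).
    move=> E; move/negP: Gw; apply; rewrite inE Ww /= (torus_act_topi Linv) //.
    by apply/eqP.
  by exists l.
have [l lP] := choice H.
pose X w := cexp (pairing (u *m rW w) (l w)).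
pose F w (t : torus L) : C^o := (cexp (pairing u (l w)) - X w)^-1 * (chr (l w) t - X w).
pose Q := [pred w | (w \in W) && (w \notin Gamma)].
have rF w : Q w -> regular_function (F w).
  move=> /andP[Ww Gw]; apply: regularZ; apply: regularB; last exact: regular_cst.
  by apply: regular_chr; have [] := lP w Ww Gw.
have rFX w : Q w -> regular_function (fun t => F w t ^+ d : C^o).
  by move=> Qw; apply: regularX; exact: rF.
exists (fun t => \prod_(w | Q w) (F w t ^+ d)); split.
- by apply: regular_prod => w; exact: rFX.
- apply: big1 => w /andP[Ww Gw]; have [Ll lw] := lP w Ww Gw.
  by rewrite /F (chr_topi u Ll) mulVf ?expr1n // subr_eq0.
- move=> w Ww Gw; have Qw : Q w by rewrite /= Ww Gw.
  have rR : regular_function (fun t => \prod_(w' | Q w' && (w' != w)) (F w' t ^+ d) : C^o).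
    by apply: regular_prod => w' /andP[Qw' _]; exact: rFX.
  have [Ll lw] := lP w Ww Gw.
  have F0 : F w (topi L (u *m rW w)) = 0 by rewrite /F (chr_topi _ Ll) subrr mulr0.
  have V := vanishesMl (rFX w Qw) rR (vanishesX (m := d) (rF w Qw) F0).
  move=> v j jd; rewrite -(V v j jd); apply: eq_taylor => t.
  by rewrite (bigD1 w).
Qed.

(** Vanishing to order at least [d] is enough, so [q] may be 0 and operators that kill a leading
    form need no separate treatment. *)
Definition leading_form d (q : 'rV[C]_n -> C^o) :=
  exists F, [/\ I F, vanishes u F d & forall v, q v = taylor u F v d].

(** The linear span of the leading forms, as the intersection of all subspaces containing their
    restrictions to [hreg]. *)
Definition leading_span : set ('rV[C]_n -> C^o) := [set f | forall N : set ('rV[C]_n -> C^o), N 0 ->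
  (forall (a : C) p q, N p -> N q -> N (a *: p + q)) ->
  (forall d q, leading_form d q -> N (q \_ hregG)) -> N f].

Lemma polynomial_leading_form d q : leading_form d q -> polynomial_function q.
Proof.
move=> [F [IF _ qE]]; apply: eq_polynomial (polynomial_taylor u d (ideal_sub II IF)) _ => v.
by rewrite qE.
Qed.

Lemma leading_form_linear_form d q x : leading_form d q ->
  leading_form d.+1 (fun v => pairing v x * q v).
Proof.
move=> [F [IF VF qE]]; have rF := ideal_sub II IF.
have [p rp [Vp pE]] := regular_coordinate Bunit LB u x.
exists (fun t => p t * F t); split; first exact: (ideal_mul II).
  move=> v j; rewrite ltnS => jd; rewrite (taylorM u v j rp rF) big1 // => i _.
  have [i0|i0] := posnP i; first by rewrite (Vp v i) ?mul0r // i0.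
  by rewrite (VF v (j - i)%N) ?mulr0 //; have := ltn_ord i; lia.
by move=> v; rewrite -add1n (taylorM_lead v rp rF Vp VF) pE qE.
Qed.

Lemma leading_form_act d q w : w \in Gamma -> leading_form d q ->
  leading_form d (fun v => q (v *m rW w)).
Proof.
rewrite inE => /andP[Ww /eqP Gw] [F [IF VF qE]].
have E : topi L (u *m rW w) = topi L u by rewrite -(torus_act_topi Linv u Ww).
exists (fun t => F (torus_act rW w t)); split; first exact: IW.
  by move=> v j jd; rewrite (taylor_act Linv) // (taylor_translate F _ j E) VF.
by move=> v; rewrite (taylor_act Linv) // (taylor_translate F _ d E) qE.
Qed.

Lemma leading_form0 q v : ideal_zero_at (topi L u) -> leading_form 0 q -> q v = 0.
Proof. by move=> Z [F [IF _ qE]]; rewrite qE taylor0 Z. Qed.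

(** Multiplying by the cutoff does not change the leading form, and afterwards the function vanishes
    to order [d.+1] at the image of [u] under every reflection. In the expansion of the
    trigonometric operator all correction terms of degree at most [d] then vanish. *)
Lemma leading_form_dunkl a d q : leading_form d.+1 q ->
  exists2 q', leading_form d q' & forall v, hregG v ->
    q' v = directional_derivative a q v + \sum_(s in Gamma | reflection rW s)
      kappa s * (pairing a (alpha s) / pairing v (alpha s)) * (q (v *m rW s) - q v).
Proof.
move=> [F0 [IF0 VF0 qE0]].
have [P [rP P1 VP]] := orbit_cutoff d.+1.
have rF0 := ideal_sub II IF0.
pose F t : C^o := P t * F0 t.
have IF : I F := ideal_mul II rP IF0.
have rF := ideal_sub II IF.
have VF : vanishes u F d.+1 := vanishesMr rP rF0 VF0.
have qE v : q v = taylor u F v d.+1.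
  have V0 : vanishes u P 0 by [].
  by rewrite -[d.+1]add0n (taylorM_lead v rP rF0 V0 VF0) taylor0 P1 mul1r qE0.
have VFs s v : reflection rW s -> forall j, (j < d.+1)%N -> taylor (u *m rW s) F (v *m rW s) j = 0.
  move=> rs j jd; have Ws := reflection_in rs.
  have [Gs|Gs] := boolP (s \in Gamma).
    have E : topi L (u *m rW s) = topi L u.
      by move: Gs; rewrite inE Ws /= (torus_act_topi Linv) // => /eqP.
    by rewrite (taylor_translate F _ j E) VF.
  exact: (vanishesMl rP rF0 (VP s Ws Gs)).
have [G rG [GE GT]] := trig_dunkl_taylor c Linv RD HE a rF.
have IG := ID IF rG GE.
have [rho Grho] := GT u.
have GE' v e : hregG v -> (e <= d)%N -> taylor u G v e =
    directional_derivative a (fun v => taylor u F v e.+1 : C^o) v + \sum_(s in Gamma | reflection rW s)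
      kappa s * (pairing a (alpha s) / pairing v (alpha s)) * (taylor u F (v *m rW s) e.+1 - taylor u F v e.+1).
  move=> Hv ed; rewrite (Grho v e) => [|s rs Gs]; last by left; exact: Hv.
  rewrite [X in _ + _ + X]big1 ?addr0 // => s rs; apply: big1 => j _.
  have jd : (e - j < d.+1)%N by lia.
  by rewrite VFs // (VF v _ jd) subrr mulr0.
exists (fun v => taylor u G v d).
  exists G; split => // v j jd.
  (* The expansion is available only off the walls; the coefficient is polynomial, so its vanishing
     there is enough. *)
  have pj := polynomial_taylor u j rG.
  apply: (polynomial_eq0_hreg (Gamma := Gamma) RD pj) => {}v Hv.
  rewrite (GE' v j Hv (ltnW jd)) big1 => [|s _].
    rewrite addr0 /directional_derivative.
    have -> : (fun t : C => taylor u F (v + t *: a) j.+1 : C^o) = (fun _ => 0).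
      by apply/funext => t; apply: VF.
    exact: derive1_cst.
  by rewrite !VF // subrr mulr0.
move=> v Hv; rewrite (GE' v d Hv (leqnn d)).
have -> : q = (fun v : 'rV[C]_n => taylor u F v d.+1 : C^o) by apply/funext.
by [].
Qed.

Lemma leading_span_lead d q : leading_form d q -> leading_span (q \_ hregG).
Proof. by move=> Lq N N0 Nl Nq; exact: Nq Lq. Qed.

Lemma leading_span0 : leading_span 0.
Proof. by []. Qed.

Lemma leading_span_lin (a : C) p q : leading_span p -> leading_span q -> leading_span (a *: p + q).
Proof. by move=> Sp Sq N N0 Nl Nq; apply: (Nl); [exact: Sp | exact: Sq]. Qed.

(** Dunkl operators involve a derivative, so linearity of [X] is asked only on polynomial functions;
    the span argument therefore carries a polynomial representative along. *)
Lemma leading_span_closed (X : ('rV[C]_n -> C^o) -> 'rV[C]_n -> C^o) :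
  (forall (a : C) p q, polynomial_function p -> polynomial_function q ->
     X ((fun v => a * p v + q v : C^o) \_ hregG) = a *: X (p \_ hregG) + X (q \_ hregG)) ->
  (forall d q, leading_form d q -> leading_span (X (q \_ hregG))) ->
  forall p, leading_span p -> leading_span (X p).
Proof.
move=> Xlin Xlead f Sf.
pose N : set ('rV[C]_n -> C^o) := [set h | exists2 p, polynomial_function p &
  h = p \_ hregG /\ leading_span (X (p \_ hregG))].
have [p _ [-> //]] : N f.
apply: Sf.
- have p0 := @polynomial_cst R n 0.
  exists (fun _ => 0) => //; split; first exact/esym/restrict0.
  (* Linearity with coefficient $-1$ and both arguments 0 shows that [X] sends 0 to 0. *)
  have := Xlin (-1) _ _ p0 p0; rewrite scaleN1r addNr => E.
  have -> : (fun _ : 'rV[C]_n => 0 : C^o) \_ hregG = (fun _ => -1 * 0 + 0 : C^o) \_ hregG.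
    by apply: eq_restrict => v _; rewrite mulr0 addr0.
  by rewrite E; exact: leading_span0.
- move=> a _ _ [p pp [-> Sp]] [q pq [-> Sq]].
  exists (fun v => a * p v + q v); first exact: polynomialD (polynomialZ a pp) pq.
  split; last by rewrite Xlin //; exact: leading_span_lin.
  exact/esym/restrict_lin.
- move=> d q Lq; exists q; first exact: polynomial_leading_form Lq.
  by split => //; exact: Xlead Lq.
Qed.

Lemma leading_span_submodule : ideal_zero_at (topi L u) ->
  submodule (generated_algebra (cherednik_generator rW Gamma alpha kappa)) leading_span.
Proof.
move=> Z; apply: submodule_generated; [exact: leading_span0 | exact: leading_span_lin |].
have GW := stabilizer_sub rW (topi L u).
have Ggrp := stabilizer_group Linv (topi L u).
have DR := dunkl_restrict RD kappa GW Ggrp.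
move=> X f; case=> [x|w Gw|a].
- refine (leading_span_closed (X := fun q v => pairing v x * q v : C^o) _ _ (p := f)).
  + move=> a p q _ _; apply/funext => v.
    rewrite -[RHS]/(a * (pairing v x * (p \_ hregG) v) + pairing v x * (q \_ hregG) v).
    have [Hv|Hv] := pselect (hregG v); first by rewrite !restrict_in //; ring.
    by rewrite !restrict_out // !mulr0 addr0.
  + move=> d q /(leading_form_linear_form x)/leading_span_lead; congr (leading_span _).
    apply/funext => v; have [Hv|Hv] := pselect (hregG v); first by rewrite !restrict_in.
    by rewrite !restrict_out // mulr0.
- refine (leading_span_closed (X := fun q v => q (v *m rW w) : C^o) _ _ (p := f)).
  + move=> a p q _ _; apply/funext => v.
    rewrite -[RHS]/(a * (p \_ hregG) (v *m rW w) + (q \_ hregG) (v *m rW w)).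
    have [Hv|Hv] := pselect (hregG (v *m rW w)); first by rewrite !restrict_in.
    by rewrite !restrict_out // mulr0 addr0.
  + move=> d q /(leading_form_act Gw)/leading_span_lead Sq.
    have -> : (fun v : 'rV[C]_n => (q \_ hregG) (v *m rW w)) = (fun v => q (v *m rW w)) \_ hregG; last exact: Sq.
    apply/funext => v; have [Hv|Hv] := pselect (hregG v).
      by rewrite (restrict_in _ Hv) (restrict_in q (hreg_act RD GW Ggrp Gw Hv)).
    have Hw : ~ hregG (v *m rW w) by move=> Hw; apply: Hv; exact: (hreg_actV RD GW Ggrp Gw Hw).
    by rewrite (restrict_out _ Hv) (restrict_out q Hw).
- refine (leading_span_closed (X := dunkl_operator rW Gamma alpha kappa a) _ _ (p := f)).
  + move=> b p q [P pE] [Q qE].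
    have {pE}-> : p = mev P by apply/funext.
    have {qE}-> : q = mev Q by apply/funext.
    have E : (fun v : 'rV[C]_n => b * mev P v + mev Q v : C^o) = mev (b *: P + Q).
      by apply/funext => v; rewrite mev_lin.
    rewrite E !DR; apply: etrans (restrict_lin _ _ _ _); apply: eq_restrict => v _.
    rewrite directional_derivative_mev_lin mulrDr addrACA; apply: (congr2 +%R); first by [].
    rewrite mulr_sumr -big_split; apply: eq_bigr => s _.
    rewrite !mev_lin; move: (kappa s * _) (mev P v) (mev Q v) (mev P _) (mev Q _) => k1 k2 k3 k4 k5.
    by rewrite /=; ring.
  (* In degree 0 there is nothing to lower: the leading form is the value at a zero of the ideal,
     hence 0. *)
  + move=> [|d] q Lq; rewrite DR.
      have q0 : q = (fun _ => 0) by apply/funext => v; exact: (leading_form0 v Z Lq).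
      have S0 : leading_span ((fun _ => 0 : C^o) \_ hregG) by have := leading_span_lead Lq; rewrite q0.
      apply: mem_eq_restrict S0 => v _; rewrite q0 big1 => [|s _]; last by rewrite subrr mulr0.
      by rewrite addr0 /directional_derivative; apply/esym/derive1_cst.
    have [q' Lq' q'E] := leading_form_dunkl a Lq.
    apply: mem_eq_restrict (leading_span_lead Lq') => v Hv; exact: q'E.
Qed.

(** The span is nonzero because a nonzero regular function has a first nonvanishing Taylor term at
    [u]. It is proper because every leading form vanishes at the origin: by homogeneity in positive
    degree, and because [u] gives a zero in degree 0. *)
Lemma Red_of_ideal_zero : ideal_zero_at (topi L u) -> (exists2 f, I f & f <> 0) ->
  Red_at rW alpha (topi L u) c.
Proof.
move=> Z [f If f0]; have rf := ideal_sub II If.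
exists leading_span; split; first exact: leading_span_submodule.
- move=> p; apply.
  + exists (fun _ => 0); first exact: polynomial_cst.
    exact: restrict0.
  + move=> a _ _ [p1 pp1 <-] [p2 pp2 <-].
    exists (fun v => a * p1 v + p2 v); first exact: polynomialD (polynomialZ a pp1) pp2.
    exact: restrict_lin.
  + by move=> d q /polynomial_leading_form pq; exists q.
- have [d [v tv Vd]] : exists d, exists2 v, taylor u f v d != 0 & vanishes u f d.
    have ex : exists d, `[< exists v, taylor u f v d != 0 >].
      apply: contrapT => H; apply: f0; apply/funext; apply: (taylor_eq0 rf (u := u)) => v d.
      apply/eqP; apply: contrapT => /negP N; apply: H; exists d; apply/asboolP; by exists v.
    case: (ex_minnP ex) => d /asboolP[v tv] dmin; exists d; exists v => // v' j jd.
    apply/eqP; apply: contrapT => /negP N; have := dmin j; rewrite leqNgt jd => H.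
    by apply/notF/H/asboolP; exists v'.
  have L1 : leading_form d (fun v => taylor u f v d) by exists f.
  move=> E; have := leading_span_lead L1; rewrite E /= => q0.
  move/negP: tv; apply; apply/eqP.
  apply: (polynomial_eq0_hreg (Gamma := Gamma) RD (polynomial_leading_form L1)) => w Hw.
  by have := congr1 (fun p => p w) q0; rewrite /= restrict_in.
- move=> E; have : [set p \_ hregG | p in polynomial_function] ((fun _ => 1 : C^o) \_ hregG).
    by exists (fun _ => 1) => //; exact: polynomial_cst.
  rewrite -E => S1.
  pose N : set ('rV[C]_n -> C^o) := [set h | exists2 p, polynomial_function p & p 0 = 0 /\ h = p \_ hregG].
  have [p pp [p0 pE]] : N ((fun _ => 1 : C^o) \_ hregG).
    apply: S1.
    + exists (fun _ => 0); first exact: polynomial_cst.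
      by split=> //; exact/esym/restrict0.
    + move=> a _ _ [p1 pp1 [p10 ->]] [p2 pp2 [p20 ->]].
      exists (fun v => a * p1 v + p2 v); first exact: polynomialD (polynomialZ a pp1) pp2.
      split; first by rewrite p10 p20 mulr0 addr0.
      exact/esym/restrict_lin.
    + move=> d q Lq; exists q; first exact: polynomial_leading_form Lq.
      split => //; move: Lq => [F [IF VF qE]]; rewrite qE.
      case: (d) => [|d']; first by rewrite taylor0 Z.
      by rewrite -[0](scale0r (0 : 'rV[C]_n)) (taylor_homo u 0 0 d'.+1 (ideal_sub II IF)) expr0n mul0r.
  have p1 : polynomial_function (fun v => 1 + -1 * p v : C^o).
    by apply: polynomialD; [exact: polynomial_cst | exact: polynomialZ].
  have H : (forall v, hregG v -> 1 + -1 * p v = 0) -> (1 : C) = 0.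
    by move=> /(polynomial_eq0_hreg RD p1)/(_ 0); rewrite p0 mulr0 addr0.
  have /eqP : (1 : C) = 0.
    apply: H => v Hv; have := congr1 (fun q => q v) pE; rewrite /= !restrict_in // => <-.
    by rewrite mulN1r subrr.
  by rewrite oner_eq0.
Qed.

End DunklIdeal.

Section RedFromReducible.
Context {R : realType} {gT : finGroupType} {W : {group gT}} {n : nat}.
Local Notation C := (Cplx R).
Variable rW : mx_representation C W n.
Variable L : zmodClosed 'rV[C]_n.
Variables (alpha : gT -> 'cV[C]_n) (alphav : gT -> 'rV[C]_n).
Variables (chi : set (torus L) -> torus L -> C) (c : set (torus L) -> C).
Hypothesis WG : weyl_group_repr rW.
Hypothesis Llat : is_lattice L.
Hypothesis Linv : invariant_lattice rW L.
Hypothesis RD : root_data rW L alpha alphav.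
Hypothesis HE : hypertorus_equations rW chi.
Local Notation HregL := (@Hreg R gT W n rW L).

(** The spanning condition on the stabilizer is recorded as well, since it is what places [g] in
    [Sigma]. *)
Theorem Red_of_reducible :
  reducible_module (daha rW chi c) (polynomial_representation rW L) ->
  exists2 g : torus L, Red_at rW alpha g c &
    forall b, (forall s, reflection rW s -> s \in stabilizer rW g -> pairing b (alpha s) = 0) -> b = 0.
Proof.
move=> [N [[N0 Nlin NX] NM Nn0 NnM]]; have [B Bunit LB] := Llat.
pose I : set (torus L -> C^o) := [set f | regular_function f /\ N (f \_ HregL)].
have II : regular_ideal I.
  split.
  - by move=> f [].
  - move=> a f h [rf Nf] [rh Nh]; split; first exact: regular_lin.
    have := Nlin a _ _ Nf Nh; congr (N _); exact/esym/restrict_lin.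
  - move=> p f rp [rf Nf]; split; first exact: regularM.
    have := NX _ _ (gen_algebra_gen (daha_regular rW chi c rp)) Nf; congr (N _).
    apply/funext => x; have [Hx|Hx] := pselect (HregL x); first by rewrite !restrict_in.
    by rewrite !restrict_out // mulr0.
  - split; first exact: regular_cst.
    move: N0; congr (N _); exact/esym/restrict0.
have IW w (f : torus L -> C^o) : w \in W -> I f -> I (fun x => f (torus_act rW w x) : C^o).
  move=> Ww [rf Nf]; split; first exact: (regular_act Linv).
  have := NX _ _ (gen_algebra_gen (daha_group rW chi c Ww)) Nf; congr (N _).
  apply/funext => x; have [Hx|Hx] := pselect (HregL x).
    by rewrite (restrict_in _ Hx) (restrict_in f (Hreg_act Linv RD Ww Hx)).
  have Hw : ~ HregL (torus_act rW w x).
    move=> Hw; apply: Hx; have Wv : (w^-1)%g \in W by rewrite groupV.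
    by have := Hreg_act Linv RD Wv Hw; rewrite (torus_actM Linv _ Ww Wv) mulgV torus_act1.
  by rewrite (restrict_out _ Hx) (restrict_out f Hw).
have ID a (f G : torus L -> C^o) : I f -> regular_function G ->
    trig_dunkl_operator rW chi c a (f \_ HregL) = G \_ HregL -> I G.
  move=> [rf Nf] rG GE; split => //; rewrite -GE.
  exact: NX (gen_algebra_gen (daha_dunkl rW chi c a)) Nf.
have I1 : ~ I (fun _ => 1).
  move=> H1; apply: NnM; apply/seteqP; split => // _ [f rf <-].
  have [_] := ideal_mul II rf H1; congr (N _).
  by apply: eq_restrict => x _; rewrite mulr1.
have [x Zx] := torus_nullstellensatz Bunit LB II I1.
have [g Zg gb] := ideal_zero_spanning Linv RD HE II IW ID WG (ex_intro _ x Zx).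
exists g; last exact: gb.
rewrite -(topi_repr g); apply: (Red_of_ideal_zero Linv RD HE II IW ID Bunit LB).
  by rewrite topi_repr.
apply: contrapT => H; apply: Nn0; apply/seteqP; split => h; last by move=> ->.
move=> Nh; have [f rf fE] := NM _ Nh.
have f0 : f = (fun _ => 0).
  by apply: contrapT => f0; apply: H; exists f => //; split; rewrite ?fE.
by rewrite -fE f0; exact: restrict0.
Qed.

End RedFromReducible.

(** * Lie algebras: abelian ideals and the Killing form *)

Section LieAlgebra.
Context {K : fieldType} {gg : vectType K}.
Variable br : gg -> gg -> gg.
Hypothesis LB : lie_bracket br.
Implicit Types (x y z : gg) (U V k : {vspace gg}).

Let brl z := lie_linear_l LB z.
Let brr x := lie_linear_r LB x.

Lemma brZDl z (a : K) x y : br (a *: x + y) z = a *: br x z + br y z.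
Proof. exact: brl. Qed.

Lemma brZDr z (a : K) x y : br z (a *: x + y) = a *: br z x + br z y.
Proof. exact: brr. Qed.

Lemma br0l z : br 0 z = 0.
Proof. by have := brZDl z (-1) 0 0; rewrite scaler0 addr0 scaleN1r addNr. Qed.

Lemma br0r z : br z 0 = 0.
Proof. by have := brZDr z (-1) 0 0; rewrite scaler0 addr0 scaleN1r addNr. Qed.

Lemma brZl z (a : K) x : br (a *: x) z = a *: br x z.
Proof. by rewrite -[a *: x]addr0 brZDl br0l addr0. Qed.

Lemma brZr z (a : K) x : br z (a *: x) = a *: br z x.
Proof. by rewrite -[a *: x]addr0 brZDr br0r addr0. Qed.

Lemma brDl z x y : br (x + y) z = br x z + br y z.
Proof. by rewrite -{1}[x]scale1r brZDl scale1r. Qed.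

Lemma brDr z x y : br z (x + y) = br z x + br z y.
Proof. by rewrite -{1}[x]scale1r brZDr scale1r. Qed.

Lemma br_suml (I : Type) (r : seq I) (F : I -> gg) z : br (\sum_(i <- r) F i) z = \sum_(i <- r) br (F i) z.
Proof.
elim: r => [|i r IH]; first by rewrite !big_nil br0l.
by rewrite !big_cons brDl IH.
Qed.

Lemma br_sumr (I : Type) (r : seq I) (F : I -> gg) z : br z (\sum_(i <- r) F i) = \sum_(i <- r) br z (F i).
Proof.
elim: r => [|i r IH]; first by rewrite !big_nil br0r.
by rewrite !big_cons brDr IH.
Qed.

Lemma br_anti x y : br x y = - br y x.
Proof.
apply/eqP; rewrite -addr_eq0; apply/eqP.
have := lie_alternating LB (x + y).
by rewrite brDl !brDr !(lie_alternating LB) add0r addr0.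
Qed.

Lemma br_derivation x y z : br x (br y z) = br (br x y) z + br y (br x z).
Proof.
have := lie_jacobi LB x y z; rewrite (br_anti z x) (br_anti z (br x y)).
rewrite -[- br x z]scaleN1r brZr scaleN1r => /eqP.
by rewrite subr_eq0 subr_eq => /eqP.
Qed.

Lemma mem_lie_prod x y U V : x \in U -> y \in V -> br x y \in lie_prod br U V.
Proof.
move=> xU yV; rewrite (coord_vbasis xU) (coord_vbasis yV) br_suml.
apply: memv_suml => i _; rewrite brZl br_sumr; apply/memvZ/memv_suml => j _.
rewrite brZr; apply/memvZ/memv_span/allpairsP.
exists ((vbasis U)`_i, (vbasis V)`_j); split => //=; apply: mem_nth; rewrite size_tuple //.
Qed.

Lemma lie_prod_sub U V (Z : {vspace gg}) : (forall x y, x \in U -> y \in V -> br x y \in Z) ->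
  (lie_prod br U V <= Z)%VS.
Proof.
move=> H; apply/span_subvP => _ /allpairsP[[x y] /= [xU yV ->]].
by apply: H; apply: vbasis_mem.
Qed.

(** Bracketing with [z] is a derivation by the Jacobi identity. *)
Lemma lie_prod_stable k U : (forall z x, z \in k -> x \in U -> br z x \in U) ->
  forall z x, z \in k -> x \in lie_prod br U U -> br z x \in lie_prod br U U.
Proof.
move=> H z w zk wU.
pose adz : {linear gg -> gg} := HB.pack (br z) (GRing.isLinear.Build _ _ _ _ (br z) (brr z)).
have adzE x : linfun adz x = br z x by rewrite lfunE.
rewrite -adzE memv_preim; apply: subvP wU; apply: lie_prod_sub => x y xU yU.
rewrite -memv_preim adzE br_derivation.
by apply: memvD; apply: mem_lie_prod => //; exact: H.
Qed.

(* The last nonzero term of the derived series. *)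
Lemma solvable_abelian_ideal k I : lie_ideal br k I -> lie_solvable br I -> I <> 0%VS ->
  exists A : {vspace gg}, [/\ A <> 0%VS, (A <= k)%VS,
    forall z x, z \in k -> x \in A -> br z x \in A & forall x y, x \in A -> y \in A -> br x y = 0].
Proof.
move=> [Ik Iid] [m Dm] I0.
have Ist z x : z \in k -> x \in I -> br z x \in I.
  by move=> zk xI; apply: subvP (mem_lie_prod zk xI); exact: Iid.
elim: m I Ik Ist I0 Dm {Iid} => [|m IH] I Ik Ist I0 /=; first by move=> /I0.
have [D0|D0] := eqVneq (lie_prod br I I) 0%VS.
  move=> _; exists I; split => // x y xI yI.
  by apply/eqP; rewrite -memv0 -D0; exact: mem_lie_prod.
rewrite -[lie_prod _ _ _]/(iter m.+1 (fun U => lie_prod br U U) I) iterSr; apply: IH; last exact/eqP.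
- by apply: lie_prod_sub => x y xI yI; apply: subvP Ik _ (Ist x y (subvP Ik _ xI) yI).
- exact: lie_prod_stable.
Qed.

Lemma spanning_basis (s : seq gg) : exists t, [/\ free t, {subset t <= s} & span t = span s].
Proof.
elim: s => [|x s [t [ft ts tE]]]; first by exists [::]; rewrite nil_free.
have [xs|xs] := boolP (x \in span s).
  exists t; split => // [y yt|]; first by rewrite inE ts ?orbT.
  by rewrite span_cons tE; apply/esym/addv_idPr; rewrite -memvE.
exists (x :: t); split; last by rewrite !span_cons tE.
  by rewrite free_cons tE xs.
by move=> y; rewrite !inE => /orP[->//|/ts ->]; rewrite orbT.
Qed.

Section Killing.
Variables (d : nat) (X : d.-tuple gg).
Hypothesis XB : basis_of fullv X.

(** Row [i] holds the coordinates of the bracket of [x] with the [i]-th basis vector; the matrices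
    act on rows, so products appear in reversed order below. *)
Definition ad_mx x : 'M[K]_d := \matrix_(i, j) coord X j (br x X`_i).

Lemma ad_mxM x y : ad_mx x *m ad_mx y = \matrix_(i, j) coord X j (br y (br x X`_i)).
Proof.
apply/matrixP => i j; rewrite !mxE [in RHS](coord_basis XB (memvf (br x X`_i))) br_sumr.
rewrite linear_sum; apply: eq_bigr => l _.
by rewrite !mxE brZr linearZ.
Qed.

Lemma ad_mx_br x y : ad_mx (br x y) = ad_mx y *m ad_mx x - ad_mx x *m ad_mx y.
Proof.
rewrite !ad_mxM; apply/matrixP => i j; rewrite !mxE -linearB; congr (coord X j _).
by rewrite [br x (br y _)]br_derivation addrK.
Qed.

Lemma ad_mxZD (a : K) x y : ad_mx (a *: x + y) = a *: ad_mx x + ad_mx y.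
Proof. by apply/matrixP => i j; rewrite !mxE brZDl linearP. Qed.

Lemma ad_mx_eq0 x : ad_mx x = 0 -> forall y, br x y = 0.
Proof.
move=> M0 y; rewrite (coord_basis XB (memvf y)) br_sumr big1 // => i _.
rewrite brZr (coord_basis XB (memvf (br x X`_i))) big1 ?scaler0 // => j _.
by have /matrixP/(_ i j) := M0; rewrite !mxE => ->; rewrite scale0r.
Qed.

Definition killing x y : K := \tr (ad_mx x *m ad_mx y).

Lemma killingC x y : killing x y = killing y x.
Proof. exact: mxtrace_mulC. Qed.

Lemma killingZDl (a : K) x y z : killing (a *: x + y) z = a * killing x z + killing y z.
Proof. by rewrite /killing ad_mxZD mulmxDl mxtraceD -scalemxAl mxtraceZ. Qed.

Lemma killing0l x : killing 0 x = 0.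
Proof. by have := killingZDl (-1) 0 0 x; rewrite scaler0 addr0 mulN1r addNr. Qed.

Lemma killing_br x y z : killing (br x y) z = killing x (br y z).
Proof.
rewrite /killing !ad_mx_br mulmxBl mulmxBr !raddfB /= mulmxA.
rewrite [\tr (ad_mx y *m _ *m _)]mxtrace_mulC mulmxA mxtrace_mulC mulmxA -[in RHS]mulmxA.
by congr (_ - _); rewrite -!mulmxA.
Qed.

(** By invariance the radical of the form is an ideal, hence 0 or everything. A single nonzero value
    excludes the latter and takes the place of Cartan's criterion. *)
Lemma killing_nondegenerate : lie_simple br fullv -> (exists x y, killing x y != 0) ->
  forall x, (forall y, killing x y = 0) -> x = 0.
Proof.
move=> [_ simple] [x0 [y0 K0]] x Hx.
have kl : linear (fun x => \row_i killing x X`_i : 'rV[K]_d).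
  by move=> a u v; apply/rowP => i; rewrite !mxE killingZDl.
pose kf : {linear gg -> 'rV[K]_d} := HB.pack (fun x => \row_i killing x X`_i : 'rV[K]_d)
  (GRing.isLinear.Build _ _ _ _ _ kl).
pose N := lker (linfun kf).
have NP z : reflect (forall y, killing z y = 0) (z \in N).
  rewrite memv_ker lfunE /=; apply: (iffP eqP) => [H y|H]; last by apply/rowP => i; rewrite !mxE H.
  rewrite killingC (coord_basis XB (memvf y)); elim/big_rec: _ => [|i w _ IH].
    exact: killing0l.
  by rewrite killingZDl IH addr0 killingC; have /rowP/(_ i) := H; rewrite !mxE => ->; rewrite mulr0.
have [N0|NT] : N = 0%VS \/ N = fullv.
  apply: simple; split; first exact: subvf.
  apply: lie_prod_sub => z w _ /NP Hw; apply/NP => y.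
  by rewrite killingC -killing_br killingC.
- by apply/eqP; rewrite -memv0 -N0; apply/NP.
- have /NP/(_ y0)/eqP : x0 \in N by rewrite NT memvf.
  by rewrite (negbTE K0).
Qed.

End Killing.
End LieAlgebra.

(** * Weight vectors for the Cartan subalgebra *)

Section Weights.
Context {R : realType} {n : nat}.
Local Notation C := (Cplx R).
Variables (gg : vectType C) (br : gg -> gg -> gg) (iota : 'Hom('rV[C]_n, gg)).
Variable Phi : set 'cV[C]_n.
Hypothesis SL : simple_lie_algebra_of br iota Phi.
Local Notation wv := (weight_vector br iota).
Implicit Types (x y z e : gg) (a b : 'rV[C]_n) (l : 'cV[C]_n).

Let LB := slie_bracket SL.

Lemma weight_vectorD l x y : wv l x -> wv l y -> wv l (x + y).
Proof. by move=> Hx Hy a; rewrite (brDr LB) Hx Hy scalerDr. Qed.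

Lemma weight_vector0 l : wv l 0.
Proof. by move=> a; rewrite (br0r LB) scaler0. Qed.

Lemma weight_vector_sum l (I : Type) (r : seq I) (P : pred I) (F : I -> gg) : (forall i, P i -> wv l (F i)) ->
  wv l (\sum_(i <- r | P i) F i).
Proof. by move=> H; apply: big_ind => //; [exact: weight_vector0 | exact: weight_vectorD]. Qed.

Lemma weight_vector_br l m x y : wv l x -> wv m y -> wv (l + m) (br x y).
Proof.
move=> Hx Hy a; rewrite (br_derivation LB) Hx Hy (brZl LB) (brZr LB) pairingDr scalerDl.
by [].
Qed.

Lemma weight_root l x : wv l x -> x != 0 -> l = 0 \/ Phi l.
Proof.
move=> Hx x0; have [->|l0] := eqVneq l 0; first by left.
by right; apply/(slie_roots SL l0); exists x.
Qed.

Lemma weight_basis : exists d (X : d.-tuple gg) (mu : 'I_d -> 'cV[C]_n),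
  basis_of fullv X /\ forall i, wv (mu i) X`_i /\ (mu i = 0 \/ Phi (mu i)).
Proof.
have [s sE sw] : exists2 s : seq gg, span s = fullv & forall x, x \in s -> exists l, wv l x.
  suff H (t : seq gg) : exists2 s : seq gg, (span t <= span s)%VS & forall x, x \in s -> exists l, wv l x.
    have [s ts sw] := H (vbasis fullv); exists s => //.
    by apply/eqP; rewrite eqEsubv subvf /= -(span_basis (vbasisP fullv)).
  elim: t => [|x t [s ts sw]]; first by exists [::].
  have [m [l [y [yw xE]]]] := slie_decomposition SL x.
  exists ([seq y i | i <- enum 'I_m] ++ s) => [|z].
    rewrite span_cons span_cat; apply: addvS => //; rewrite -memvE xE.
    by apply: memv_suml => i _; apply: memv_span; apply: map_f; rewrite mem_enum.
  by rewrite mem_cat => /orP[/mapP[i _ ->]|/sw//]; exists (l i).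
have [t [ft ts tE]] := spanning_basis s.
have tB : basis_of fullv (in_tuple t) by rewrite /basis_of /= ft tE sE eqxx.
have H (i : 'I_(size t)) : exists l, wv l (in_tuple t)`_i.
  by apply/sw/ts; apply: mem_nth.
have [mu muP] := choice H.
exists (size t), (in_tuple t), mu; split=> // i; split; first exact: muP.
apply: weight_root (muP i) _; apply: free_not0 ft _; exact: mem_nth.
Qed.

(* Products of factors [ad b - pairing b (l j)] extract the weight components. *)
Lemma weight_component (A : {vspace gg}) x : (forall a x, x \in A -> br (iota a) x \in A) ->
  x \in A -> x != 0 -> exists l e, [/\ wv l e, e != 0 & e \in A].
Proof.
move=> Ast; have [m [l [y [yw ->]]]] := slie_decomposition SL x; move=> xA x0.
(* A direction [b] on which distinct weights take distinct values, so that one operator separates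
   all of them. *)
have [b bP] : exists b, forall ij : 'I_m * 'I_m, l ij.1 != l ij.2 -> pairing b (l ij.1 - l ij.2) != 0.
  by apply: (generic_vector (P := fun ij : 'I_m * 'I_m => l ij.1 != l ij.2)) => ij; rewrite subr_eq0.
pose t j := pairing b (l j).
have PA (P : {poly C}) : \sum_j P.[t j] *: y j \in A.
  elim/poly_ind: P => [|P z IH]; first by rewrite big1 ?mem0v // => j _; rewrite horner0 scale0r.
  have -> : \sum_j (P * 'X + z%:P).[t j] *: y j = br (iota b) (\sum_j P.[t j] *: y j) + z *: \sum_j y j.
    rewrite (br_sumr LB) scaler_sumr -big_split; apply: eq_bigr => j _ /=.
    by rewrite hornerMXaddC scalerDl (brZr LB) yw scalerA.
  by apply: memvD; [exact: Ast | exact: memvZ].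
pose e i := \sum_(j | l j == l i) y j.
have we i : wv (l i) (e i) by apply: weight_vector_sum => j /eqP <-.
have eA i : e i \in A.
  pose P := \prod_(j | l j != l i) ('X - (t j)%:P).
  have P0 : P.[t i] != 0.
    rewrite horner_prod; apply/prodf_neq0 => j ji; rewrite hornerXsubC /t -pairingBr.
    by apply: (bP (i, j)); rewrite eq_sym.
  have := PA P; rewrite (bigID (fun j => l j == l i)) /= [X in _ + X]big1 => [|j ji]; last first.
    have Pj : P.[t j] = 0.
      apply/eqP; rewrite horner_prod; apply/prodf_eq0; exists j; first exact: ji.
      by rewrite hornerXsubC subrr.
    by rewrite Pj scale0r.
  rewrite addr0 (eq_bigr (fun j => P.[t i] *: y j)) => [|j /eqP ji]; last by rewrite /t ji.
  by rewrite -scaler_sumr => /(memvZ (P.[t i])^-1); rewrite scalerA mulVf // scale1r.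
have [/existsP[i ei]|/existsPn H] := boolP [exists i, e i != 0]; first by exists (l i), (e i).
(* [e i] collects all summands with the weight of [i], so the same component occurs [k i] times as
   [i] varies; weighting by the inverse of [k i] recovers the vector. *)
pose k i : C := #|[pred j | l j == l i]|%:R.
have k0 i : k i != 0.
  by rewrite pnatr_eq0 -lt0n; apply/card_gt0P; exists i; rewrite inE.
move/negP: x0; case; apply/eqP.
transitivity (\sum_i (k i)^-1 *: e i); last by rewrite big1 // => i _; have := H i; rewrite negbK => /eqP ->; rewrite scaler0.
under [RHS]eq_bigr do rewrite scaler_sumr.
rewrite (exchange_big_dep predT) //=; apply: eq_bigr => j _.
rewrite (eq_bigr (fun _ => (k j)^-1 *: y j)) => [|i /eqP ij]; last by rewrite /k ij.
rewrite sumr_const -scaler_nat scalerA; set c := #|_|.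
have -> : c%:R = k j :> C by rewrite /k /c; congr (_%:R); apply: eq_card => i; rewrite !inE eq_sym.
by rewrite mulfV // scale1r.
Qed.

Variables (d : nat) (X : d.-tuple gg) (mu : 'I_d -> 'cV[C]_n).
Hypothesis XB : basis_of fullv X.
Hypothesis Xw : forall i, wv (mu i) X`_i.

Lemma ad_mx_iota b : ad_mx br X (iota b) = diag_mx (\row_i pairing b (mu i)).
Proof.
apply/matrixP => i j; rewrite !mxE Xw linearZ /= coord_free ?(basis_free XB) // eq_sym.
by case: (j == i); rewrite ?mulr1 ?mulr0.
Qed.

Lemma killing_iota a b : killing br X (iota a) (iota b) = \sum_i pairing a (mu i) * pairing b (mu i).
Proof.
rewrite /killing !ad_mx_iota mulmx_diag mxtrace_diag.
by apply: eq_bigr => i _; rewrite !mxE.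
Qed.

(** Invariance under the Cartan element of [a] gives $-\langle a,l\rangle\kappa = \langle
    a,m\rangle\kappa$ for the value $\kappa$ of the form, and [a] can be chosen off the kernel of $l
    + m$. *)
Lemma killing_weight l m x y : wv l x -> wv m y -> l + m != 0 -> killing br X x y = 0.
Proof.
move=> Hx Hy lm; have [a am] : exists a, pairing a (l + m) != 0.
  apply: contrapT => H; move/negP: lm; apply; apply/eqP/pairing_eq0 => a.
  by apply/eqP; apply: contrapT => /negP am; apply: H; exists a.
have E : killing br X (br x (iota a)) y = killing br X x (br (iota a) y) := killing_br LB XB x (iota a) y.
have {}E : - pairing a l * killing br X x y = pairing a m * killing br X x y.
  move: E; rewrite (br_anti LB) Hx Hy -scaleNr -[- _ *: x]addr0 (killingZDl LB) (killing0l LB) addr0 => ->.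
  rewrite (killingC br X x) -[_ *: y]addr0 (killingZDl LB) (killing0l LB) addr0.
  by rewrite (killingC br X y).
apply/eqP; have : pairing a (l + m) * killing br X x y = 0.
  by rewrite pairingDr mulrDl -E mulNr addrN.
by move/eqP; rewrite mulf_eq0 (negbTE am).
Qed.

(* [ad b] is a commutator commuting with one of its factors, so all its powers are traceless. *)
Lemma commutator_weights_eq0 l e y b : wv l e -> br e y = iota b -> pairing b l = 0 ->
  forall i, pairing b (mu i) = 0.
Proof.
move=> He ey bl; pose t i := pairing b (mu i).
pose D k : 'M[C]_d := diag_mx (\row_i t i ^+ k).
have TE : ad_mx br X (iota b) = D 1 by rewrite ad_mx_iota; congr diag_mx; apply/rowP => i; rewrite !mxE expr1.
(* Since [b] kills the weight of [e], the matrices of [e] and of [iota b] commute, so that of [e]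
   respects the eigenspaces of the latter. *)
have Ez i j : t i != t j -> ad_mx br X e i j = 0.
  move=> tij; have : ad_mx br X (br (iota b) e) = 0.
    by rewrite He bl scale0r; apply/matrixP => i' j'; rewrite !mxE (br0l LB) linear0.
  rewrite (ad_mx_br LB XB) TE /D mul_diag_mx mul_mx_diag => /matrixP/(_ i j); rewrite !mxE !expr1.
  rewrite [X in X - _]mulrC -mulrBl => /eqP; rewrite mulf_eq0 subr_eq0 [t j == _]eq_sym (negbTE tij).
  by move/eqP.
have DE k : D k *m ad_mx br X e = ad_mx br X e *m D k.
  rewrite /D mul_diag_mx mul_mx_diag; apply/matrixP => i j.
  have [tij|/Ez E0] := eqVneq (t i) (t j); first by rewrite !mxE tij mulrC.
  by move: E0; rewrite !mxE => ->; rewrite mulr0 mul0r.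
have tr0 k : \sum_i t i * t i ^+ k = 0.
  have <- : \tr (D k *m ad_mx br X (br e y)) = \sum_i t i * t i ^+ k.
    rewrite ey TE /D mulmx_diag mxtrace_diag; apply: eq_bigr => i _.
    by rewrite !mxE expr1 mulrC.
  rewrite (ad_mx_br LB XB) mulmxBr raddfB /= !mulmxA DE.
  by rewrite mxtrace_mulC mulmxA subrr.
(* Interpolating $z \mapsto z^{-1}$, which sends 0 to 0, turns the vanishing traces into the number
   of nonzero eigenvalues, which is therefore 0. *)
have := moments_eq0 tr0 (fun z : C => z^-1).
rewrite (eq_bigr (fun i => (t i != 0)%:R)) => [H i|i _]; last first.
  by have [->|ti] := eqVneq (t i) 0; rewrite ?mul0r ?mulfV.
have := psumr_eq0P (fun i _ => ler0n C (t i != 0)) H (i := i) isT.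
by move/eqP; rewrite pnatr_eq0 eqb0 negbK => /eqP.
Qed.

End Weights.

(** * Opposite root vectors and semisimple centralizers *)

Section Sigma.
Context {R : realType} {gT : finGroupType} {W : {group gT}} {n : nat}.
Local Notation C := (Cplx R).
Variable rW : mx_representation C W n.
Variable L : zmodClosed 'rV[C]_n.
Variables (alpha : gT -> 'cV[C]_n) (alphav : gT -> 'rV[C]_n).
Variables (gg : vectType C) (br : gg -> gg -> gg) (iota : 'Hom('rV[C]_n, gg)).
Variable Ad : torus L -> 'End(gg).
Hypothesis WG : weyl_group_repr rW.
Hypothesis Linv : invariant_lattice rW L.
Hypothesis RD : root_data rW L alpha alphav.
Hypothesis SL : simple_lie_algebra_of br iota (root_set rW alpha).
Hypothesis AA : adjoint_action br iota Ad.
Local Notation wv := (weight_vector br iota).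
Implicit Types (x y z e : gg) (a b : 'rV[C]_n) (l : 'cV[C]_n).

Let LB := slie_bracket SL.

Lemma root_vector s : reflection rW s -> exists2 x, x != 0 & wv (alpha s) x.
Proof. by move=> rs; apply/(slie_roots SL (alpha_neq0 RD rs)); exists s => //; left. Qed.

Lemma root_set_pairing s l : reflection rW s -> l = 0 \/ root_set rW alpha l ->
  exists m : int, pairing (alphav s) l = m%:~R.
Proof.
move=> rs [->|[t rt lt]]; first by exists 0; rewrite pairing0r.
have [m mE] := alpha_dual Linv RD rt (coroot_lattice RD rs).
by case: lt => ->; [exists m | exists (- m); rewrite pairingNr mE mulrNz].
Qed.

(** The coroot takes integral values on the weights, so the form is a sum of squares of integers. If
    it were 0, [iota (alphav s)] would be central, although it acts by 2 on a root vector for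
    [alpha s]. *)
Lemma killing_neq0 s d (X : d.-tuple gg) (mu : 'I_d -> 'cV[C]_n) : reflection rW s ->
  basis_of fullv X -> (forall i, wv (mu i) X`_i /\ (mu i = 0 \/ root_set rW alpha (mu i))) ->
  killing br X (iota (alphav s)) (iota (alphav s)) != 0.
Proof.
move=> rs XB Xw; have Xw1 i := (Xw i).1.
have [m mE] := choice (fun i => root_set_pairing rs (Xw i).2).
apply/negP; rewrite (killing_iota XB Xw1) => /eqP K0.
have t0 i : pairing (alphav s) (mu i) = 0.
  have pos j : true -> 0 <= pairing (alphav s) (mu j) * pairing (alphav s) (mu j).
    by move=> _; rewrite mE -intrM ler0z -expr2 sqr_ge0.
  have := psumr_eq0P pos K0 (i := i) isT.
  by move/eqP; rewrite mulf_eq0 orbb => /eqP.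
have A0 : ad_mx br X (iota (alphav s)) = 0.
  by rewrite (ad_mx_iota XB Xw1); apply/matrixP => i j; rewrite !mxE t0 mul0rn.
have [x x0 wx] := root_vector rs.
have := ad_mx_eq0 LB XB A0 x; rewrite wx (root_pairing RD rs) => /eqP.
by rewrite scaler_eq0 (negbTE x0) pnatr_eq0.
Qed.

(** Nondegeneracy gives a [y] pairing nontrivially with [e], and orthogonality of weights lets it be
    taken of weight $-l$. Then the bracket of [e] and [y] has weight 0, so it is some [iota b]. If
    [b] killed [l], it would kill all weights and be 0, and invariance would make the pairing of [e]
    with [y] vanish. *)
Lemma opposite_weight_vector l e : wv l e -> e != 0 -> l != 0 ->
  exists y b, [/\ wv (- l) y, br e y = iota b & pairing b l != 0].
Proof.
move=> He e0 l0.
have [d [X [mu [XB Xw]]]] := weight_basis SL.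
have Xw1 i := (Xw i).1.
have [s rs _] : root_set rW alpha l by apply/(slie_roots SL l0); exists e.
have KN : exists x y, killing br X x y != 0.
  by exists (iota (alphav s)), (iota (alphav s)); exact: killing_neq0 Xw.
have [y Ky] : exists y, killing br X e y != 0.
  apply: contrapT => H; move/negP: e0; apply; apply/eqP.
  apply: (killing_nondegenerate LB XB (slie_simple SL) KN) => y.
  by apply/eqP; apply: contrapT => /negP N; apply: H; exists y.
have {y Ky}[y yw Ky] : exists2 y, wv (- l) y & killing br X e y != 0.
  have [m [l' [z [zw yE]]]] := slie_decomposition SL y.
  apply: contrapT => H; move/negP: Ky; apply; apply/eqP; rewrite yE.
  rewrite (killingC br X e); elim/big_rec: _ => [|i w _ IH]; first exact: (killing0l LB).
  rewrite -[z i]scale1r (killingZDl LB) mul1r IH addr0 (killingC br X _ e).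
  have [E|ne] := eqVneq (l + l' i) 0; last exact: (killing_weight SL XB He (zw i) ne).
  apply/eqP; apply: contrapT => /negP N; apply: H; exists (z i) => //.
  by have -> : - l = l' i by apply/eqP; rewrite eq_sym -addr_eq0 addrC E.
have [b bE] : exists b, br e y = iota b.
  have : wv 0 (br e y) by rewrite -(subrr l); exact: (weight_vector_br SL He yw).
  by move=> /(slie_cartan SL)/memv_imgP[b _ ->]; exists b.
exists y, b; split=> //; apply/negP => /eqP bl.
have t0 := commutator_weights_eq0 SL XB Xw1 He bE bl.
have A0 : ad_mx br X (iota b) = 0.
  by rewrite (ad_mx_iota XB Xw1); apply/matrixP => i j; rewrite !mxE t0 mul0rn.
have b0 : b = 0.
  apply: (roots_separate RD WG) => s' rs'; have [x x0 wx] := root_vector rs'.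
  have := ad_mx_eq0 LB XB A0 x; rewrite wx => /eqP.
  by rewrite scaler_eq0 (negbTE x0) orbF => /eqP.
have [a al] : exists a, pairing a l != 0.
  apply: contrapT => H; move/negP: l0; apply; apply/eqP/pairing_eq0 => a.
  by apply/eqP; apply: contrapT => /negP al; apply: H; exists a.
have := killing_br LB XB (iota a) e y.
rewrite He bE b0 linear0 (killingC br X (iota a)) (killing0l LB) -[_ *: e]addr0 (killingZDl LB) (killing0l LB) addr0.
by move/eqP; rewrite mulf_eq0 (negbTE al) (negbTE Ky).
Qed.

Lemma centralizer_weight u l x : wv l x -> x != 0 ->
  (x \in centralizer Ad (topi L u)) = (cexp (pairing u l) == 1).
Proof.
move=> wx x0; apply/fixedSpaceP/eqP => [|l1]; rewrite (AA u wx); last by rewrite l1 scale1r.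
move=> /eqP; rewrite -subr_eq0 -{2}[x]scale1r -scalerBl scaler_eq0 (negbTE x0) orbF.
by rewrite subr_eq0 => /eqP.
Qed.

(* An abelian ideal contains a weight vector [e]; the stabilizer roots, resp. an opposite weight vector,
   bracket nontrivially with [e]. *)
Lemma Sigma_of_spanning (g : torus L) :
  (forall b, (forall s, reflection rW s -> s \in stabilizer rW g -> pairing b (alpha s) = 0) -> b = 0) ->
  Sigma br Ad g.
Proof.
rewrite -(topi_repr g); set u := repr g => span_g I Iid Isol.
apply: contrapT => I0.
have [A [A0 Ak Ast Aab]] := solvable_abelian_ideal LB Iid Isol I0.
have ik a : iota a \in centralizer Ad (topi L u).
  have wa : wv 0 (iota a) by apply/(slie_cartan SL); rewrite memv_img ?memvf.
  by apply/fixedSpaceP; rewrite (AA u wa) pairing0r cexp0 scale1r.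
have [x xA x0] : exists2 x, x \in A & x != 0.
  exists (vpick A); first exact: memv_pick.
  by rewrite vpick0; apply/eqP.
have [l [e [we e0 eA]]] := weight_component SL (fun a x => Ast _ x (ik a)) xA x0.
have [l0|l0] := eqVneq l 0.
  move: we; rewrite l0 => /(slie_cartan SL)/memv_imgP[b _ eb].
  have b0 : b = 0.
    apply: span_g => s rs Gs; have [y y0 wy] := root_vector rs.
    have yk : y \in centralizer Ad (topi L u).
      by rewrite (centralizer_weight u wy y0) -(stabilizer_reflection Linv RD u rs).
    (* The inner bracket lies in the abelian [A], so the outer one is 0; computed by weights, it is
       the square of [pairing b (alpha s)] times [y]. *)
    have : br e (br e y) = 0.
      by apply: Aab => //; rewrite (br_anti LB) memvN; exact: Ast.
    rewrite eb wy (brZr LB) wy scalerA => /eqP.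
    by rewrite scaler_eq0 (negbTE y0) orbF mulf_eq0 orbb => /eqP.
  by move/negP: e0; apply; rewrite eb b0 linear0.
have [y [b [wy ey bl]]] := opposite_weight_vector we e0 l0.
(* The character of $-l$ at [u] is the inverse of that of [l], so [y] centralizes too and [iota b]
   falls into [A]. It must then commute with [e], which contradicts that [b] does not kill [l]. *)
have bA : iota b \in A.
  rewrite -ey; have [->|y0] := eqVneq y 0; first by rewrite (br0r LB) mem0v.
  rewrite (br_anti LB) memvN; apply: Ast => //.
  rewrite (centralizer_weight u wy y0) pairingNr cexpN invr_eq1.
  by rewrite -(centralizer_weight u we e0) (subvP Ak).
move/eqP: (Aab _ _ bA eA); rewrite we scaler_eq0 (negbTE e0) orbF.
by apply/negP.
Qed.

End Sigma.

Theorem theorem5p3 (R : realType) (gT : finGroupType) (W : {group gT}) (n : nat)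
    (rW : mx_representation (Cplx R) W n)
    (L : zmodClosed 'rV[Cplx R]_n)
    (alpha : gT -> 'cV[Cplx R]_n) (alphav : gT -> 'rV[Cplx R]_n)
    (gg : vectType (Cplx R)) (br : gg -> gg -> gg)
    (iota : 'Hom('rV[Cplx R]_n, gg)) (Ad : torus L -> 'End(gg))
    (chi : set (torus L) -> torus L -> Cplx R)
    (c : set (torus L) -> Cplx R) :
  weyl_group_repr rW -> mx_irreducible rW ->
  is_lattice L -> invariant_lattice rW L ->
  root_data rW L alpha alphav ->
  simple_lie_algebra_of br iota (root_set rW alpha) ->
  adjoint_action br iota Ad ->
  hypertorus_equations rW chi ->
  conjugation_invariant rW c ->
  reducible_module (daha rW chi c) (polynomial_representation rW L) <->
  exists2 g, Sigma br Ad g & Red_at rW alpha g c.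
Proof.
move=> WG _ Llat Linv RD SL AA HE Hc; split=> [red|[g _ Rg]].
  have [g Rg g_span] := Red_of_reducible WG Llat Linv RD HE red.
  by exists g => //; exact: (Sigma_of_spanning WG Linv RD SL AA g_span).
exact: (reducible_of_Red Linv RD HE Hc Rg).
Qed.
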